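(* Let $V(\vec q)=-\kappa/|\vec q|$ be the Coulomb potential on $\mathbb{R}^3$, let $H=\frac{|\vec p|^2}{2\mu}+V(\vec q)$, and let particles with uniform spatial density $\nu$ and fixed momentum $\vec p_0$ in the asymptotic past scatter on $V$, with time evolution $\dot\rho=\{\!\{H,\rho\}\!\}$ given by a generalized Moyal bracket with arbitrary coefficients $a_n$. Let $\rho_{n,k}$ ($n,k\ge 0$) be the coefficients of $\hbar^{2n}\lambda^k$ in the perturbative solution obtained by replacing $V$ with $\lambda V$, and let $D_{n,k}(\vec q)=\int_{\mathbb{R}^3}\rho_{n,k}\,d^3p$. Let $\vartheta$ be the scattering angle (the angle between $\vec q$ and $\vec p_0$). Then: 1. The $\rho_{n,k}$ do not depend on time, and there are functions $f_{n,k}$ of the scattering angle $\vartheta$ alone such that $$D_{n,k}(\vec q)=\frac{f_{n,k}(\vartheta)}{|\vec q|^{2n+k}} .$$ 2. In the far field, i.e. in $\lim_{|\vec q|\to\infty}\sum_{n,k}\hbar^{2n}D_{n,k}(\vec q)\,|\vec q|^2\,d\Omega$, nonzero contributions can come only from the terms with $2n+k-2\le 0$, i.e. $n=0$, $k\le 2$ and $n=1$, $k=0$; since $\rho_{1,0}=0$, only the terms with $n=0$, $k\le2$ contribute. The terms with $n=0$ are exactly those obtained when the generalized bracket is replaced by the Poisson bracket. Consequently $\lim_{|\vec q|\to\infty}D(\vec q)|\vec q|^2d\Omega$ coincides with the prediction of classical theory, and for every generalized Moyal bracket the differential cross section is given by Rutherford's formula $$\frac{d\sigma}{d\Omega}=\frac{\kappa^2\mu^2}{4p_0^4}\,\frac{1}{\sin^4(\vartheta/2)},\qquad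 p_0=|\vec p_0| .$$
   Context: For phase-space functions (or distributions) $f,g$ on $\mathbb{R}^3\times\mathbb{R}^3$ define $fD_\omega^0g=fg$ and $fD_\omega^{m+1}g=\sum_{i=1}^3\left(\frac{\partial f}{\partial q_i}D_\omega^{m}\frac{\partial g}{\partial p_i}-\frac{\partial f}{\partial p_i}D_\omega^{m}\frac{\partial g}{\partial q_i}\right)$; $fD_\omega g=\{f,g\}$ is the Poisson bracket. The generalized Moyal bracket is $\{\!\{f,g\}\!\}=\sum_{n=0}^\infty a_n\hbar^{2n}fD_\omega^{2n+1}g$ with $a_0=1$ and dimensionless constants $a_1,a_2,\dots$ (here $a_n$ always denotes a bracket coefficient). The initial condition is $\rho\to\rho_{\mathrm{in}}$ as $t\to-\infty$ with $\rho_{\mathrm{in}}(\vec q,\vec p)=\nu\,\delta^{(3)}(\vec p-\vec p_0)$ (normalization is dropped). With the retarded Green's function of the free evolution, the evolution equation becomes the integral equation $$\rho(t;\vec q,\vec p)=\rho_{\mathrm{in}}(\vec q,\vec p)+\int_{\mathbb{R}^3}\int_{-\infty}^t K\!\left(\vec q-\tfrac{\vec p}{\mu}(t-\tau),\vec p,\vec p'\right)\rho\!\left(\tau;\vec q-\tfrac{\vec p}{\mu}(t-\tau),\vec p'\right)d\tau\, d^3p',$$ with $K(\vec q,\vec p,\vec p')=\{\!\{V(\vec q),\delta^{(3)}(\vec p-\vec p')\}\!\}$. Here $$V(\vec q)D_\omega^{m}\delta^{(3)}(\vec p-\vec p')=\sum_{i_1,\dots,i_m=1}^3\left(\partial_{q_{i_1}}\cdots\partial_{q_{i_m}}V(\vec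 q)\right)\left(\partial_{p_{i_1}}\cdots\partial_{p_{i_m}}\delta^{(3)}(\vec p-\vec p')\right),$$ and the argument $\vec q-\frac{\vec p}{\mu}(t-\tau)$ is inserted after the derivatives are taken. The perturbative solution is the series $\rho=\sum_{n,k\ge0}\hbar^{2n}\lambda^k\rho_{n,k}$ obtained with $V$ replaced by $\lambda V$ and comparison of coefficients: $\rho_{0,0}=\rho_{\mathrm{in}}$, $\rho_{n,0}=0$ for $n\ge1$, and for $k\ge1$ $$\rho_{n,k}(t;\vec q,\vec p)=\sum_{\tilde n=0}^n a_{n-\tilde n}\int_{\mathbb{R}^3}\int_0^\infty\left(VD_\omega^{2(n-\tilde n)+1}\delta^{(3)}(\vec p-\vec p')\right)\Big|_{\vec q\to\vec q-\frac{\vec p}{\mu}u}\ \rho_{\tilde n,k-1}\!\left(t-u;\vec q-\tfrac{\vec p}{\mu}u,\vec p'\right)du\,d^3p'.$$ The density of particles reaching a far detector in the solid angle $d\Omega$ is $\lim_{|\vec q|\to\infty}D(\vec q)|\vec q|^2d\Omega$ with $D(\vec q)=\int_{\mathbb{R}^3}\rho\,d^3p=\sum_{n,k}\hbar^{2n}D_{n,k}(\vec q)$ (at $\lambda=1$), the limit being analyzed term by term; the far-field differential cross section is determined by it. Classical theory is the case $a_n=0$ for all $n\ge1$; its differential cross section for the Coulomb potential is Rutherford's formula. *)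

(* Defs.v *)
From HB Require Import structures.
From mathcomp Require Import all_boot all_order all_algebra.
From mathcomp Require Import all_classical all_reals all_analysis.

Set Implicit Arguments.
Unset Strict Implicit.
Unset Printing Implicit Defensive.

Import Order.TTheory GRing.Theory Num.Theory.
Import numFieldNormedType.Exports.

Local Open Scope classical_set_scope.
Local Open Scope ring_scope.

(* The library norm on row vectors is the max norm, so the Euclidean structure
   of R^3 is spelled out here. *)
Definition dot (R : realType) (x y : 'rV[R]_3) : R :=
  \sum_(i < 3) x ord0 i * y ord0 i.

Definition enorm (R : realType) (x : 'rV[R]_3) : R := Num.sqrt (dot x x).

Definition angle (R : realType) (x y : 'rV[R]_3) : R :=
  acos (dot x y / (enorm x * enorm y)).

(* Row vectors carry no measurable structure in the library: integrals over R^3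
   are taken against Lebesgue measure on R * R * R. *)
Definition vec3 (R : realType) (x : R * R * R) : 'rV[R]_3 :=
  \row_(i < 3) [:: x.1.1; x.1.2; x.2]`_i.

Definition int3 (R : realType) (f : 'rV[R]_3 -> R) : R :=
  
  \int[((@lebesgue_measure R \x @lebesgue_measure R) \x @lebesgue_measure R)%E]_x
    f (vec3 x).

Definition pderiv (R : realType) (i : 'I_3) (f : 'rV[R]_3 -> R) : 'rV[R]_3 -> R :=
  fun x => 'D_(delta_mx ord0 i) f x.

Definition smooth (R : realType) (f : 'rV[R]_3 -> R) : Prop :=
  forall (I : seq 'I_3) (x : 'rV[R]_3),
    differentiable (foldr (fun i g => pderiv i g) f I) x.

Definition test_function (R : realType) (U : set 'rV[R]_3) (f : 'rV[R]_3 -> R) :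
  Prop :=
  let supp := closure [set x | f x != 0] in
  [/\ smooth f, compact supp & supp `<=` U].

(* Functions of (q, p), and distributions in (q, p).  The formulas below only
   involve the germ of the test function at p = p0, so a distribution is
   represented by a functional on all phase-space functions; this makes its
   value on psi(q), a test function that is constant in p, directly available. *)
Definition phase_fun (R : realType) := 'rV[R]_3 -> 'rV[R]_3 -> R.
Definition phase_dist (R : realType) := phase_fun R -> R.

Definition dq (R : realType) (i : 'I_3) (f : phase_fun R) : phase_fun R :=
  fun q p => pderiv i (fun x => f x p) q.

Definition dp (R : realType) (i : 'I_3) (f : phase_fun R) : phase_fun R :=
  fun q p => pderiv i (f q) p.

Fixpoint Domega (R : realType) (m : nat) (f g : phase_fun R) : phase_fun R :=
  if m is m'.+1 then
    fun q p => \sum_(i < 3)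
      (Domega m' (dq i f) (dp i g) q p - Domega m' (dp i f) (dq i g) q p)
  else fun q p => f q p * g q p.

Definition poisson (R : realType) (f g : phase_fun R) : phase_fun R :=
  fun q p => \sum_(i < 3) (dq i f q p * dp i g q p - dp i f q p * dq i g q p).

(* A bracket that is a power series in hbar^2; [B n] is the coefficient of
   hbar^(2n). *)
Definition bracket_series (R : realType) :=
  nat -> phase_fun R -> phase_fun R -> phase_fun R.

Definition moyal_series (R : realType) (a : nat -> R) : bracket_series R :=
  fun n f g q p => a n * Domega n.*2.+1 f g q p.

Definition poisson_series (R : realType) : bracket_series R :=
  fun n f g q p => if n == 0%N then poisson f g q p else 0.

Definition coulomb (R : realType) (kappa : R) (q : 'rV[R]_3) : R :=
  - kappa / enorm q.

(* The coefficient rho_{n,k}(t) of hbar^(2n) lambda^k, as a distribution on phase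
   space.  The base case is rho_in = nu delta(p - p0).  In the recursion,
     int dp' (V D^m delta(p - p')) rho(q, p') = sum_I (d_q^I V)(q) (d_p^I rho)(q, p),
   |I| = m, is paired with Phi after the substitution q -> q - p u / mu.  By
   duality the substitution becomes its (measure preserving) inverse acting on
   Phi, and the d_p^I, which commute with d_q^I V, act on Phi with the sign
   (-1)^m = -1, only odd m being present in the bracket.  Hence
     < B_j(V, rho) o S_u , Phi > = - < rho , B_j(V, Phi o S_u^-1) >,
   where S_u (q, p) = (q - p u / mu, p). *)
Fixpoint rho_coef (R : realType) (mu nu : R) (p0 : 'rV[R]_3) (V : 'rV[R]_3 -> R)
    (B : bracket_series R) (n k : nat) (t : R) (Phi : phase_fun R) {struct k} : R :=
  if k is k'.+1 then
    - \sum_(j < n.+1)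
        \int[@lebesgue_measure R]_(u in `[0, +oo[)
          rho_coef mu nu p0 V B j k' (t - u)
            (B (n - j)%N (fun q _ => V q) (fun q p => Phi (q + (u / mu) *: p) p))
  else if n == 0%N then nu * int3 (fun q => Phi q p0) else 0.

(* The complement of the half-line {s p0 | s >= 0}: the positions q <> 0 with
   nonzero scattering angle, i.e. those whose free backward trajectory q - p0 u / mu
   (u >= 0) avoids the singularity of V. *)
Definition off_forward_ray (R : realType) (p0 : 'rV[R]_3) : set 'rV[R]_3 :=
  [set q | forall s : R, 0 <= s -> q != s *: p0].

(* The distribution int T d^3p in q is, on the open set U, the continuous
   function D (which is unique on U). *)
Definition is_momentum_marginal (R : realType) (U : set 'rV[R]_3)
    (T : phase_dist R) (D : 'rV[R]_3 -> R) : Prop :=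
  (forall q, U q -> {for q, continuous D}) /\
  (forall psi, test_function U psi ->
     T (fun q _ => psi q) = int3 (fun q => D q * psi q)).

(* Contribution of hbar^(2n) D_{n,k} to lim D(q) |q|^2 in the direction of the
   unit vector e. *)
Definition far_field_term (R : realType) (hbar : R)
    (D : nat -> nat -> 'rV[R]_3 -> R) (e : 'rV[R]_3) (n k : nat) (l : \bar R) :
  Prop :=
  (hbar ^+ n.*2 * D n k (r *: e) * r ^+ 2)%:E @[r --> +oo] --> l.

(* Number of particles scattered into the solid angle per unit time and incident
   flux: the scattered density is D without the unscattered beam D_{0,0} = nu,
   and since incident and outgoing speeds are both |p0| / mu the quotient
   of fluxes is the quotient by nu of the far-field density. *)
Definition is_cross_section (R : realType) (hbar nu : R)
    (D : nat -> nat -> 'rV[R]_3 -> R) (e : 'rV[R]_3) (sigma : R) : Prop :=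
  exists l : nat -> nat -> R,
    [/\ l 0%N 0%N = 0,
        (forall n k, (n, k) != (0, 0)%N -> far_field_term hbar D e n k (l n k)%:E)
      & (\sum_(n < N) \sum_(k < N) l n k) / nu @[N --> \oo] --> sigma].

Definition rutherford (R : realType) (kappa mu : R) (p0 : 'rV[R]_3) (theta : R) : R :=
  kappa ^+ 2 * mu ^+ 2 / (4 * enorm p0 ^+ 4) * (sin (theta / 2) ^+ 4)^-1.

(* Main.v *)
Require Import Defs.
From HB Require Import structures.
From mathcomp Require Import all_boot all_order all_algebra.
From mathcomp Require Import all_classical all_reals all_analysis.
From mathcomp Require Import measurable_realfun.
From mathcomp Require Import ring lra zify.

(** Free motion, multiplication by derivatives of V and derivatives of delta(p - p0)
    preserve the distributions [Psi |-> sum_J int W_J(q) (d_p^J Psi)(q, p0) dq] whose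
    coefficients [W] are tensor fields on the complement of the forward ray, smooth,
    homogeneous of degree -(2n+k) and covariant under the rotations fixing p0.  A free
    shift by s turns d_p into d_p + s d_q; the q-derivatives are integrated by parts
    onto [W], and every time integral of u^l W(q - u p0 / mu) lowers the decay by l+1.
    On a test function of q alone only the scalar coefficient survives, and reflections
    map any two unit vectors with the same scattering angle to each other.

    At order hbar^0 the first-order field w is the integrated force.  It is divergence
    free since V is harmonic, so D_01 = 0, and q.w is constant.  Hence div div (w grad V)
    is a multiple of |q|^-5, and its time integral of weight u^2 has an elementary
    antiderivative, which yields Rutherford's formula. *)

(** The exponent [2n+k] is a balance. Order [(j, k)] has decay [2j+k]; multiplying by derivatives of
    V of order [2(n-j)+1] adds [2(n-j)+2], and the time integral takes one back, which leaves
    [2n+k+1]. Convergence holds at every order because V enters only differentiated: each field to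
    be integrated decays at least like the inverse square along the ray, and an integration by parts
    raises the weight [u^l] and the decay together. Uniform bounds follow from homogeneity, since a
    backward ray, rescaled, stays in a compact segment ending at [- p0]. The coefficients are not
    controlled on the forward ray, hence the restriction to [off_forward_ray p0], which backward
    motion preserves. A free shift moves the q-support by an amount depending on p, so test
    functions are controlled only for p near [p0]. In the far field the term of decay one would
    diverge unless it vanished identically; homogeneity cannot exclude it, and harmonicity of V
    does. *)

Set Implicit Arguments.
Unset Strict Implicit.
Unset Printing Implicit Defensive.
Import Order.TTheory GRing.Theory Num.Theory.
Import numFieldNormedType.Exports.
Local Open Scope classical_set_scope.
Local Open Scope ring_scope.

(** * Iterated directional derivatives *)

Section SmoothOn.
Context {R : realType} {E : normedModType R}.
Implicit Types (f g : E -> R) (x a : E) (O : set E).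

Definition dirD a f : E -> R := fun x => 'D_a f x.

(* Weaker than continuous Frechet differentiability, but stable under integrals
   with a parameter and enough for the symmetry of second derivatives. *)
Definition c1_at f x := [/\ {for x, continuous f}, (forall a, derivable f x a)
  & forall k a b, 'D_(k *: a + b) f x = k * 'D_a f x + 'D_b f x].

Definition smooth_on O f := forall s x, O x -> c1_at (foldr dirD f s) x.

Lemma near_dirD a f g x : {near x, f =1 g} -> {near x, dirD a f =1 dirD a g}.
Proof.
move=> /near_join; apply: filterS => y fg.
exact: near_eq_derive.
Qed.

Lemma near_iterD s f g x : {near x, f =1 g} ->
  {near x, foldr dirD f s =1 foldr dirD g s}.
Proof. by move=> fg; elim: s => //= a s; exact: near_dirD. Qed.

Lemma c1_at_near f g x : {near x, f =1 g} -> c1_at f x -> c1_at g x.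
Proof.
move=> fg [cf df lf]; split.
- have fgx : f x = g x by exact: nbhs_singleton fg.
  rewrite /prop_for /continuous_at -fgx.
  apply: cvg_trans cf; apply: near_eq_cvg; exact: fg.
- by move=> a; exact: near_eq_derivable fg (df a).
- move=> k a b.
  have H c : 'D_c g x = 'D_c f x by apply: near_eq_derive; apply: filterS fg.
  by rewrite !H lf.
Qed.

Lemma eq_smooth_on O f g : open O -> {in O, f =1 g} -> smooth_on O f ->
  smooth_on O g.
Proof.
move=> oO fg sf s x Ox; apply: c1_at_near (sf s x Ox).
apply: near_iterD; have := open_nbhs_nbhs (conj oO Ox).
by apply: filterS => y Oy; apply: fg; rewrite inE.
Qed.

Lemma smooth_onS O O' f : O' `<=` O -> smooth_on O f -> smooth_on O' f.
Proof. by move=> OO sf s x /OO; exact: sf. Qed.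

Lemma smooth_onU O O' f : smooth_on O f -> smooth_on O' f ->
  smooth_on (O `|` O') f.
Proof. by move=> sf sf' s x [/sf|/sf']; exact. Qed.

Lemma smooth_dirD O a f : smooth_on O f -> smooth_on O (dirD a f).
Proof. by move=> sf s x Ox; have := sf (rcons s a) x Ox; rewrite foldr_rcons. Qed.

Lemma smooth_iterD O s f : smooth_on O f -> smooth_on O (foldr dirD f s).
Proof. by move=> sf; elim: s => //= a s; exact: smooth_dirD. Qed.

Lemma smooth_cont O f x : smooth_on O f -> O x -> {for x, continuous f}.
Proof. by move=> sf Ox; have [] := sf [::] x Ox. Qed.

Lemma smooth_derivable O f x a : smooth_on O f -> O x -> derivable f x a.
Proof. by move=> sf Ox; have [] := sf [::] x Ox. Qed.

Lemma smooth_lin O f x k a b : smooth_on O f -> O x ->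
  'D_(k *: a + b) f x = k * 'D_a f x + 'D_b f x.
Proof. by move=> sf Ox; have [_ _] := sf [::] x Ox; exact. Qed.

(** A coinduction principle: if derivatives of members of [G] are again members up to equality on
    the open set [O], then so are all iterated derivatives, and [c1_at] for members suffices.
    Equality on [O] only leaves the values elsewhere free. *)
Lemma smooth_coind O (G : set (E -> R)) : open O ->
  (forall f, G f -> forall x, O x -> c1_at f x) ->
  (forall f a, G f -> exists2 g, G g & forall x, O x -> dirD a f x = g x) ->
  forall f, G f -> smooth_on O f.
Proof.
move=> oO Gc1 GD f Gf s x Ox.
have [g Gg fg] : exists2 g, G g & forall x, O x -> foldr dirD f s x = g x.
  elim: s => [|a s [g Gg fg]] /=; first by exists f.
  have [h Gh gh] := GD g a Gg; exists h => // y Oy.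
  rewrite -gh //; apply: near_eq_derive.
  by apply: filterS (open_nbhs_nbhs (conj oO Oy)) => z; exact: fg.
apply: c1_at_near (Gc1 g Gg x Ox).
by apply: filterS (open_nbhs_nbhs (conj oO Ox)) => z /fg ->.
Qed.

Lemma c1_cst (c : R) x : c1_at (fun=> c) x.
Proof.
split=> [|a|k a b]; [exact: cvg_cst | exact: derivable_cst|].
by rewrite !derive_cst mulr0 addr0.
Qed.

Lemma c1_add f g x : c1_at f x -> c1_at g x -> c1_at (fun x => f x + g x) x.
Proof.
move=> [cf df lf] [cg dg lg]; split=> [|a|k a b].
- exact: cvgD.
- exact: derivableD.
- by rewrite !(@deriveD _ _ _ f g) // lf lg mulrDr addrACA.
Qed.

Lemma c1_mul f g x : c1_at f x -> c1_at g x -> c1_at (fun x => f x * g x) x.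
Proof.
move=> [cf df lf] [cg dg lg]; split=> [|a|k a b].
- exact: cvgM.
- exact: derivableM.
- rewrite !(@deriveM _ _ f g) // lf lg.
move: ('D_a f x) ('D_b f x) ('D_a g x) ('D_b g x) (f x) (g x) => ? ? ? ? ? ?.
rewrite /GRing.scale /=; ring.
Qed.

Lemma diff_c1 f x : differentiable f x -> c1_at f x.
Proof.
move=> df; split=> [|a|k a b].
- exact: differentiable_continuous.
- exact: diff_derivable.
- by rewrite !deriveE // linearP.
Qed.

Lemma smooth_cst O (c : R) : open O -> smooth_on O (fun=> c).
Proof.
move=> oO; apply: (@smooth_coind O [set f | exists c, f = fun=> c]) => //=.
- by move=> _ [k ->] x _; exact: c1_cst.
- move=> _ a [k ->]; exists (fun=> 0); first by exists 0.
  by move=> x _; exact: derive_cst.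
- by exists c.
Qed.

Lemma smooth_add O f g : open O -> smooth_on O f -> smooth_on O g ->
  smooth_on O (fun x => f x + g x).
Proof.
move=> oO sf sg; apply: (@smooth_coind O [set h | exists f g,
  [/\ smooth_on O f, smooth_on O g & h = fun x => f x + g x]]) => //=.
- move=> _ [f1 [g1 [sf1 sg1 ->]]] x Ox.
  by apply: c1_add; [exact: (sf1 [::])|exact: (sg1 [::])].
- move=> _ a [f1 [g1 [sf1 sg1 ->]]].
  exists (fun x => dirD a f1 x + dirD a g1 x).
    exists (dirD a f1), (dirD a g1).
    by split; [exact: smooth_dirD..|].
  by move=> x Ox; apply: deriveD; apply: smooth_derivable Ox.
- by exists f, g.
Qed.

(** Leibniz's rule leaves the class of products, so the class handed to [smooth_coind] is their
    closure under sums. *)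
Inductive sumprod O : (E -> R) -> Prop :=
| sumprodM f g of smooth_on O f & smooth_on O g : sumprod O (fun x => f x * g x)
| sumprodD f g of sumprod O f & sumprod O g : sumprod O (fun x => f x + g x).

Lemma smooth_mul O f g : open O -> smooth_on O f -> smooth_on O g ->
  smooth_on O (fun x => f x * g x).
Proof.
move=> oO sf sg; apply: (@smooth_coind O (sumprod O)) => //; last exact: sumprodM.
- move=> h; elim=> [f1 g1 sf1 sg1|f1 g1 _ IHf _ IHg] x Ox.
    by apply: c1_mul; [exact: (sf1 [::])|exact: (sg1 [::])].
  by apply: c1_add; [exact: IHf|exact: IHg].
(* Derivability is proved along with the formula, since the sum rule requires it. *)
- move=> h a Gh; suff [g1 Gg1 [H1 _]] : exists2 g, sumprod O g &
      (forall x, O x -> dirD a h x = g x) /\ (forall x, O x -> derivable h x a).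
    by exists g1.
  elim: Gh => {h} [f1 g1 sf1 sg1|f1 g1 _ [f2 Gf2 [H2 d2]] _ [g2 Gg2 [H3 d3]]].
    exists (fun x => f1 x * dirD a g1 x + g1 x * dirD a f1 x).
      by apply: sumprodD; apply: sumprodM => //; exact: smooth_dirD.
    split=> x Ox.
      by apply: deriveM; apply: smooth_derivable Ox.
    by apply: derivableM; apply: smooth_derivable Ox.
  exists (fun x => f2 x + g2 x); first exact: sumprodD.
  split=> x Ox; last by apply: derivableD; [exact: d2|exact: d3].
  by rewrite -H2 // -H3 //; apply: deriveD; [exact: d2|exact: d3].
Qed.

Lemma smooth_scale O (c : R) f : open O -> smooth_on O f ->
  smooth_on O (fun x => c * f x).
Proof. by move=> oO sf; apply: smooth_mul => //; exact: smooth_cst. Qed.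

Lemma smooth_sum O (I : Type) (r : seq I) (F : I -> E -> R) : open O ->
  (forall i, smooth_on O (F i)) -> smooth_on O (fun x => \sum_(i <- r) F i x).
Proof.
move=> oO sF; elim: r => [|i r IH].
  by under [fun x => _]eq_fun do rewrite big_nil; exact: smooth_cst.
under [fun x => _]eq_fun do rewrite big_cons.
exact: smooth_add.
Qed.

End SmoothOn.

(** * Composition with affine maps *)

Section SmoothComp.
Context {R : realType} {E F : normedModType R}.
Variables (A L : E -> F) (O : set F).
Hypothesis AL : forall (h : R) a x, A (h *: a + x) = h *: L a + A x.
Hypothesis Llin : forall (k : R) a b, L (k *: a + b) = k *: L a + L b.
Hypothesis cA : continuous A.

(** [A] is affine with linear part [L], so the two difference quotients are the same function of
    [h]; no chain rule is involved. *)
Lemma dirD_comp (f : F -> R) a x : dirD a (f \o A) x = dirD (L a) f (A x).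
Proof.
rewrite /dirD /derive.
suff -> : (fun h : R => h^-1 *: ((f \o A \o shift x) (h *: a) - (f \o A) x)) =
  (fun h : R => h^-1 *: ((f \o shift (A x)) (h *: L a) - f (A x))) by [].
by apply/funext => h /=; rewrite AL.
Qed.

Lemma derivable_comp (f : F -> R) a x : derivable f (A x) (L a) ->
  derivable (f \o A) x a.
Proof.
rewrite /derivable.
suff -> : (fun h : R => h^-1 *: ((f \o A \o shift x) (h *: a) - (f \o A) x)) =
  (fun h : R => h^-1 *: ((f \o shift (A x)) (h *: L a) - f (A x))) by [].
by apply/funext => h /=; rewrite AL.
Qed.

Lemma smooth_comp (f : F -> R) : open O -> smooth_on O f ->
  smooth_on (A @^-1` O) (f \o A).
Proof.
move=> oO sf.
have oAO : open (A @^-1` O) by apply: open_comp => // x _; exact: cA.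
apply: (@smooth_coind _ _ _ [set h | exists2 f, smooth_on O f & h = f \o A]) => //=.
- move=> _ [g sg ->] x /= Ox; split.
  + by apply: continuous_comp; [exact: cA|exact: smooth_cont sg Ox].
  + by move=> a; apply: derivable_comp; exact: smooth_derivable sg Ox.
  + move=> k a b; have H c := dirD_comp g c x; rewrite /dirD in H.
    by rewrite !H Llin (smooth_lin _ _ _ sg Ox).
- move=> _ a [g sg ->]; exists (dirD (L a) g \o A).
    by exists (dirD (L a) g) => //; exact: smooth_dirD.
  by move=> x _; exact: dirD_comp.
- by exists f.
Qed.

End SmoothComp.

Lemma mulfI_eq {R : fieldType} (k u v d1 d2 : R) :
  k != 0 -> d1 = k * u -> d2 = k * v -> d1 = d2 -> u = v.
Proof. by move=> k0 -> ->; exact: mulfI. Qed.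

Lemma subrAC_add {R : pzRingType} (p q r z : R) : p - q - r + z = p - r - q + z.
Proof. by rewrite [p - q - r]addrAC. Qed.

Lemma close_eq {R : realType} (e u v w w' : R) :
  `|u - w| <= e / 2 -> `|v - w'| <= e / 2 -> w = w' -> `|v - u| <= e.
Proof.
move=> uw + ww; rewrite -ww => vw.
by rewrite (splitr e) -(subrKA w) (le_trans (ler_normD _ _)) // lerD // distrC.
Qed.

(** * Symmetry of second derivatives *)

Section Schwarz.
Context {R : realType} {E : normedModType R}.
Implicit Types (f g : E -> R) (x a b : E) (O : set E).

Lemma line_cont a x : continuous (fun t : R => t *: a + x).
Proof. by move=> t; apply: cvgD; [exact: scalel_continuous|exact: cvg_cst]. Qed.

Lemma dirD_line f a x (t : R) :
  'D_1 (fun t : R => f (t *: a + x)) t = dirD a f (t *: a + x).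
Proof.
have := @dirD_comp R R E (fun t : R => t *: a + x) (fun h : R => h *: a) _ f 1 t.
rewrite /dirD /= scale1r; apply=> h k u.
by rewrite scalerDl -scalerA addrA.
Qed.

Lemma derivable_line f a x (t : R) : derivable f (t *: a + x) a ->
  derivable (fun t : R => f (t *: a + x)) t 1.
Proof.
move=> df; have := @derivable_comp R R E (fun t : R => t *: a + x)
  (fun h : R => h *: a) _ f 1 t.
rewrite scale1r; apply=> // h k u.
by rewrite scalerDl -scalerA addrA.
Qed.

Lemma is_derive_line f a x (t : R) : derivable f (t *: a + x) a ->
  is_derive t 1 (fun t : R => f (t *: a + x)) (dirD a f (t *: a + x)).
Proof.
by move=> df; apply: DeriveDef; [exact: derivable_line|exact: dirD_line].
Qed.

Lemma line_MVT f a x (h : R) : 0 < h ->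
  (forall t : R, 0 <= t <= h -> derivable f (t *: a + x) a) ->
  exists2 t : R, 0 <= t <= h & f (h *: a + x) - f x = h * dirD a f (t *: a + x).
Proof.
move=> h0 df.
have dd t : t \in `]0, h[ ->
    is_derive t 1 (fun t : R => f (t *: a + x)) (dirD a f (t *: a + x)).
  rewrite in_itv /= => /andP[t0 th]; apply: is_derive_line.
  by apply: df; rewrite !ltW.
have cf : {within `[0, h], continuous (fun t : R => f (t *: a + x))}.
  apply: derivable_within_continuous => t; rewrite in_itv /= => th.
  exact/derivable_line/df.
have [c] := MVT h0 dd cf.
rewrite in_itv /= => /andP[c0 ch] H; exists c; first by rewrite !ltW.
by move: H; rewrite scale0r add0r subr0 mulrC.
Qed.

(** The mean value theorem is applied to [y |-> f (h b + y) - f y] along [a], then to [dirD a f]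
    along [b]. *)
Lemma second_diff O f a b x (h : R) : 0 < h -> smooth_on O f ->
  (forall s t : R, 0 <= s <= h -> 0 <= t <= h -> O (s *: a + t *: b + x)) ->
  exists s t : R, [/\ 0 <= s <= h, 0 <= t <= h &
    f (h *: a + h *: b + x) - f (h *: a + x) - f (h *: b + x) + f x =
    h * h * dirD b (dirD a f) (s *: a + t *: b + x)].
Proof.
move=> h0 sf Oh.
have h00 : 0 <= (0 : R) <= h by rewrite (ltW h0) lexx.
have hhh : 0 <= h <= h by rewrite (ltW h0) lexx.
pose g y := f (h *: b + y) - f y.
have Os (s : R) : 0 <= s <= h -> O (s *: a + x).
  by move=> s0h; have := Oh s 0 s0h h00; rewrite scale0r addr0.
have Os' (s : R) : 0 <= s <= h -> O (h *: b + (s *: a + x)).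
  by move=> s0h; have := Oh s h s0h hhh; rewrite addrCA addrA.
have dshift y : O (h *: b + y) ->
    derivable (fun y => f (h *: b + y)) y a /\
    'D_a (fun y => f (h *: b + y)) y = dirD a f (h *: b + y).
  move=> Oy.
  have AL (k : R) c z : h *: b + (k *: c + z) = k *: id c + (h *: b + z).
    by rewrite addrCA.
  split; last exact: (@dirD_comp R E E (fun y => h *: b + y) id AL f a y).
  apply: (@derivable_comp R E E (fun y => h *: b + y) id AL f a y).
  exact: smooth_derivable sf Oy.
have dg (s : R) : 0 <= s <= h -> derivable g (s *: a + x) a.
  move=> s0h; apply: derivableB; first by have [] := dshift _ (Os' s s0h).
  exact: smooth_derivable sf (Os s s0h).
have [s s0h Hs] := line_MVT h0 dg.
have Dg : dirD a g (s *: a + x) =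
    dirD a f (h *: b + (s *: a + x)) - dirD a f (s *: a + x).
  have [d1 d2] := dshift _ (Os' s s0h).
  have d3 := smooth_derivable sf (Os s s0h) : derivable f (s *: a + x) a.
  by apply: etrans (deriveB d1 d3) _; rewrite d2.
have db (t : R) : 0 <= t <= h -> derivable (dirD a f) (t *: b + (s *: a + x)) b.
  move=> t0h; apply: smooth_derivable (smooth_dirD a sf) _.
  by rewrite addrCA addrA; exact: Oh.
have [t t0h Ht] := line_MVT h0 db.
exists s, t; split; [exact: s0h|exact: t0h|].
have sw (u v : E) : u + v + x = v + (u + x) by rewrite addrCA addrA.
rewrite (sw (h *: a)) (sw (s *: a)) -mulrA -Ht.
move: Hs; rewrite Dg => <-; rewrite /g.
by rewrite !opprB !addrA [in RHS]addrAC.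
Qed.

(** The second difference over a parallelogram is symmetric in [a] and [b]; by [second_diff] it
    equals [h^2] times either mixed derivative at some nearby point, and both mixed derivatives are
    continuous at [x]. *)
Lemma Schwarz O f a b x : open O -> smooth_on O f -> O x ->
  dirD a (dirD b f) x = dirD b (dirD a f) x.
Proof.
move=> oO sf Ox; apply/eqP; rewrite -subr_eq0 -normr_le0.
apply/ler_addgt0Pr => e e0; rewrite add0r.
have e2 : 0 < e / 2 by rewrite divr_gt0.
have c1 := smooth_cont (smooth_dirD a (smooth_dirD b sf)) Ox.
have c2 := smooth_cont (smooth_dirD b (smooth_dirD a sf)) Ox.
move/cvgrPdist_le : c1 => /(_ _ e2) n1.
move/cvgrPdist_le : c2 => /(_ _ e2) n2.
have n3 := open_nbhs_nbhs (conj oO Ox).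
have [d d0 Hd] := (nbhs_ballP x _).1 (filterI n3 (filterI n1 n2)).
(* This step length keeps the whole parallelogram inside the ball of radius [d]. *)
pose h := d / (`|a| + `|b| + 1).
have p0 : 0 < `|a| + `|b| + 1 by rewrite ltr_wpDl // addr_ge0.
have h0 : 0 < h by rewrite divr_gt0.
have inb (s t : R) : 0 <= s <= h -> 0 <= t <= h -> ball x d (s *: a + t *: b + x).
  move=> /andP[s0 sh] /andP[t0 th].
  rewrite -ball_normE /ball_ /= opprD addrCA subrr addr0 normrN.
  apply: (@le_lt_trans _ _ (h * (`|a| + `|b|))).
    rewrite mulrDr; apply: le_trans (ler_normD _ _) _.
    by rewrite !normrZ !ger0_norm // lerD // ler_wpM2r.
  by rewrite /h mulrAC -mulrA gtr_pMr // ltr_pdivrMr // mul1r ltrDl.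
have [s [t [s0 t0 H1]]] := second_diff h0 sf (fun s t s0 t0 => (Hd _ (inb s t s0 t0)).1).
have inb' (s' t' : R) : 0 <= s' <= h -> 0 <= t' <= h -> ball x d (s' *: b + t' *: a + x).
  by move=> *; rewrite [_ *: b + _]addrC; exact: inb.
have [s' [t' [s0' t0' H2]]] := second_diff h0 sf (fun s t s0 t0 => (Hd _ (inb' s t s0 t0)).1).
have hh0 : h * h != 0 by rewrite mulf_neq0 // gt_eqF.
have {H1 H2} := mulfI_eq hh0 H1 H2.
rewrite [h *: b + h *: a]addrC => /(_ (subrAC_add _ _ _ _)) H.
have [_ [_ /= K1]] := Hd _ (inb _ _ s0 t0).
have [_ [/= K2 _]] := Hd _ (inb' _ _ s0' t0').
exact: close_eq K1 K2 H.
Qed.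
End Schwarz.

(** * Integration over space *)

Section Caratheodory.
Context {R : realType} d {T : measurableType d}.
Implicit Type f : R -> T -> R.

(** The left end of the cell containing [x] in the grid of mesh [1/(n+1)]; it takes countably many
    values. *)
Let step (n : nat) (x : R) : R := (Num.floor (x * n.+1%:R))%:~R / n.+1%:R.

Lemma floor_grid_cvg (x : R) : step n x @[n --> \oo] --> x.
Proof.
apply/cvgrPdist_le => e e0.
have : (fun n : nat => n.+1%:R^-1 : R) @ \oo --> (0 : R) by exact: cvg_harmonic.
move/cvgrPdist_le => /(_ _ e0); apply: filterS => n /=.
rewrite sub0r normrN ger0_norm ?invr_ge0 // => ne.
have n0 : 0 < n.+1%:R :> R by rewrite ltr0n.
apply: le_trans ne; rewrite /step.
have /andP[h1 h2] := floor_itv (x * n.+1%:R).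
rewrite ger0_norm; last by rewrite subr_ge0 ler_pdivrMr.
rewrite lerBlDr -[X in X + _]mul1r -mulrDl ler_pdivlMr //.
by rewrite addrC; apply: ltW; rewrite intrD in h2.
Qed.

Lemma measurable_grid f n : (forall x, measurable_fun setT (f x)) ->
  measurable_fun setT (fun z : R * T => f (step n z.1) z.2).
Proof.
move=> mf _ Y mY; rewrite setTI.
have -> : (fun z : R * T => f (step n z.1) z.2) @^-1` Y =
    \bigcup_(k in [set: int])
      (((fun x : R => Num.floor (x * n.+1%:R)) @^-1` [set k]) `*`
       (f (k%:~R / n.+1%:R) @^-1` Y)).
  apply/seteqP; split => [[x t] /= H|[x t] [k _ [/= xk H]]].
    by exists (Num.floor (x * n.+1%:R)).
  by rewrite /step xk.
apply: countable_bigcupT_measurable; first exact: countableP.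
move=> k; apply: measurableX; last by rewrite -[X in measurable X]setTI; exact: mf.
have -> : (fun x : R => Num.floor (x * n.+1%:R)) @^-1` [set k] =
   [set` `[(k%:~R / n.+1%:R : R), ((k + 1)%:~R / n.+1%:R : R)[ ].
  have n0 : 0 < n.+1%:R :> R by rewrite ltr0n.
  apply/seteqP; split => x /=; rewrite in_itv /= ler_pdivrMr // ltr_pdivlMr //.
    by move=> <-; exact: floor_itv.
  by exact: floor_def.
exact: measurable_itv.
Qed.

(** Freezing the first variable at its grid point gives functions whose preimages are countable
    unions of rectangles; by continuity they converge pointwise to [f]. *)
Lemma measurable_caratheodory f : (forall x, measurable_fun setT (f x)) ->
  (forall t, continuous (f ^~ t)) ->
  measurable_fun setT (fun z : R * T => f z.1 z.2).
Proof.
move=> mf cf; apply: measurable_fun_cvg (fun n => measurable_grid n mf) _.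
move=> [x t] _ /=.
exact: cvg_comp (@floor_grid_cvg x) (cf t x).
Qed.

Lemma measurable_caratheodoryC f : (forall x, measurable_fun setT (f x)) ->
  (forall t, continuous (f ^~ t)) ->
  measurable_fun setT (fun z : T * R => f z.2 z.1).
Proof.
move=> mf cf.
exact: (measurableT_comp (measurable_caratheodory mf cf) (@measurable_swap _ _ T R)).
Qed.

End Caratheodory.

Section Vec3.
Context {R : realType}.
Notation V3 := 'rV[R]_3.

Lemma vec3E (x y z : R) : vec3 (x, y, z) =
  x *: delta_mx ord0 (inord 0) + (y *: delta_mx ord0 (inord 1) + z *: delta_mx ord0 (inord 2)).
Proof.
apply/rowP => i; rewrite !mxE /=.
have H j k : (j < 3)%N -> (k < 3)%N ->
  ((inord j : 'I_3) == inord k) = (j == k) by move=> *; rewrite -val_eqE /= !inordK.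
rewrite -(inord_val i); case: (val i) (ltn_ord i) => [|[|[|//]]] j3.
all: rewrite !H // inordK //= ?mulr1 ?mulr0 ?addr0 ?add0r //.
Qed.

(** Caratheodory's criterion is applied one coordinate at a time: continuity in the last coordinate,
    measurability in the others. *)
Lemma measurable_vec3 (g : V3 -> R) : continuous g ->
  measurable_fun setT (g \o @vec3 R).
Proof.
move=> cg.
apply: (@measurable_caratheodoryC R _ _ (fun z xy => g (vec3 (xy, z)))).
- move=> z; apply: (@measurable_caratheodoryC R _ _ (fun y x => g (vec3 (x, y, z)))).
  + move=> y; apply: continuous_measurable_fun => x.
    under eq_fun do rewrite vec3E.
    apply: continuous_comp; last exact: cg.
    exact: line_cont.
  + move=> x y; under eq_fun do rewrite vec3E.
    apply: continuous_comp; last exact: cg.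
    apply: cvgD; first exact: cvg_cst.
    exact: line_cont.
- move=> [x y] z; under eq_fun do rewrite vec3E.
  apply: continuous_comp; last exact: cg.
  apply: cvgD; first exact: cvg_cst.
  apply: cvgD; first exact: cvg_cst.
  exact: scalel_continuous.
Qed.

Lemma measurable_time_vec3 (g : R -> V3 -> R) : (forall u, continuous (g u)) ->
  (forall q, continuous (g ^~ q)) ->
  measurable_fun setT (fun z : R * (R * R * R) => g z.1 (vec3 z.2)).
Proof.
move=> c1 c2; apply: (@measurable_caratheodory R _ _ (fun u x => g u (vec3 x))).
- by move=> u; exact: measurable_vec3.
- by move=> x; exact: c2.
Qed.

End Vec3.

(** The pushforward and the product measure agree on rectangles, which determines a product of
    sigma-finite measures. *)
Lemma product_measure_pushforward {R : realType} d1 d2 (T1 : measurableType d1)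
    (T2 : measurableType d2) (m1 : {sigma_finite_measure set T1 -> \bar R})
    (m2 : {sigma_finite_measure set T2 -> \bar R}) (f1 : T1 -> T1) (f2 : T2 -> T2)
    (X : set (T1 * T2)) :
  measurable_fun setT f1 -> measurable_fun setT f2 ->
  (forall A, measurable A -> m1 (f1 @^-1` A) = m1 A) ->
  (forall A, measurable A -> m2 (f2 @^-1` A) = m2 A) ->
  measurable X ->
  (m1 \x m2)%E ((fun z => (f1 z.1, f2 z.2)) @^-1` X) = (m1 \x m2)%E X.
Proof.
move=> mf1 mf2 H1 H2 mX; pose f (z : T1 * T2) := (f1 z.1, f2 z.2).
have mf : measurable_fun setT f.
  by apply: measurable_fun_pair; apply: measurableT_comp.
have pf1 A : measurable A -> measurable (f1 @^-1` A).
  by move=> mA; rewrite -[X in measurable X]setTI; exact: mf1.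
have pf2 A : measurable A -> measurable (f2 @^-1` A).
  by move=> mA; rewrite -[X in measurable X]setTI; exact: mf2.
rewrite [RHS](@product_measure_unique _ _ _ _ _ m1 m2
  (measure_function_pushforward__canonical__measure_function_Measure (m1 \x m2)%E mf)) //.
move=> A B mA mB; rewrite /= /pushforward.
rewrite (_ : f @^-1` (A `*` B) = (f1 @^-1` A) `*` (f2 @^-1` B)) //.
rewrite product_measure1E; [|exact: pf1|exact: pf2].
by congr (_ * _)%E; [exact: H1|exact: H2].
Qed.

(* The library's canonical sigma-finite structure on a product measure only
   applies to subprobabilities, so it is rebuilt here. *)
Section SigmaFiniteProducts.
Context {R : realType}.
Notation lam := (@lebesgue_measure R).

Lemma product_sigma_finite d1 d2 (T1 : measurableType d1) (T2 : measurableType d2)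
    (m1 : {sigma_finite_measure set T1 -> \bar R})
    (m2 : {sigma_finite_measure set T2 -> \bar R}) :
  sigma_finite setT (m1 \x m2)%E.
Proof.
have /sigma_finiteP[F [TF ndF Foo]] := sigma_finiteT m1.
have /sigma_finiteP[G [TG ndG Goo]] := sigma_finiteT m2.
exists (fun n => F n `*` G n).
  rewrite -setXTT TF TG; apply/seteqP; split => [[x y] [/= [n _ Fx] [k _ Gy]]|].
    exists (maxn n k) => //; split => /=.
    - by move: x Fx; exact/subsetPset/ndF/leq_maxl.
    - by move: y Gy; exact/subsetPset/ndG/leq_maxr.
  by move=> [x y] [n _ [/= Fx Gy]]; split; exists n.
move=> k; have [mF F0] := Foo k; have [mG G0] := Goo k.
split; first exact: measurableX.
by rewrite product_measure1E // lte_mul_pinfty // ge0_fin_numE.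
Qed.

Definition area := (lam \x lam)%E.
HB.instance Definition _ := Measure.on area.
HB.instance Definition _ := Measure_isSigmaFinite.Build _ _ _ area
  (product_sigma_finite lam lam).

Definition vol := (area \x lam)%E.
HB.instance Definition _ := Measure.on vol.
HB.instance Definition _ := Measure_isSigmaFinite.Build _ _ _ vol
  (product_sigma_finite area lam).
End SigmaFiniteProducts.

Lemma translate_cont {R : realType} {E : normedModType R} (c : E) :
  continuous (fun q : E => q + c).
Proof. by move=> q; apply: cvgD; [done|exact: cvg_cst]. Qed.

(** * Translation invariance of the volume *)

Section Translation.
Context {R : realType}.
Notation V3 := 'rV[R]_3.
Notation lam := (@lebesgue_measure R).
Notation vol3 := (@vol R).

Lemma lebesgue_translation (c : R) (A : set R) : measurable A ->
  lam ((fun x => x + c) @^-1` A) = lam A.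
Proof.
move=> mA.
have mf : measurable_fun setT (fun x : measurableTypeR R => x + c : measurableTypeR R).
  by apply: measurable_funD => //; exact: measurable_cst.
rewrite [RHS](@lebesgue_measure_unique _
  (measure_function_pushforward__canonical__measure_function_Measure lam mf)) //.
move=> _ [[a b] _ <-] /=; rewrite /pushforward.
rewrite (_ : (fun x => x + c) @^-1` _ = `]a - c, b - c]%classic); last first.
  by apply/seteqP; split => x /=; rewrite !in_itv /= ltrBlDr lerBrDr.
by rewrite !lebesgue_measure_itv /= !lte_fin ltrD2r -!EFinB opprD addrACA opprK addNr addr0.
Qed.


Lemma volume_translation (c : R * R * R) (X : set (R * R * R)) : measurable X ->
  vol3 ((fun z => (z.1.1 + c.1.1, z.1.2 + c.1.2, z.2 + c.2)) @^-1` X) = vol3 X.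
Proof.
have m1 (k : R) : measurable_fun setT (fun x : measurableTypeR R => x + k : measurableTypeR R).
  by apply: measurable_funD => //; exact: measurable_cst.
have m2 : measurable_fun setT (fun z : R * R => (z.1 + c.1.1, z.2 + c.1.2)).
  by apply: measurable_fun_pair; [apply: (measurableT_comp (m1 c.1.1))|
    apply: (measurableT_comp (m1 c.1.2))].
move=> mX; have H2 A : measurable A ->
    area ((fun z => (z.1 + c.1.1, z.2 + c.1.2)) @^-1` A) = area A.
  move=> mA; apply: (product_measure_pushforward (m1 _) (m1 _) _ _ mA);
    exact: lebesgue_translation.
have H := @product_measure_pushforward R _ _ _ _ area lam _ _ X m2 (m1 c.2) H2
  (@lebesgue_translation c.2) mX.
exact: H.
Qed.

Definition unvec3 (q : V3) : R * R * R :=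
  (q ord0 (inord 0), q ord0 (inord 1), q ord0 (inord 2)).

Lemma unvec3K : cancel (@unvec3) (@vec3 R).
Proof.
move=> q; apply/rowP => i; rewrite !mxE /=.
rewrite -[in RHS](inord_val i); case: (val i) (ltn_ord i) => [|[|[|//]]] //.
Qed.

Lemma vec3D (x c : R * R * R) : vec3 (x.1.1 + c.1.1, x.1.2 + c.1.2, x.2 + c.2) = vec3 x + vec3 c.
Proof.
by apply/rowP => i; rewrite !mxE /=; case: (val i) (ltn_ord i) => [|[|[|//]]].
Qed.

(** Continuity gives measurability of the integrand, and vanishing for large norm gives
    integrability: the norm is the max norm, so its balls correspond to the boxes [box3]. *)
Definition cont_bsupp (g : V3 -> R) :=
  continuous g /\ exists M, forall q, M < `|q| -> g q = 0.

Definition box3 (M : R) : set (R * R * R) := (`[-M, M] `*` `[-M, M]) `*` `[-M, M].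

Lemma measurable_box3 M : measurable (box3 M).
Proof. by apply: measurableX => //; exact: measurableX. Qed.

Lemma box3_fin M : (vol3 (box3 M) < +oo)%E.
Proof.
rewrite /box3; set I := [set` _].
have lM : (lam I < +oo)%E.
  by rewrite lebesgue_measure_itv /=; case: ifP => // _; rewrite -EFinB ltry.
have lM0 : lam I \is a fin_num by rewrite ge0_fin_numE.
have mI : measurable I by exact: measurable_itv.
have mII : measurable (I `*` I) by exact: measurableX.
have aII : (area (I `*` I) < +oo)%E.
  by rewrite /area product_measure1E // -ge0_fin_numE ?mule_ge0 // fin_numM.
have aII0 : area (I `*` I) \is a fin_num by rewrite ge0_fin_numE.
by rewrite /vol product_measure1E // -ge0_fin_numE ?mule_ge0 // fin_numM.
Qed.

Lemma box3P (M : R) (x : R * R * R) : ~ box3 M x -> M < `|vec3 x|.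
Proof.
apply: contra_notP => /negP; rewrite -leNgt => xM.
have H (i : 'I_3) : `|vec3 x ord0 i| <= M.
  by apply: le_trans xM; rewrite /Num.norm /= mx_normrE; apply: (le_bigmax _ _ (ord0, i)).
split=> [|/=]; [split=> /=|]; rewrite in_itv /= -ler_norml.
- by have := H (inord 0); rewrite mxE inordK.
- by have := H (inord 1); rewrite mxE inordK.
- by have := H (inord 2); rewrite mxE inordK.
Qed.

Lemma cont_bsupp_bound g : cont_bsupp g -> exists2 C, 0 <= C & forall q, `|g q| <= C.
Proof.
move=> [cg [M gM]].
have cK : compact [set q : V3 | `|q| <= M].
  apply: bounded_closed_compact.
    exists M; split => [|N MN q /= qM]; first exact: num_real.
    exact: le_trans qM (ltW MN).
  apply: (@closed_comp _ _ (fun q : V3 => `|q|) [set x | x <= M]).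
    by move=> q _; exact: norm_continuous.
  exact: closed_le.
have [[q0 q0M]|no] := pselect (exists q : V3, `|q| <= M).
  have [c _ Hc] := @EVT_max_rV R 3 (fun q => `|g q|) _ (ex_intro _ q0 q0M) cK
     (continuous_subspaceT (fun q => continuous_comp (cg q) (@norm_continuous _ _ (g q)))).
  exists `|g c| => // q; have [qM|qM] := leP `|q| M; first by apply: Hc; rewrite inE.
  by rewrite gM // normr0.
exists 0 => // q; rewrite gM ?normr0 //.
by rewrite ltNge; apply/negP => qM; apply: no; exists q.
Qed.

Lemma integrable_box3 (C M : R) :
  vol3.-integrable setT (EFin \o (fun x => C * \1_(box3 M) x)).
Proof.
have -> : (EFin \o (fun x => C * \1_(box3 M) x)) =
   (fun x => C%:E * (\1_(box3 M) x)%:E)%E by apply/funext => x /=; rewrite EFinM.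
apply: integrableZl => //.
apply/integrableP; split.
  by apply/measurable_EFinP; exact: measurable_indic (measurable_box3 M).
under eq_integral do rewrite gee0_abs ?lee_fin //.
by rewrite integral_indic ?setIT ?box3_fin //; exact: measurable_box3.
Qed.

Lemma integrable_bsupp (f : R * R * R -> R) (C M : R) :
  measurable_fun setT f ->
  (forall x, `|f x| <= C * \1_(box3 M) x) ->
  vol3.-integrable setT (EFin \o f).
Proof.
move=> mf fC; apply: le_integrable (integrable_box3 C M) => //.
  exact/measurable_EFinP.
by move=> x _; rewrite /= lee_fin (le_trans (fC x)) // ler_norm.
Qed.

Lemma cont_bsupp_box g : cont_bsupp g -> exists C M, forall x, `|g (vec3 x)| <= C * \1_(box3 M) x.
Proof.
move=> ccg; have [C C0 gC] := cont_bsupp_bound ccg; have [cg [M gM]] := ccg.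
exists C, M => x; rewrite indicE; have [bx|bx] := boolP (x \in box3 M).
  by rewrite mulr1.
by rewrite mulr0 gM ?normr0 //; apply: box3P; rewrite notin_setE in bx.
Qed.

Lemma cont_bsupp_integrable g : cont_bsupp g -> vol3.-integrable setT (EFin \o (g \o @vec3 R)).
Proof.
move=> ccg; have [C [M gM]] := cont_bsupp_box ccg.
by apply: integrable_bsupp gM; apply: measurable_vec3; case: ccg.
Qed.

Lemma cont_bsupp_translate g (c : V3) : cont_bsupp g -> cont_bsupp (fun q => g (q + c)).
Proof.
move=> [cg [M gM]]; split.
  have cf : continuous (fun q : V3 => q + c).
    exact: translate_cont.
  suff : continuous (g \o (fun q => q + c)) by [].
  by move=> q; apply: continuous_comp; [exact: cf|exact: cg].
exists (M + `|c|) => q qM; apply: gM.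
have := ler_normB (q + c) c; rewrite addrK => h.
by rewrite -(ltrD2r `|c|) (lt_le_trans qM).
Qed.

Lemma int3_translate g (c : V3) : cont_bsupp g -> int3 (fun q => g (q + c)) = int3 g.
Proof.
move=> ccg; have [cg _] := ccg.
pose RR := measurableTypeR R.
pose t (z : (RR * RR * RR)%type) : (RR * RR * RR)%type := (z.1.1 + (unvec3 c).1.1, z.1.2 + (unvec3 c).1.2, z.2 + (unvec3 c).2).
have gt : (fun x => g (vec3 x + c)) = (g \o @vec3 R) \o t.
  by apply/funext => x /=; rewrite /t vec3D unvec3K.
have mt : measurable_fun setT t.
  have m1 (k : R) : measurable_fun setT (fun x : measurableTypeR R => x + k : measurableTypeR R).
    by apply: measurable_funD => //; exact: measurable_cst.
  apply: measurable_fun_pair; last exact: (measurableT_comp (m1 _)).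
  by apply: measurable_fun_pair; apply: (measurableT_comp (m1 _)); apply: measurableT_comp.
rewrite /int3 /Rintegral; congr fine.
have mg := measurable_vec3 cg.
transitivity (\int[pushforward vol3 t]_x (g (vec3 x))%:E)%E.
  rewrite (@integral_pushforward _ _ _ _ R t mt vol3 setT (EFin \o (g \o @vec3 R))) //.
  - by rewrite preimage_setT; apply: eq_integral => x _ /=; rewrite /t vec3D unvec3K.
  - exact/measurable_EFinP.
  - rewrite preimage_setT; have := cont_bsupp_integrable (cont_bsupp_translate c ccg).
    by rewrite (_ : _ \o @vec3 R = (g \o @vec3 R) \o t).
apply: eq_measure_integral => A mA _; apply: volume_translation mA.
Qed.

End Translation.

Section ContinuousOps.
Context {R : realType} {E : normedModType R}.
Implicit Types (f g : E -> R).

Lemma cont_add f g : continuous f -> continuous g -> continuous (fun q => f q + g q).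
Proof. by move=> cf cg q; exact: cvgD (cf q) (cg q). Qed.

Lemma cont_mul f g : continuous f -> continuous g -> continuous (fun q => f q * g q).
Proof. by move=> cf cg q; exact: cvgM (cf q) (cg q). Qed.

Lemma cont_cst (k : R) : continuous (fun _ : E => k).
Proof. by move=> q; exact: cvg_cst. Qed.

End ContinuousOps.

(** * Integration by parts in space *)

Section Int3.
Context {R : realType}.
Notation V3 := 'rV[R]_3.
Notation lam := (@lebesgue_measure R).
Notation vol3 := (@vol R).
Implicit Types (f g h : V3 -> R).

Lemma cont_bsupp_add f g : cont_bsupp f -> cont_bsupp g -> cont_bsupp (fun q => f q + g q).
Proof.
move=> [cf [M fM]] [cg [N gN]]; split.
  exact: cont_add.
exists (Num.max M N) => q; rewrite gt_max => /andP[qM qN].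
by rewrite fM // gN // addr0.
Qed.

Lemma cont_bsupp_mul f g : continuous f -> cont_bsupp g -> cont_bsupp (fun q => f q * g q).
Proof.
move=> cf [cg [N gN]]; split.
  exact: cont_mul.
by exists N => q qN; rewrite gN // mulr0.
Qed.

Lemma cc0 : cont_bsupp (fun _ : V3 => 0 : R).
Proof. by split; [exact: cont_cst|exists 0]. Qed.

Lemma cont_bsupp_scale (k : R) g : cont_bsupp g -> cont_bsupp (fun q => k * g q).
Proof. by apply: cont_bsupp_mul; exact: cont_cst. Qed.

Lemma cont_bsupp_sum (I : Type) (r : seq I) (F : I -> V3 -> R) :
  (forall i, cont_bsupp (F i)) -> cont_bsupp (fun q => \sum_(i <- r) F i q).
Proof.
move=> cF; elim: r => [|i r IH].
  by under [fun x => _]eq_fun do rewrite big_nil; exact: cc0.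
under [fun x => _]eq_fun do rewrite big_cons.
exact: cont_bsupp_add.
Qed.

Lemma int3D f g : cont_bsupp f -> cont_bsupp g -> int3 (fun q => f q + g q) = int3 f + int3 g.
Proof.
move=> cf cg; rewrite /int3.
exact: (RintegralD measurableT (cont_bsupp_integrable cf) (cont_bsupp_integrable cg)).
Qed.

Lemma int3Z (k : R) f : cont_bsupp f -> int3 (fun q => k * f q) = k * int3 f.
Proof. by move=> cf; exact: (RintegralZl k measurableT (cont_bsupp_integrable cf)). Qed.

Lemma int3_0 : int3 (fun _ : V3 => 0 : R) = 0.
Proof. by rewrite /int3 /Rintegral integral0. Qed.

Lemma int3_sum (I : Type) (r : seq I) (F : I -> V3 -> R) :
  (forall i, cont_bsupp (F i)) ->
  int3 (fun q => \sum_(i <- r) F i q) = \sum_(i <- r) int3 (F i).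
Proof.
move=> cF; elim: r => [|i r IH].
  by under [fun x => _]eq_fun do rewrite big_nil; rewrite big_nil int3_0.
under [fun x => _]eq_fun do rewrite big_cons.
by rewrite int3D ?IH ?big_cons //; exact: cont_bsupp_sum.
Qed.

Lemma eq_int3 f g : f =1 g -> int3 f = int3 g.
Proof. by move=> /funext ->. Qed.

Lemma dirD_bsupp h (a : V3) M : (forall q, M < `|q| -> h q = 0) ->
  forall q, M < `|q| -> dirD a h q = 0.
Proof.
move=> hM q qM; rewrite /dirD -(derive_cst (0 : R) q a); apply: near_eq_derive.
have : nbhs q [set x | M < `|x|].
  apply: open_nbhs_nbhs; split => //.
  apply: (@open_comp _ _ (fun x : V3 => `|x|) [set x | M < x]) => [x _|].
    exact: norm_continuous.
  exact: open_gt.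
by apply: filterS => x /=; exact: hM.
Qed.

Lemma cont_bsupp_dirD h (a : V3) : smooth_on setT h -> cont_bsupp h -> cont_bsupp (dirD a h).
Proof.
move=> sh [_ [M hM]]; split; last by exists M; exact: dirD_bsupp.
by move=> q; exact: smooth_cont (smooth_dirD a sh) I.
Qed.

(** By translation invariance the integral of [h (t a + x)] does not depend on [t]; its derivative
    at [t = 0], taken under the integral sign, is the integral of [dirD a h]. *)
Lemma int3_dirD h (a : V3) : smooth_on setT h -> cont_bsupp h -> int3 (dirD a h) = 0.
Proof.
move=> sh cch; have ccd := cont_bsupp_dirD a sh cch.
pose f (t : R) (x : R * R * R) := h (t *: a + vec3 x).
have fE t x : f t x = h (vec3 x + t *: a) by rewrite /f addrC.
have intf (t : R) : vol3.-integrable setT (EFin \o f t).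
  have := cont_bsupp_integrable (cont_bsupp_translate (t *: a) cch).
  by congr integrable; apply/funext => x /=; rewrite fE.
have df t x : derivable (f ^~ x) t 1.
  exact: derivable_line (smooth_derivable sh I).
have [C C0 hC] := cont_bsupp_bound ccd; have [_ [M hM]] := ccd.
(* For [|t| < 1] the shifted supports all lie in the box enlarged by [|a|]. *)
pose G (x : R * R * R) := C * \1_(box3 (M + `|a|)) x.
have dfE t x : partial1of2 f t x = dirD a h (t *: a + vec3 x).
  by rewrite partial1of2E; exact: dirD_line.
have Gub t x : t \in `](-1), 1[ -> `|partial1of2 f t x| <= G x.
  rewrite in_itv /= => /andP[t1 t2]; rewrite dfE /G indicE.
  have [bx|] := boolP (x \in _); first by rewrite mulr1.
  rewrite notin_setE => /box3P xb; rewrite hM ?normr0 ?mulr0 //.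
  have ta : `|t *: a| <= `|a|.
    by rewrite normrZ ler_piMl // ler_norml (ltW t1) (ltW t2).
  have := ler_normB (t *: a + vec3 x) (t *: a).
  rewrite addrAC subrr add0r => h1.
  rewrite -(ltrD2r `|a|) (lt_le_trans xb) // (le_trans h1) //.
  by rewrite lerD2l.
have G0 x : 0 <= G x by rewrite mulr_ge0.
have I0 : `](-1), 1[%classic (0 : R) by rewrite /= in_itv /= ltrN10 ltr01.
have := @differentiation_under_integral R _ _ vol3 f setT measurableT 0 (-1) 1 I0
  (fun t _ => intf t) (fun t x _ _ => df t x) G G0 (integrable_box3 _ _)
  (fun t x t1 _ => Gub t x t1).
rewrite (_ : (fun t => _) = fun=> int3 h); last first.
  apply/funext => t; rewrite -(int3_translate (t *: a) cch) /int3.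
  by apply: eq_Rintegral => x _; rewrite fE.
rewrite derive1_cst => ->; rewrite /int3; apply: eq_Rintegral => x _.
by rewrite dfE scale0r add0r.
Qed.

(** Leibniz's formula is a hypothesis because the lemma is applied to an [f] that is smooth off the
    forward ray only; its product with a test function is nevertheless smooth everywhere. *)
Lemma int3_by_parts f g (a : V3) : smooth_on setT (fun q => f q * g q) ->
  cont_bsupp (fun q => f q * g q) -> cont_bsupp (fun q => f q * dirD a g q) ->
  cont_bsupp (fun q => dirD a f q * g q) ->
  (forall q, dirD a (fun q => f q * g q) q = f q * dirD a g q + dirD a f q * g q) ->
  int3 (fun q => f q * dirD a g q) = - int3 (fun q => dirD a f q * g q).
Proof.
move=> sfg cfg c1 c2 E; apply/eqP; rewrite -addr_eq0 -int3D //.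
by rewrite -(int3_dirD a sfg cfg); apply/eqP/eq_int3 => q; rewrite E.
Qed.

End Int3.

Section TimeIntegral.
Context {R : realType}.
Notation V3 := 'rV[R]_3.
Notation lam := (@lebesgue_measure R).
Notation vol3 := (@vol R).

Lemma decay_integral : (\int[lam]_(u in `[0%R, +oo[) ((1 + u) ^- 2)%:E = 1)%E.
Proof.
pose F (u : R) : R := - (1 + u)^-1.
have dF (u : R) : 0 <= u -> is_derive u 1 F ((1 + u) ^- 2).
  move=> u0; have u1 : 1 + u != 0 by rewrite gt_eqF // ltr_pwDl.
  have d1 : is_derive u 1 (fun u : R => 1 + u) 1.
    have := is_deriveD (is_derive_cst (1 : R) u 1) (is_derive_id u 1).
    by rewrite add0r.
  split; first by apply: derivableN; apply: derivableV.
  by rewrite deriveN ?deriveV ?derive_val ?scaler1 ?opprK //; apply: derivableV.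
have FE (u : R) : 0 <= u -> derive1 F u = (1 + u) ^- 2.
  by move=> u0; rewrite derive1E; have := dF u u0 => -[].
rewrite (@ge0_continuous_FTC2y R (fun u => (1 + u) ^- 2) F 0 0).
- by rewrite /F addr0 invr1 sub0e -EFinN opprK.
- by move=> x x0; rewrite invr_ge0 exprn_ge0 // addr_ge0.
- apply: continuous_in_subspaceT => x; rewrite inE /= in_itv /= andbT => x0.
  apply: cvgV; first by rewrite gt_eqF // exprn_gt0 // ltr_pwDl.
  apply: (@cvg_comp _ _ _ (fun u => 1 + u) (fun u => u ^+ 2)); last exact: exprn_continuous.
  by apply: cvgD; [exact: cvg_cst|].
- rewrite /F -oppr0; apply: cvgN.
  apply/cvgrPdist_le => e e0; near=> u.
  rewrite sub0r normrN ger0_norm; last by rewrite invr_ge0 addr_ge0.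
  by rewrite -[e]invrK lef_pV2 ?posrE ?invr_gt0 ?ltr_pwDl // ler_wpDl.
- by move=> x x0; have := dF x (ltW x0) => -[].
- apply: cvg_at_right_filter; apply: differentiable_continuous.
  by apply/derivable1_diffP; have := dF 0 (lexx _) => -[].
- by move=> x; rewrite in_itv /= andbT => x0; exact: FE (ltW x0).
Unshelve. all: end_near. Qed.

End TimeIntegral.

(** * Integration over time *)

Section TimeIntegral2.
Context {R : realType}.
Notation V3 := 'rV[R]_3.
Notation lam := (@lebesgue_measure R).
Notation vol3 := (@vol R).
Notation pos := (`[0%R, +oo[%classic : set R).

Definition tint (f : R -> R) : R := \int[lam]_(u in `[0, +oo[) f u.

(** The common majorant of all time integrands; the absolute value makes it continuous on the whole
    line. *)
Definition decay (u : R) : R := (1 + `|u|) ^- 2.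

Lemma decay_ge0 u : 0 <= decay u.
Proof. by rewrite invr_ge0 exprn_ge0 // addr_ge0. Qed.

Lemma decay_cont : continuous decay.
Proof.
move=> u; apply: cvgV; first by rewrite gt_eqF // exprn_gt0 // ltr_pwDl.
apply: (@cvg_comp _ _ _ (fun u : R => 1 + `|u|) (fun u => u ^+ 2)); last exact: exprn_continuous.
by apply: cvgD; [exact: cvg_cst|exact: norm_continuous].
Qed.

Lemma measurable_pos : measurable (pos : set (measurableTypeR R)).
Proof. exact: measurable_itv. Qed.
Hint Resolve measurable_pos : core.

Lemma cont_measurable_pos (f : R -> R) : continuous f -> measurable_fun pos (EFin \o f).
Proof.
by move=> cf; apply/measurable_EFinP/measurable_funTS; exact: continuous_measurable_fun.
Qed.

Lemma decay_integrable (C : R) : lam.-integrable pos (EFin \o (fun u => C * decay u)).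
Proof.
have -> : (EFin \o (fun u => C * decay u)) = (fun x => C%:E * (EFin \o decay) x)%E.
  by apply/funext => x /=; rewrite EFinM.
apply: integrableZl => //; apply/integrableP; split.
  exact: cont_measurable_pos decay_cont.
rewrite [ltLHS](_ : _ = (\int[lam]_(u in `[0%R, +oo[) ((1 + u) ^- 2)%:E)%E).
  by rewrite decay_integral ltry.
apply: eq_integral => u; rewrite inE /= in_itv /= andbT => u0.
by rewrite ger0_norm ?decay_ge0 // /decay ger0_norm.
Qed.

Lemma time_integrable (f : R -> R) (C : R) : continuous f ->
  (forall u, 0 <= u -> `|f u| <= C * decay u) -> lam.-integrable pos (EFin \o f).
Proof.
move=> cf fC; apply: le_integrable (decay_integrable C) => //.
  exact: cont_measurable_pos.
move=> u /=; rewrite in_itv /= andbT => u0; rewrite lee_fin.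
by rewrite (le_trans (fC u u0)) // ler_norm.
Qed.

Lemma eq_tint (f g : R -> R) : (forall u, 0 <= u -> f u = g u) -> tint f = tint g.
Proof.
by move=> fg; apply: eq_Rintegral => u; rewrite inE /= in_itv /= andbT; exact: fg.
Qed.

(** Absolute integrability on the product follows from the majorant [C * decay u] times the
    indicator of a box, whose volume is finite. *)
Lemma time_fubini (h : R -> V3 -> R) (C M : R) :
  (forall u, continuous (h u)) -> (forall q, continuous (h ^~ q)) ->
  (forall u q, 0 <= u -> `|h u q| <= C * decay u) ->
  (forall u q, M < `|q| -> h u q = 0) ->
  tint (fun u => int3 (h u)) = int3 (fun q => tint (h ^~ q)).
Proof.
move=> c1 c2 hC hM.
pose RR := measurableTypeR R.
pose RR3 := (RR * RR * RR)%type.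
(* The indicator turns the integral over the half-line into one over the whole line, to which
   Fubini's theorem applies. *)
pose f (z : RR * RR3) : R := \1_pos z.1 * h z.1 (vec3 z.2).
have mf : measurable_fun setT (EFin \o f).
  apply/measurable_EFinP; apply: measurable_funM; last exact: measurable_time_vec3.
  have m1 : measurable_fun setT (\1_pos : measurableTypeR R -> R).
    exact: measurable_indic.
  exact: (measurableT_comp m1 (@measurable_fst _ _ RR RR3)).
have ccu u : cont_bsupp (h u) by split => //; exists M => q; exact: hM.
have hb u x : 0 <= u -> `|h u (vec3 x)| <= (C * decay u) * \1_(box3 M) x.
  move=> u0; rewrite indicE; have [bx|] := boolP (x \in _).
    by rewrite mulr1; exact: hC.
  by rewrite notin_setE => /box3P xb; rewrite hM // normr0 mulr0.
have fpos u x : 0 <= u -> f (u, x) = h u (vec3 x).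
  by move=> u0; rewrite /f indicE mem_set ?mul1r //= in_itv /= u0.
have fneg u x : ~ pos u -> f (u, x) = 0.
  by move=> u0; rewrite /f indicE memNset ?mul0r.
have intf : (lam \x vol3)%E.-integrable setT (EFin \o f).
  apply/(integrable12ltyP lam [the {sigma_finite_measure set _ -> \bar R} of vol3] mf).
  pose K : \bar R := (\int[vol3]_x (\1_(box3 M) x)%:E)%E.
  have K0 : (0 <= K)%E by apply: integral_ge0 => x _; rewrite lee_fin.
  have Kfin : K \is a fin_num.
    by rewrite /K integral_indic ?setIT ?ge0_fin_numE ?box3_fin //; exact: measurable_box3.
  pose k u : \bar R := ((C * decay u)%:E * K)%E.
  have C0 : 0 <= C.
    have := hC 0 0 (lexx _); move/(le_trans (normr_ge0 _)).
    by rewrite /decay normr0 addr0 expr1n invr1 mulr1.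
  have inner u : pos u -> (\int[vol3]_x `|(EFin \o f) (u, x)| <= k u)%E.
    rewrite /= in_itv /= andbT => u0.
    have mB : measurable_fun setT (fun x : RR3 => (\1_(box3 M) x : R)%:E).
      by apply/measurable_EFinP; exact: measurable_indic (measurable_box3 M).
    have -> : k u = (\int[vol3]_x ((C * decay u)%:E * (\1_(box3 M) x)%:E))%E.
      by apply/esym/ge0_integralZl; rewrite ?lee_fin ?mulr_ge0 ?decay_ge0.
    have mfu : measurable_fun setT (fun x : RR3 => `|(EFin \o f) (u, x)|)%E.
      have -> : (fun x : RR3 => `|(EFin \o f) (u, x)|)%E = (fun x : RR3 => (`|h u (vec3 x)|)%:E).
        by apply/funext => x /=; rewrite fpos.
      apply/measurable_EFinP; apply: (measurableT_comp (@normr_measurable R setT)).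
      exact: measurable_vec3.
    have mCB := measurable_funeM (C * decay u)%:E mB.
    have f0 (x : RR3) : setT x -> (0 <= `|(EFin \o f) (u, x)|)%E by move=> _; exact: abse_ge0.
    apply: (ge0_le_integral vol3 measurableT f0 mfu mCB) => x _.
    by rewrite /= fpos // lee_fin; exact: hb.
  apply: (@le_lt_trans _ _ (\int[lam]_(u in pos) k u)%E).
    rewrite [leRHS]integral_mkcond.
    have p0 (u : RR) : setT u -> (0 <= \int[vol3]_x `|(EFin \o f) (u, x)|)%E.
      by move=> _; exact: integral_ge0.
    have mF := @measurable_fun_fubini_tonelli_F _ _ _ _ R
        [the {sfinite_measure set _ -> \bar R} of vol3] _
        (measurableT_comp (@abse_measurable R setT) mf) (fun _ => abse_ge0 _).
    have mk : measurable_fun setT (k \_ pos).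
      apply/(measurable_restrictT _ measurable_pos).
      apply: emeasurable_funM => //.
      by apply: cont_measurable_pos; apply: cont_mul; [exact: cont_cst|exact: decay_cont].
    apply: (ge0_le_integral lam measurableT p0 mF mk) => u _.
    rewrite patchE; case: ifPn; first by rewrite inE; exact: inner.
    rewrite notin_setE => nu; rewrite integral0_eq // => x _.
    by rewrite /= fneg // normr0.
  rewrite /k ge0_integralZr //.
  - have Ifin := integrable_fin_num measurable_pos (decay_integrable C).
    have I0 : (0 <= \int[lam]_(u in pos) (EFin \o (fun u => (C * decay u)%R)) u)%E.
      by apply: integral_ge0 => u _; rewrite lee_fin mulr_ge0 // decay_ge0.
    by apply: lte_mul_pinfty => //; rewrite -ge0_fin_numE.
  - by apply: cont_measurable_pos; apply: cont_mul; [exact: cont_cst|exact: decay_cont].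
  - by move=> u _; rewrite lee_fin mulr_ge0 // decay_ge0.
have F := @Fubini _ _ _ _ R lam [the {sigma_finite_measure set _ -> \bar R} of vol3] _ intf.
have E1 : (\int[lam]_u \int[vol3]_x (EFin \o f) (u, x) =
    \int[lam]_(u in pos) (int3 (h u))%:E)%E.
  rewrite [RHS]integral_mkcond; apply: eq_integral => u _; rewrite patchE.
  case: ifPn => [|nu]; last first.
    by rewrite integral0_eq // => x _; rewrite /= fneg // -notin_setE.
  rewrite inE /= in_itv /= andbT => u0.
  rewrite /int3 /Rintegral fineK.
    by apply: eq_integral => x _ /=; rewrite fpos.
  exact: (integrable_fin_num measurableT (cont_bsupp_integrable (ccu u))).
have E2 : (\int[vol3]_x \int[lam]_u (EFin \o f) (u, x) =
    \int[vol3]_x (tint (h ^~ (vec3 x)))%:E)%E.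
  apply: eq_integral => x _; rewrite /tint /Rintegral fineK; last first.
    exact: (integrable_fin_num measurable_pos
      (time_integrable (c2 (vec3 x)) (fun u => hC u (vec3 x)))).
  rewrite [RHS]integral_mkcond; apply: eq_integral => u _; rewrite patchE.
  case: ifPn => [|nu]; last by rewrite /= fneg // -notin_setE.
  by rewrite inE /= in_itv /= andbT => u0; rewrite fpos.
by rewrite /tint /int3 /Rintegral -E1 F E2.
Qed.

End TimeIntegral2.

(** * Continuity and derivatives of time integrals *)

Section TintRegularity.
Context {R : realType}.
Notation lam := (@lebesgue_measure R).
Notation pos := (`[0%R, +oo[%classic : set R).

Lemma tintD (f g : R -> R) (C C' : R) : continuous f -> continuous g ->
  (forall u, 0 <= u -> `|f u| <= C * decay u) ->
  (forall u, 0 <= u -> `|g u| <= C' * decay u) ->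
  tint (fun u => f u + g u) = tint f + tint g.
Proof.
move=> cf cg fC gC.
exact: (RintegralD (@measurable_pos R) (time_integrable cf fC) (time_integrable cg gC)).
Qed.

Lemma tintZ (f : R -> R) (k C : R) : continuous f ->
  (forall u, 0 <= u -> `|f u| <= C * decay u) ->
  tint (fun u => k * f u) = k * tint f.
Proof.
move=> cf fC; exact: (RintegralZl k (@measurable_pos R) (time_integrable cf fC)).
Qed.

Lemma tint0 : tint (fun _ => 0) = 0 :> R.
Proof. by rewrite /tint /Rintegral integral0. Qed.

(** Dominated convergence concerns sequences: a failure of continuity at [x] yields points within
    [d / (n+1)] of [x] whose integrals stay away from that at [x], and dominated convergence along
    this sequence contradicts it. *)
Lemma tint_cont {E : normedModType R} (f : E -> R -> R) (x : E) (C d : R) : 0 < d ->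
  (forall y, ball x d y -> continuous (f y)) ->
  (forall u, 0 <= u -> {for x, continuous (f ^~ u)}) ->
  (forall y u, ball x d y -> 0 <= u -> `|f y u| <= C * decay u) ->
  {for x, continuous (fun y => tint (f y))}.
Proof.
move=> d0 cf cx fC; apply/cvgrPdist_lt => e e0; apply: contrapT => H.
have dn (n : nat) : 0 < d / n.+1%:R by rewrite divr_gt0.
have Hn (n : nat) : exists y, ball x (d / n.+1%:R) y /\
    ~ `|tint (f x) - tint (f y)| < e.
  apply: contrapT => Hn; apply: H.
  apply/nbhs_ballP; exists (d / n.+1%:R) => [|y by_]; first exact: dn.
  by apply: contrapT => ny; apply: Hn; exists y.
have [y Hy] := choice Hn.
have yd n : ball x d (y n).
  apply: le_ball (Hy n).1.
  by rewrite ler_pdivrMr // ler_peMr ?ler1n // ltW.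
have yx : y @ \oo --> x.
  apply/cvgrPdist_lt => r r0.
  have : (fun n : nat => d * n.+1%:R^-1 : R) @ \oo --> (d * 0 : R).
    by apply: cvgMr; exact: cvg_harmonic.
  rewrite mulr0 => /cvgrPdist_lt /(_ r r0); apply: filterS => n.
  rewrite sub0r normrN ger0_norm ?mulr_ge0 ?ltW // => dr.
  have := (Hy n).1; rewrite -ball_normE /= => h; exact: lt_trans h dr.
have bx : ball x d x by exact: ballxx.
have mf z : ball x d z -> measurable_fun (pos : set (measurableTypeR R)) (EFin \o f z).
  by move=> bz; apply: cont_measurable_pos; exact: cf.
have cvgf (u : measurableTypeR R) : pos u ->
    (EFin \o f (y n)) u @[n --> \oo] --> (EFin \o f x) u.
  rewrite /= in_itv /= andbT => u0; apply: cvg_EFin; first exact: nearW.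
  exact: (cvg_comp _ _ yx (cx u u0)).
have dom : {ae lam, forall (u : measurableTypeR R) (n : nat), pos u ->
    (`|(EFin \o f (y n)) u| <= (EFin \o (fun u => (C * decay u)%R)) u)%E}.
  apply: aeW => u n; rewrite /= in_itv /= andbT => u0.
  by rewrite lee_fin; exact: fC.
have [_ _] := @dominated_convergence _ (measurableTypeR R) R lam pos (@measurable_pos R)
  (fun n => EFin \o f (y n)) (EFin \o f x) _ (fun n => mf _ (yd n)) (mf _ bx)
  (aeW _ cvgf) (decay_integrable C) dom.
have fin z : ball x d z -> (\int[lam]_(u in pos) (EFin \o f z) u)%E = (tint (f z))%:E.
  move=> bz; rewrite /tint /Rintegral fineK //.
  exact: (integrable_fin_num (@measurable_pos R) (time_integrable (cf _ bz) (fun u => fC z u bz))).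
rewrite (fin _ bx) => /fine_cvgP[_ /cvgrPdist_lt/(_ e e0)[N _ HN]].
have := HN N (leqnn N) => /=; rewrite (fin _ (yd N)) /=.
exact: (Hy N).2.
Qed.

Lemma tint_derive {E : normedModType R} (f : E -> R -> R) (x a : E) (C C' d : R) : 0 < d ->
  (forall y, ball x d y -> continuous (f y)) ->
  (forall y u, ball x d y -> 0 <= u -> `|f y u| <= C * decay u) ->
  (forall y u, ball x d y -> 0 <= u -> derivable (f ^~ u) y a) ->
  (forall y u, ball x d y -> 0 <= u -> `|dirD a (f ^~ u) y| <= C' * decay u) ->
  derivable (fun y => tint (f y)) x a /\
  dirD a (fun y => tint (f y)) x = tint (fun u => dirD a (f ^~ u) x).
Proof.
move=> d0 cf fC df dC.
(* For [|t| < w] the points [t a + x] stay in the ball, so the problem becomes one-dimensional in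
   [t]. *)
pose w := d / (`|a| + 1).
have a1 : 0 < `|a| + 1 by rewrite ltr_wpDl.
have w0 : 0 < w by rewrite divr_gt0.
have inb t : t \in `](- w), w[ -> ball x d (t *: a + x).
  rewrite in_itv /= => /andP[t1 t2].
  rewrite -ball_normE /ball_ /= opprD addrCA subrr addr0 normrN normrZ.
  have tw : `|t| <= w by rewrite ler_norml (ltW t1) (ltW t2).
  apply: le_lt_trans (ler_wpM2r (normr_ge0 a) tw) _.
  by rewrite /w mulrAC -mulrA gtr_pMr // ltr_pdivrMr // mul1r ltrDl.
pose g (t : R) (u : measurableTypeR R) := f (t *: a + x) u.
have I0 : `](- w), w[%classic (0 : R) by rewrite /= in_itv /= oppr_lt0 w0.
have intg (t : R) : `](- w), w[%classic t -> lam.-integrable pos (EFin \o g t).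
  by move=> /inb bt; exact: (time_integrable (cf _ bt) (fun u => fC _ u bt)).
have dg t (u : measurableTypeR R) : `](- w), w[%classic t -> pos u ->
    derivable (g ^~ u) t 1.
  move=> /inb bt; rewrite /= in_itv /= andbT => u0.
  exact: (@derivable_line R E (f ^~ u) a x t (df _ u bt u0)).
have dgE t (u : measurableTypeR R) : partial1of2 g t u = dirD a (f ^~ u) (t *: a + x).
  by rewrite partial1of2E; exact: (@dirD_line R E (f ^~ u)).
have C'0 : 0 <= C'.
  have := dC x 0 (ballxx _ d0) (lexx _); move/(le_trans (normr_ge0 _)).
  by rewrite /decay normr0 addr0 expr1n invr1 mulr1.
have G0 (u : measurableTypeR R) : 0 <= C' * decay u by rewrite mulr_ge0 // decay_ge0.
have Gub t (u : measurableTypeR R) : `](- w), w[%classic t -> pos u ->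
    `|partial1of2 g t u| <= C' * decay u.
  move=> /inb bt; rewrite /= in_itv /= andbT => u0.
  by rewrite dgE; exact: dC.
have D1 := @derivable_under_integral R _ _ lam g pos (@measurable_pos R) 0 _ _ I0
  intg dg _ G0 (decay_integrable C') Gub.
have D2 := @differentiation_under_integral R _ _ lam g pos (@measurable_pos R) 0 _ _ I0
  intg dg _ G0 (decay_integrable C') Gub.
split; first by apply/derivable1P; exact: D1.
have := @dirD_line R E (fun y => tint (f y)) a x 0.
rewrite scale0r add0r => <-; rewrite -derive1E; apply: etrans D2 _.
by apply: eq_tint => u _; rewrite dgE scale0r add0r.
Qed.

End TintRegularity.

Section TintScale.
Context {R : realType}.
Notation lam := (@lebesgue_measure R).

(** The constant [min(1, k)^-2] comes from [1 + k u >= min(1, k) (1 + u)]. *)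
Lemma decay_scale (k : R) : 0 < k ->
  exists2 K, 0 <= K & forall u, 0 <= u -> decay (k * u) <= K * decay u.
Proof.
move=> k0; pose m := Num.min 1 k.
have m0 : 0 < m by rewrite lt_min ltr01.
exists (m ^- 2) => [|u u0]; first by rewrite invr_ge0 exprn_ge0 // ltW.
rewrite /decay -invfM -exprMn lef_pV2 ?posrE ?exprn_gt0 ?mulr_gt0 ?ltr_pwDl //.
have H : m * (1 + `|u|) <= 1 + `|k * u|.
  rewrite normrM (ger0_norm (ltW k0)) mulrDr mulr1.
  by rewrite lerD ?ler_wpM2r ?ge_min ?lexx ?orbT.
by rewrite lerXn2r // nnegrE ?mulr_ge0 ?addr_ge0 // ltW.
Qed.

Lemma tint_scale_ge0 (g : R -> R) (k : R) : 0 < k -> continuous g ->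
  (forall u, 0 <= u -> 0 <= g u) -> tint g = tint (fun u => k * g (k * u)).
Proof.
move=> k0 cg g0; rewrite /tint /Rintegral; congr fine.
have D1 (x : R) : derive1 (fun u : R => k * u) x = k.
  by rewrite derive1Ml ?derive1_id ?mulr1 //; exact: derivable_id.
have FE : derive1 (fun u : R => k * u) = fun=> k by apply/funext.
have ck : continuous (fun u : R => k * u) by exact: mulrl_continuous.
have := @increasing_ge0_integration_by_substitutiony R (fun u => k * u) g 0.
rewrite FE mulr0 => ->.
- by apply: eq_integral => u _ /=; rewrite fctE /= mulrC.
- by move=> x y _ _; rewrite ltr_pM2l.
- by move=> x _; exact: cvg_cst.
- exact: is_cvg_cst.
- exact: is_cvg_cst.
- split; last by apply: cvg_at_right_filter; exact: ck.
  by move=> x _; apply: derivableM; [exact: derivable_cst|exact: derivable_id].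
- by apply: gt0_cvgMry; [exact: k0|exact: cvg_id].
- exact: continuous_subspaceT.
- by move=> x; rewrite in_itv /= andbT => x0; exact: g0 (ltW x0).
Qed.

(** [tint_scale_ge0] covers nonnegative integrands; adding [C * decay] makes [f] nonnegative on the
    half-line, and its contribution cancels afterwards. *)
Lemma tint_scale (f : R -> R) (k C : R) : 0 < k -> continuous f ->
  (forall u, 0 <= u -> `|f u| <= C * decay u) ->
  tint (fun u => f (k * u)) = tint f / k.
Proof.
move=> k0 cf fC; have [K K0 HK] := decay_scale k0.
have C0 : 0 <= C.
  have := fC 0 (lexx _); move/(le_trans (normr_ge0 _)).
  by rewrite /decay normr0 addr0 expr1n invr1 mulr1.
have ck : continuous (fun u : R => k * u) by exact: mulrl_continuous.
have ccomp (g : R -> R) : continuous g -> continuous (fun u => g (k * u)).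
  by move=> cg u; exact: (cvg_comp _ _ (ck u) (cg (k * u))).
have fk u : 0 <= u -> `|f (k * u)| <= (C * K) * decay u.
  move=> u0; apply: le_trans (fC _ (mulr_ge0 (ltW k0) u0)) _.
  by rewrite -mulrA ler_wpM2l // HK.
have dk u : 0 <= u -> `|C * decay (k * u)| <= (C * K) * decay u.
  move=> u0; rewrite ger0_norm ?mulr_ge0 ?decay_ge0 //.
  by rewrite -mulrA ler_wpM2l // HK.
have cd : continuous (fun u => C * decay u).
  by apply: cont_mul; [exact: cont_cst|exact: decay_cont].
have dd u : 0 <= u -> `|C * decay u| <= C * decay u.
  by move=> u0; rewrite ger0_norm // mulr_ge0 ?decay_ge0.
have E1 := tint_scale_ge0 k0 cd (fun u _ => mulr_ge0 C0 (decay_ge0 u)).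
have g0 u : 0 <= u -> 0 <= f u + C * decay u.
  by move=> u0; have := fC u u0; rewrite ler_norml => /andP[h _]; rewrite -lerBlDr sub0r.
have E2 := tint_scale_ge0 k0 (cont_add cf cd) g0.
rewrite (tintD cf cd fC dd) E1 in E2.
have E3 : tint (fun u => k * (f (k * u) + C * decay (k * u))) =
    k * tint (fun u => f (k * u)) + tint (fun u => k * (C * decay (k * u))).
  rewrite -(tintZ k (ccomp _ cf) fk) -(@tintD _ _ _ (k * (C * K)) (k * (C * K))).
  - by apply: eq_tint => u _; rewrite mulrDr.
  - by apply: cont_mul; [exact: cont_cst|exact: ccomp].
  - by apply: cont_mul; [exact: cont_cst|exact: (ccomp (fun u => C * decay u))].
  - by move=> u u0; rewrite normrM gtr0_norm // -[leRHS]mulrA ler_wpM2l ?fk // ltW.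
  - by move=> u u0; rewrite normrM gtr0_norm // -[leRHS]mulrA ler_wpM2l ?dk // ltW.
rewrite E3 in E2; have {E2} := addIr _ E2 => ->.
by rewrite mulrAC mulfV ?mul1r // gt_eqF.
Qed.

End TintScale.

(** * The domain of free trajectories *)

Section OffRay.
Context {R : realType}.
Notation V3 := 'rV[R]_3.
Variables (p0 : V3).
Hypothesis p0_neq0 : p0 != 0.
Notation U := (off_forward_ray p0).

Lemma off_rayP (x : V3) : U x <-> forall s, 0 <= s -> x <> s *: p0.
Proof. by split=> H s s0; [apply/eqP|apply/eqP]; exact: H. Qed.

Lemma off_ray_neq0 (x : V3) : U x -> x != 0.
Proof. by move=> Ux; have := Ux 0 (lexx _); rewrite scale0r. Qed.

Lemma off_ray_scale (x : V3) (k : R) : 0 < k -> U x -> U (k *: x).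
Proof.
move=> k0 /off_rayP Ux; apply/off_rayP => s s0 E.
apply: (Ux (k^-1 * s)); first by rewrite mulr_ge0 // invr_ge0 ltW.
by rewrite -scalerA -E scalerA mulVf ?scale1r // gt_eqF.
Qed.

(** The reason for this domain: it is stable under backward free motion, so the integrands along
    backward trajectories never meet the singularity of V. *)
Lemma off_ray_sub (x : V3) (s : R) : 0 <= s -> U x -> U (x - s *: p0).
Proof.
move=> s0 /off_rayP Ux; apply/off_rayP => t t0 E.
apply: (Ux (t + s)); first by rewrite addr_ge0.
by rewrite scalerDl -E subrK.
Qed.

(* The backward ray from [x], rescaled by [1 + s], stays on the segment from
   [x] to [- p0]. *)
Lemma off_ray_segment (x : V3) (s : R) : 0 <= s <= 1 -> U x ->
  U (s *: x - (1 - s) *: p0).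
Proof.
move=> /andP[s0 s1] Ux; have s1' : 0 <= 1 - s by rewrite subr_ge0.
have [->|sn0] := eqVneq s 0.
  apply/off_rayP => t t0; rewrite scale0r add0r subr0 => /eqP.
  rewrite eq_sym -subr_eq0 -scaleNr -scalerBl scaler_eq0 (negPf p0_neq0) orbF opprK.
  by rewrite gt_eqF // ltr_wpDl.
apply: off_ray_sub => //; apply: off_ray_scale => //.
by rewrite lt_neqAle eq_sym sn0.
Qed.

Lemma dotC (x y : V3) : dot x y = dot y x.
Proof. by apply: eq_bigr => i _; rewrite mulrC. Qed.

Lemma dotDl (x y z : V3) : dot (x + y) z = dot x z + dot y z.
Proof. by rewrite -big_split; apply: eq_bigr => i _; rewrite mxE mulrDl. Qed.

Lemma dotZl (k : R) (x z : V3) : dot (k *: x) z = k * dot x z.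
Proof. by rewrite mulr_sumr; apply: eq_bigr => i _; rewrite mxE mulrA. Qed.

Lemma dotDr (x y z : V3) : dot z (x + y) = dot z x + dot z y.
Proof. by rewrite ![dot z _]dotC dotDl. Qed.

Lemma dotZr (k : R) (x z : V3) : dot z (k *: x) = k * dot z x.
Proof. by rewrite ![dot z _]dotC dotZl. Qed.

Lemma dotNl (x z : V3) : dot (- x) z = - dot x z.
Proof. by rewrite -scaleN1r dotZl mulN1r. Qed.

Lemma dotNr (x z : V3) : dot z (- x) = - dot z x.
Proof. by rewrite ![dot z _]dotC dotNl. Qed.

Lemma dot_delta (x : V3) i : dot x (delta_mx ord0 i) = x ord0 i.
Proof.
rewrite /dot (bigD1 i) //= mxE !eqxx mulr1 big1 ?addr0 // => j ji.
by rewrite mxE eqxx (negPf ji) mulr0.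
Qed.

Lemma dot_ge0 (x : V3) : 0 <= dot x x.
Proof. by apply: sumr_ge0 => i _; rewrite -expr2 sqr_ge0. Qed.

Lemma dot_eq0 (x : V3) : (dot x x == 0) = (x == 0).
Proof.
apply/idP/idP => [|/eqP ->]; last by rewrite /dot big1 // => i _; rewrite mxE mul0r.
rewrite psumr_eq0 => [/allP H|i _]; last by rewrite -expr2 sqr_ge0.
apply/eqP/rowP => i; rewrite mxE; apply/eqP.
by have := H i (mem_index_enum _); rewrite /= -expr2 sqrf_eq0.
Qed.

Lemma dot_gt0 (x : V3) : x != 0 -> 0 < dot x x.
Proof. by move=> x0; rewrite lt_neqAle eq_sym dot_eq0 x0 dot_ge0. Qed.

Lemma enorm_sqr (x : V3) : enorm x ^+ 2 = dot x x.
Proof. by rewrite sqr_sqrtr ?dot_ge0. Qed.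

Lemma enorm_gt0 (x : V3) : x != 0 -> 0 < enorm x.
Proof. by move=> x0; rewrite sqrtr_gt0 dot_gt0. Qed.

Lemma enormZ (k : R) (x : V3) : 0 <= k -> enorm (k *: x) = k * enorm x.
Proof. by move=> k0; rewrite /enorm dotZl dotZr mulrA -expr2 sqrtrM ?sqr_ge0 // sqrtr_sqr ger0_norm. Qed.

(* Strict Cauchy-Schwarz: equality would put [x] on the forward ray. *)
Lemma off_ray_dot (x : V3) : U x <-> dot x p0 < enorm x * enorm p0.
Proof.
have P0 := enorm_gt0 p0_neq0.
have id2 : dot (enorm p0 *: x - enorm x *: p0) (enorm p0 *: x - enorm x *: p0) =
    2 * enorm x * enorm p0 * (enorm x * enorm p0 - dot x p0).
  rewrite dotDl !dotDr !dotNl !dotNr !dotZl !dotZr -!enorm_sqr (dotC p0 x); ring.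
split=> [Ux|H]; last first.
  apply/off_rayP => s s0 E; move: H; rewrite E dotZl enormZ // -enorm_sqr -mulrA -expr2.
  by rewrite ltxx.
have x0 := enorm_gt0 (off_ray_neq0 Ux).
have : 0 < dot (enorm p0 *: x - enorm x *: p0) (enorm p0 *: x - enorm x *: p0).
  apply: dot_gt0; rewrite subr_eq0; apply/eqP => E.
  move/off_rayP: Ux => /(_ (enorm x / enorm p0)); apply; first by rewrite divr_ge0 // ltW.
  by rewrite mulrC -scalerA -E scalerA mulVf ?scale1r // gt_eqF.
by rewrite id2 pmulr_rgt0 ?mulr_gt0 // subr_gt0.
Qed.

Lemma dot_diff (x : V3) : differentiable (fun x : V3 => dot x x) x.
Proof.
have -> : (fun x : V3 => dot x x) = \sum_(i < 3) ((fun x : V3 => x ord0 i) * (fun x : V3 => x ord0 i)).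
  by apply/funext => y; rewrite fct_sumE.
apply: differentiable_sum => i.
by apply: differentiableM; exact: differentiable_coord.
Qed.

Lemma dotl_diff (y x : V3) : differentiable (fun x : V3 => dot x y) x.
Proof.
have -> : (fun x : V3 => dot x y) = \sum_(i < 3) ((fun x : V3 => x ord0 i) * cst (y ord0 i)).
  by apply/funext => z; rewrite fct_sumE.
apply: differentiable_sum => i.
by apply: differentiableM; [exact: differentiable_coord|exact: differentiable_cst].
Qed.

Lemma enorm_cont : continuous (@enorm R).
Proof.
move=> x; apply: (@continuous_comp _ _ _ (fun x : V3 => dot x x) (@Num.sqrt R)).
  exact: differentiable_continuous (dot_diff x).
exact: sqrt_continuous.
Qed.

Lemma off_ray_open : open U.
Proof.
have -> : U = (fun x : V3 => enorm x * enorm p0 - dot x p0) @^-1` [set r | 0 < r].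
  by apply/seteqP; split => x /=; rewrite subr_gt0; move/off_ray_dot.
apply: open_comp; last exact: open_gt.
have cd : continuous (fun x : V3 => dot x p0).
  by move=> x; exact: differentiable_continuous (dotl_diff p0 x).
have := cont_add (cont_mul enorm_cont (@cont_cst R V3 (enorm p0)))
  (cont_mul (@cont_cst R V3 (-1)) cd).
by under eq_fun do rewrite mulN1r; move=> c x _; exact: c.
Qed.

(** [(1+s)^-1 (x - s p0)] is the point of parameter [(1+s)^-1] on the segment from [- p0] to [x],
    and [K'] is the union of these segments over [K]. *)
Lemma compact_segments (K : set V3) : compact K -> K `<=` U ->
  exists2 K', compact K' & K' `<=` U /\
    forall x s, K x -> 0 <= s -> K' ((1 + s)^-1 *: (x - s *: p0)).
Proof.
move=> cK KU; pose f (z : R * V3) : V3 := z.1 *: z.2 - (1 - z.1) *: p0.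
have cf : continuous f.
  move=> z; apply: cvgB; first by apply: cvgZ; [exact: cvg_fst|exact: cvg_snd].
  apply: cvgZl; apply: cvgB; [exact: cvg_cst|exact: cvg_fst].
exists (f @` (`[0, 1]%classic `*` K)).
  apply: continuous_compact; first exact: continuous_subspaceT.
  apply: compact_setX => //; exact: segment_compact.
split=> [_ [[s x] [/= s01 Kx] <-]|x s Kx s0].
  by apply: off_ray_segment; [rewrite in_itv /= in s01|exact: KU].
have s1 : 0 < 1 + s by rewrite ltr_pwDl.
exists ((1 + s)^-1, x).
  split=> //=; rewrite in_itv /= invr_ge0 ltW //= invf_le1 //.
  by rewrite lerDl.
rewrite /f /= scalerBr scalerA; congr (_ - _ *: _).
by apply: (mulfI (lt0r_neq0 s1)); rewrite mulrBr mulrA mulfV ?gt_eqF // mulr1 mul1r addrAC subrr add0r.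
Qed.

End OffRay.

Lemma cont_at_scale {R : realType} {E : normedModType R} (c : R) (f : E -> R) x :
  {for x, continuous f} -> {for x, continuous (fun y => c * f y)}.
Proof. by move=> cf; exact: cvgM (cvg_cst _) cf. Qed.

(** * Homogeneous functions and their integrals along backward rays *)

Section Nice.
Context {R : realType}.
Notation V3 := 'rV[R]_3.
Variables (mu : R) (p0 : V3).
Hypothesis mu_gt0 : 0 < mu.
Hypothesis p0_neq0 : p0 != 0.
Notation U := (off_forward_ray p0).
Implicit Types (F G : V3 -> R) (d l : nat) (K : set V3).

(** Indexing by the decay [d], the negative of the degree of homogeneity, keeps the exponents
    natural numbers. Nothing is required on the forward ray. *)
Definition nice d F := smooth_on U F /\
  forall x (k : R), U x -> 0 < k -> F (k *: x) = F x / k ^+ d.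

Lemma nice_eq d F G : (forall x, U x -> F x = G x) -> nice d F -> nice d G.
Proof.
move=> FG [sF hF]; split=> [|x k Ux k0].
  apply: (@eq_smooth_on _ _ U F); [exact: off_ray_open| |exact: sF].
  by move=> x; rewrite inE; exact: FG.
by rewrite -!FG ?hF //; exact: off_ray_scale.
Qed.

Lemma nice_cst (c : R) : nice 0 (fun=> c).
Proof.
split; first by apply: smooth_cst; exact: off_ray_open.
by move=> *; rewrite expr0 divr1.
Qed.

Lemma nice0 d : nice d (fun=> 0).
Proof.
split; first by apply: smooth_cst; exact: off_ray_open.
by move=> *; rewrite mul0r.
Qed.

Lemma nice_add d F G : nice d F -> nice d G -> nice d (fun x => F x + G x).
Proof.
move=> [sF hF] [sG hG]; split; first by apply: smooth_add => //; exact: off_ray_open.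
by move=> x k Ux k0; rewrite hF // hG // mulrDl.
Qed.

Lemma nice_mul d d' F G : nice d F -> nice d' G -> nice (d + d') (fun x => F x * G x).
Proof.
move=> [sF hF] [sG hG]; split; first by apply: smooth_mul => //; exact: off_ray_open.
by move=> x k Ux k0; rewrite hF // hG // exprD invfM mulrACA.
Qed.

Lemma nice_scale d (c : R) F : nice d F -> nice d (fun x => c * F x).
Proof. exact: (nice_mul (nice_cst c)). Qed.

Lemma nice_sum d (I : Type) (r : seq I) (F : I -> V3 -> R) :
  (forall i, nice d (F i)) -> nice d (fun x => \sum_(i <- r) F i x).
Proof.
move=> nF; elim: r => [|i r IH].
  by under [fun x => _]eq_fun do rewrite big_nil; exact: nice0.
by under [fun x => _]eq_fun do rewrite big_cons; exact: nice_add.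
Qed.

(** Differentiating [F (k x) = k^-d F x] gives [k (D_a F) (k x) = k^-d D_a F x]. *)
Lemma nice_dirD d F (a : V3) : nice d F -> nice d.+1 (dirD a F).
Proof.
move=> [sF hF]; split; first exact: smooth_dirD.
move=> x k Ux k0; have kn0 : k != 0 by rewrite gt_eqF.
have E1 := @dirD_comp R V3 V3 (fun x => k *: x) (fun x => k *: x)
  (fun h b y => etrans (scalerDr k (h *: b) y) (congr1 (fun z => z + k *: y)
     (etrans (scalerA k h b) (etrans (congr1 (fun c => c *: b) (mulrC k h)) (esym (scalerA h k b))))))
  F a x.
have Ukx := off_ray_scale k0 Ux.
have E2 : dirD (k *: a) F (k *: x) = k * dirD a F (k *: x).
  have := smooth_lin k a 0 sF Ukx.
  by rewrite addr0 (derive0 F (k *: x)) addr0.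
have E3 : dirD a (F \o (fun x => k *: x)) x = dirD a F x / k ^+ d.
  have N : {near x, (F \o (fun x => k *: x)) =1 (fun y => (k ^+ d)^-1 * F y)}.
    apply: filterS (open_nbhs_nbhs (conj (off_ray_open p0_neq0) Ux)) => y Uy /=.
    by rewrite hF // mulrC.
  rewrite [RHS]mulrC; apply: etrans (near_eq_derive a N) _.
  exact: (@deriveMl _ _ F (k ^+ d)^-1 x a (smooth_derivable sF Ux)).
rewrite E3 E2 in E1; apply: (mulfI kn0); rewrite -E1 exprS invfM.
by rewrite mulrCA [k * (_ * _)]mulrA mulfV // mul1r.
Qed.

Lemma nice_iterD d F (s : seq V3) : nice d F -> nice (size s + d) (foldr dirD F s).
Proof. by move=> nF; elim: s => //= a s; exact: nice_dirD. Qed.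

(** Homogeneity pulls out the factor [(1+s)^-d], and the rescaled point lies in the compact set of
    [compact_segments], where [F] is bounded. *)
Lemma nice_bound d F K : nice d F -> compact K -> K `<=` U ->
  exists2 C, 0 <= C & forall x s, K x -> 0 <= s ->
    `|F (x - s *: p0)| <= C * (1 + s) ^- d.
Proof.
move=> [sF hF] cK KU; have [K' cK' [K'U HK']] := compact_segments p0_neq0 cK KU.
have [C C0 HC] : exists2 C, 0 <= C & forall y, K' y -> `|F y| <= C.
  have [[y0 K'y0]|no] := pselect (exists y, K' y); last first.
    by exists 0 => // y K'y; exfalso; apply: no; exists y.
  have cF : {within K', continuous (fun y => `|F y|)}.
    apply: continuous_in_subspaceT => y; rewrite inE => K'y.
    exact: (cvg_comp _ _ (smooth_cont sF (K'U _ K'y)) (@norm_continuous _ R^o (F y))).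
  have [c _ Hc] := @EVT_max_rV R 3 _ K' (ex_intro _ y0 K'y0) cK' cF.
  by exists `|F c| => // y K'y; apply: Hc; rewrite inE.
exists C => // x s Kx s0; have s1 : 0 < 1 + s by rewrite ltr_pwDl.
have K'y := HK' x s Kx s0.
have -> : x - s *: p0 = (1 + s) *: ((1 + s)^-1 *: (x - s *: p0)).
  by rewrite scalerA mulfV ?scale1r // gt_eqF.
rewrite hF //; last exact: K'U.
rewrite normrM normfV (ger0_norm (exprn_ge0 _ (ltW s1))).
by rewrite ler_wpM2r ?HC // invr_ge0 exprn_ge0 // ltW.
Qed.

(* The absolute value, harmless for [u >= 0], makes the integrand continuous on
   the whole line. *)
Definition path_fun l F (x : V3) (u : R) : R :=
  (`|u| / mu) ^+ l * F (x - (`|u| / mu) *: p0).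

Definition path_int l F (x : V3) : R := tint (path_fun l F x).

Lemma speed_ge0 (u : R) : 0 <= `|u| / mu.
Proof. by rewrite divr_ge0 // ltW. Qed.

Lemma path_in (x : V3) (u : R) : U x -> U (x - (`|u| / mu) *: p0).
Proof. by move=> Ux; apply: off_ray_sub => //; exact: speed_ge0. Qed.

Lemma path_fun_cont l d F x : nice d F -> U x -> continuous (path_fun l F x).
Proof.
move=> [sF _] Ux u.
have cs : continuous (fun u : R => `|u : R| / mu).
  by apply: cont_mul; [exact: norm_continuous|exact: cont_cst].
have cp : continuous (fun u : R => x - (`|u| / mu) *: p0).
  have -> : (fun u : R => x - (`|u| / mu) *: p0) =
      (fun s => s *: (- p0) + x) \o (fun u => `|u| / mu).
    by apply/funext => t /=; rewrite scalerN addrC.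
  by move=> t; apply: continuous_comp; [exact: cs|exact: line_cont].
apply: cvgM.
  exact: (cvg_comp _ _ (cs u) (@exprn_continuous _ l (`|u| / mu))).
exact: (cvg_comp _ _ (cp u) (smooth_cont sF (path_in u Ux))).
Qed.

(** With [s = |u| / mu] one has [s^l (1+s)^-d <= (1+s)^-2] as soon as [l + 2 <= d]; this inequality
    is the convergence condition throughout. *)
Lemma path_fun_bound l d F K : nice d F -> (l.+2 <= d)%N -> compact K -> K `<=` U ->
  exists2 C, 0 <= C & forall x u, K x -> `|path_fun l F x u| <= C * decay u.
Proof.
move=> nF ld cK KU; have [C C0 HC] := nice_bound nF cK KU.
have m0 : 0 < mu^-1 by rewrite invr_gt0.
have [M M0 HM] := decay_scale m0.
exists (C * M) => [|x u Kx]; first by rewrite mulr_ge0.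
have s0 := speed_ge0 u; set s := `|u| / mu in s0 *.
have s1 : 0 < 1 + s by rewrite ltr_pwDl.
have dE : decay s <= M * decay u.
  have -> : decay u = decay `|u| by rewrite /decay normr_id.
  by rewrite /s mulrC; exact: HM.
rewrite -mulrA; apply: le_trans (ler_wpM2l C0 dE).
rewrite /path_fun -/s normrM (ger0_norm (exprn_ge0 _ s0)).
apply: le_trans (ler_wpM2l (exprn_ge0 _ s0) (HC x s Kx s0)) _.
rewrite mulrCA; apply: ler_wpM2l => //.
have -> : d = (2 + (l + (d - l.+2)))%N by rewrite addnA add2n subnKC.
rewrite /decay (ger0_norm s0).
rewrite exprD invfM mulrCA; apply: ler_piMr; first by rewrite invr_ge0 exprn_ge0 // ltW.
rewrite ler_pdivrMr ?exprn_gt0 // mul1r exprD.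
have t1 : 1 <= 1 + s by rewrite lerDl.
apply: (@le_trans _ _ ((1 + s) ^+ l)).
  by apply: lerXn2r; rewrite ?nnegrE ?addr_ge0 // lerDr.
by rewrite ler_peMr ?exprn_ege1 // exprn_ge0 // ltW.
Qed.

Lemma off_ray_compact_nbhs (x : V3) : U x ->
  exists2 d : R, 0 < d & exists K, [/\ compact K, K `<=` U & ball x d `<=` K].
Proof.
move=> Ux; have [e e0 He] := (nbhs_ballP x _).1 (open_nbhs_nbhs (conj (off_ray_open p0_neq0) Ux)).
have e2 : 0 < e / 2 by rewrite divr_gt0.
exists (e / 2) => //; exists (closed_ball x (e / 2)); split.
- apply: bounded_closed_compact; last exact: closed_ball_closed.
  rewrite closed_ballE //; exists (`|x| + e / 2); split; first exact: num_real.
  move=> M xM y; rewrite /closed_ball_ /= => xy.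
  apply: ltW; apply: le_lt_trans xM; have -> : y = x - (x - y) by rewrite subKr.
  by apply: le_trans (ler_normB _ _) _; rewrite lerD2l.
- move=> y xy; apply: He; apply: (@closed_ball_subset _ _ x (e / 2)) => //.
  by rewrite ltr_pdivrMr // ltr_pMr // ltrDl.
- exact: subset_closed_ball.
Qed.

Lemma path_fun_dirD l d F (y a : V3) u : nice d F -> U y ->
  derivable (path_fun l F ^~ u) y a /\
  dirD a (path_fun l F ^~ u) y = path_fun l (dirD a F) y u.
Proof.
move=> [sF _] Uy; set s := `|u| / mu.
have AL (h : R) (b z : V3) : h *: b + z - s *: p0 = h *: id b + (z - s *: p0).
  by rewrite addrA.
have dF := smooth_derivable sF (path_in u Uy) : derivable F (y - s *: p0) a.
have dFs := @derivable_comp R V3 V3 (fun z => z - s *: p0) id AL F a y dF.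
have E := @dirD_comp R V3 V3 (fun z => z - s *: p0) id AL F a y.
have -> : path_fun l F ^~ u = (fun z => s ^+ l * (F \o (fun z => z - s *: p0)) z) by [].
split; first exact: (derivableM (derivable_cst (s ^+ l) y a) dFs).
apply: etrans (deriveMl _ dFs) _; exact: (congr1 (fun z => s ^+ l * z) E).
Qed.

Lemma path_int_regular l d F (x : V3) : nice d F -> (l.+2 <= d)%N -> U x ->
  {for x, continuous (path_int l F)} /\
  forall a, derivable (path_int l F) x a /\
    dirD a (path_int l F) x = path_int l (dirD a F) x.
Proof.
move=> nF ld Ux; have [e e0 [K [cK KU eK]]] := off_ray_compact_nbhs Ux.
have [C C0 HC] := path_fun_bound nF ld cK KU.
have cu y : ball x e y -> continuous (path_fun l F y).
  by move=> /eK /KU Uy; exact: path_fun_cont nF Uy.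
split.
  apply: (@tint_cont R V3 (path_fun l F) x C e e0 cu) => [u u0|y u /eK Ky _].
    have cF := smooth_cont nF.1 (path_in u Ux).
    have ct := @translate_cont R V3 (- ((`|u| / mu) *: p0)) x.
    have cG : {for x, continuous (fun z : V3 => F (z - (`|u| / mu) *: p0))}.
      exact: (cvg_comp _ _ ct cF).
    exact: (cont_at_scale cG).
  exact: HC.
move=> a; have [C' C'0 HC'] := path_fun_bound (nice_dirD a nF) (leqW ld) cK KU.
have [D1 D2] := @tint_derive R V3 (path_fun l F) x a C C' e e0 cu
  (fun y u by_ _ => HC y u (eK _ by_))
  (fun y u by_ _ => (path_fun_dirD l a u nF (KU _ (eK _ by_))).1)
  (fun y u by_ _ => eq_ind_r (fun z => `|z| <= _) (HC' y u (eK _ by_))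
     (path_fun_dirD l a u nF (KU _ (eK _ by_))).2).
split=> //; apply: etrans D2 _; apply: eq_tint => u _.
exact: (path_fun_dirD l a u nF Ux).2.
Qed.

Lemma path_intD l d F G (x : V3) : nice d F -> nice d G -> (l.+2 <= d)%N -> U x ->
  path_int l (fun y => F y + G y) x = path_int l F x + path_int l G x.
Proof.
move=> nF nG ld Ux; have [e e0 [K [cK KU eK]]] := off_ray_compact_nbhs Ux.
have Kx : K x by apply: eK; exact: ballxx.
have [C C0 HC] := path_fun_bound nF ld cK KU.
have [C' C'0 HC'] := path_fun_bound nG ld cK KU.
rewrite -(tintD (path_fun_cont nF Ux) (path_fun_cont nG Ux)
  (fun u _ => HC x u Kx) (fun u _ => HC' x u Kx)).
by apply: eq_tint => u _; rewrite /path_fun mulrDr.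
Qed.

Lemma path_intZ l d (c : R) F (x : V3) : nice d F -> (l.+2 <= d)%N -> U x ->
  path_int l (fun y => c * F y) x = c * path_int l F x.
Proof.
move=> nF ld Ux; have [e e0 [K [cK KU eK]]] := off_ray_compact_nbhs Ux.
have Kx : K x by apply: eK; exact: ballxx.
have [C C0 HC] := path_fun_bound nF ld cK KU.
rewrite -(tintZ c (path_fun_cont nF Ux) (fun u _ => HC x u Kx)).
by apply: eq_tint => u _; rewrite /path_fun mulrCA.
Qed.

Lemma path_int_eq l F G (x : V3) : (forall y, U y -> F y = G y) -> U x ->
  path_int l F x = path_int l G x.
Proof.
by move=> FG Ux; apply: eq_tint => u _; rewrite /path_fun FG //; exact: path_in.
Qed.

Lemma path_int0 l (x : V3) : path_int l (fun=> 0) x = 0.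
Proof. by rewrite -[RHS]tint0; apply: eq_tint => u _; rewrite /path_fun mulr0. Qed.

Lemma path_int_sum l d (I : Type) (r : seq I) (F : I -> V3 -> R) (x : V3) :
  (forall i, nice d (F i)) -> (l.+2 <= d)%N -> U x ->
  path_int l (fun y => \sum_(i <- r) F i y) x = \sum_(i <- r) path_int l (F i) x.
Proof.
move=> nF ld Ux; elim: r => [|i r IH].
  by under [fun y => _]eq_fun do rewrite big_nil; rewrite big_nil path_int0.
under [fun y => _]eq_fun do rewrite big_cons.
rewrite (path_intD (nF i) (nice_sum _ nF) ld Ux) big_cons.
by rewrite IH.
Qed.

(** Rescaling time by [k] in the integral at [k x] produces [k^(l+1)] from the weight and the
    measure, against [k^-d] from [F]. *)
Lemma nice_path_int l d F : nice d F -> (l.+2 <= d)%N ->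
  nice (d - l.+1) (path_int l F).
Proof.
move=> nF ld; split.
  have oU := off_ray_open p0_neq0.
  (* The class ranges over all [d'] because each derivative under the integral raises the decay by
     one. *)
  apply: (@smooth_coind _ _ _ [set g | exists d' F', [/\ nice d' F', (l.+2 <= d')%N
    & g = path_int l F']] oU) => [_ [d' [F' [nF' ld' ->]]] x Ux|_ a [d' [F' [nF' ld' ->]]]|].
  - have [cF DF] := path_int_regular nF' ld' Ux; split => // [a|k a b].
      by have [] := DF a.
    have H c : 'D_c (path_int l F') x = path_int l (dirD c F') x by have [_] := DF c.
    rewrite !H -(path_intZ _ (nice_dirD a nF') (leqW ld') Ux).
    rewrite -(path_intD (nice_scale k (nice_dirD a nF')) (nice_dirD b nF') (leqW ld') Ux).
    by apply: path_int_eq Ux => y Uy; have [sF _] := nF'; exact: (smooth_lin k a b sF Uy).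
  - exists (path_int l (dirD a F')).
      by exists d'.+1, (dirD a F'); split => //; [exact: nice_dirD|exact: leqW].
    by move=> x Ux; have [_ DF] := path_int_regular nF' ld' Ux; have [_] := DF a.
  - by exists d, F.
move=> x k Ux k0.
have [e e0 [K [cK KU eK]]] := off_ray_compact_nbhs Ux.
have Kx : K x by apply: eK; exact: ballxx.
have [C C0 HC] := path_fun_bound nF ld cK KU.
have k10 : 0 < k^-1 by rewrite invr_gt0.
have kn0 : k != 0 by rewrite gt_eqF.
pose c := k ^+ l / k ^+ d.
have cf : continuous (fun u => c * path_fun l F x u).
  by apply: cont_mul; [exact: cont_cst|exact: path_fun_cont nF Ux].
have cC u : 0 <= u -> `|c * path_fun l F x u| <= (`|c| * C) * decay u.
  by move=> _; rewrite normrM -mulrA ler_wpM2l // HC.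
have E1 := tint_scale k10 cf cC.
have E2 := tintZ c (path_fun_cont nF Ux) (fun u _ => HC x u Kx).
rewrite invrK E2 in E1.
have -> : path_int l F (k *: x) = tint (fun u => c * path_fun l F x (k^-1 * u)).
  apply: eq_tint => u u0; rewrite /path_fun.
  have sE : `|u| / mu = k * (`|k^-1 * u| / mu).
    by rewrite normrM (gtr0_norm k10) !mulrA mulfV // mul1r.
  rewrite [in LHS]sE -(scalerA k) -scalerBr.
  rewrite nF.2 //; last exact: path_in.
  by rewrite exprMn /c [F _ / _]mulrC mulrACA.
rewrite E1 -/(path_int l F x) /c.
have -> : k ^+ d = k ^+ (d - l.+1) * k ^+ l * k.
  by rewrite -exprD -exprSr -addnS subnK // ltnW.
rewrite !invfM; set P := path_int l F x; set q := (k ^+ (d - _))^-1.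
have kl0 : k ^+ l != 0 by rewrite expf_neq0.
rewrite -[RHS]mulr1 -(mulfV kl0) -(mulr1 (k ^+ l / _)) -(mulVf kn0); ring.
Qed.

End Nice.

(** * Derivatives of the Coulomb potential *)

Section Coulomb.
Context {R : realType}.
Notation V3 := 'rV[R]_3.
Notation X0 := [set x : V3 | x != 0].

Definition rinv (x : V3) : R := (enorm x)^-1.

Lemma neq0_open : open X0.
Proof.
have -> : X0 = (@enorm R) @^-1` [set r | 0 < r].
  apply/seteqP; split => x /=; first exact: enorm_gt0.
  by apply: contraTneq => ->; rewrite /enorm /dot big1 ?sqrtr0 ?ltxx // => i _; rewrite mxE mul0r.
by apply: open_comp; [move=> x _; exact: enorm_cont|exact: open_gt].
Qed.

Lemma dotl_dirD (b x a : V3) : dirD a (fun x => dot x b) x = dot a b.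
Proof.
rewrite /dirD /derive; apply: lim_near_cst => //.
near=> h; have h0 : h != 0 by near: h; exact: nbhs_dnbhs_neq.
by rewrite /= dotDl dotZl addrK /GRing.scale /= mulrA mulVf ?mul1r.
Unshelve. all: end_near. Qed.

Lemma dot_dirD (x a : V3) : dirD a (fun x => dot x x) x = 2 * dot x a.
Proof.
have E : (fun x : V3 => dot x x) = \sum_(i < 3) ((fun x : V3 => x ord0 i) * (fun x : V3 => x ord0 i)).
  by apply/funext => y; rewrite fct_sumE.
have dc i : derivable (fun x : V3 => x ord0 i) x a.
  exact/diff_derivable/differentiable_coord.
have dcE i : 'D_a (fun x : V3 => x ord0 i) x = a ord0 i.
  have := dotl_dirD (delta_mx ord0 i) x a; rewrite /dirD dot_delta => <-.
  by congr ('D_a _ x); apply/funext => y; rewrite dot_delta.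
rewrite /dirD E derive_sum => [|i]; last exact: derivableM.
rewrite /dot mulr_sumr; apply: eq_bigr => i _.
by rewrite deriveM // dcE /GRing.scale /= -mulr2n mulr_natl.
Qed.

Lemma rinv_dirD (x a : V3) : x != 0 ->
  derivable rinv x a /\ dirD a rinv x = - dot x a * rinv x ^+ 3.
Proof.
move=> x0; have r0 := enorm_gt0 x0.
pose g (t : R) := dot (t *: a + x) (t *: a + x).
have dg : is_derive (0 : R) 1 g (2 * dot x a).
  have := @is_derive_line R V3 (fun x => dot x x) a x 0.
  rewrite scale0r add0r dot_dirD; apply.
  exact/diff_derivable/dot_diff.
have g0 : g 0 = dot x x by rewrite /g scale0r add0r.
have gp : 0 < g 0 by rewrite g0 dot_gt0.
have g0n : 0 < g 0 by [].
have ds := @is_derive1_comp R (@Num.sqrt R) g 0 _ _ (is_derive1_sqrt gp) dg.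
have hn0 : (@Num.sqrt R \o g) 0 != 0 by rewrite /= sqrtr_eq0 -ltNge.
have di := is_deriveV hn0 ds.
have hE : (@Num.sqrt R \o g) 0 = enorm x by rewrite /= g0.
have lineE : (fun t : R => rinv (t *: a + x)) = (fun y => ((@Num.sqrt R \o g) y)^-1) by [].
split.
  by apply/derivable1P; rewrite lineE; case: di.
have := @dirD_line R V3 rinv a x 0; rewrite scale0r add0r => <-.
rewrite lineE; have [_ ->] := di; rewrite hE /GRing.scale /= g0 -/(enorm x) /rinv.
have rn : enorm x != 0 by rewrite gt_eqF.
by field.
Qed.

(** The algebra generated by constants, linear forms and [1/|x|]. It is closed under
    differentiation, since the derivative of [1/|x|] along [a] is [- (x.a) / |x|^3]; this makes V
    smooth off the origin. *)
Inductive coulomb_alg : (V3 -> R) -> Prop :=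
| calg_cst c : coulomb_alg (fun=> c)
| calg_dot b : coulomb_alg (fun x => dot x b)
| calg_rinv : coulomb_alg rinv
| calg_add f g of coulomb_alg f & coulomb_alg g : coulomb_alg (fun x => f x + g x)
| calg_mul f g of coulomb_alg f & coulomb_alg g : coulomb_alg (fun x => f x * g x).

Lemma calg_c1 f x : coulomb_alg f -> x != 0 -> c1_at f x.
Proof.
move=> cf x0; elim: cf => [c|b||g h _ cg _ ch|g h _ cg _ ch].
- exact: c1_cst.
- exact/diff_c1/dotl_diff.
- split=> [|a|k a b].
  + apply: (cvg_comp _ _ (@enorm_cont R x)); apply: inv_continuous.
    by rewrite gt_eqF // enorm_gt0.
  + exact: (rinv_dirD a x0).1.
  + have H c := (rinv_dirD c x0).2; rewrite /dirD in H.
    by rewrite !H dotDr dotZr; ring.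
- exact: c1_add.
- exact: c1_mul.
Qed.

Lemma smooth_calg f : coulomb_alg f -> smooth_on X0 f.
Proof.
apply: (@smooth_coind _ _ X0 coulomb_alg neq0_open) => [g cg x x0|g a].
  exact: calg_c1.
elim=> [c|b||g1 g2 c1 [h1 k1 H1] c2 [h2 k2 H2]|g1 g2 c1 [h1 k1 H1] c2 [h2 k2 H2]].
- exists (fun=> 0); first exact: calg_cst.
  by move=> x _; exact: derive_cst.
- exists (fun=> dot a b); first exact: calg_cst.
  by move=> x _; exact: dotl_dirD.
- exists (fun x => -1 * dot x a * (rinv x * (rinv x * rinv x))).
    by do !apply: calg_mul; [exact: calg_cst|exact: calg_dot|exact: calg_rinv..].
  by move=> x x0; rewrite (rinv_dirD a x0).2 mulN1r.
- exists (fun x => h1 x + h2 x); first exact: calg_add.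
  move=> x x0; rewrite -H1 // -H2 //; apply: deriveD.
    by have [_ d _] := calg_c1 c1 x0; exact: d.
  by have [_ d _] := calg_c1 c2 x0; exact: d.
- exists (fun x => g1 x * h2 x + g2 x * h1 x).
    by apply: calg_add; exact: calg_mul.
  move=> x x0; rewrite -H1 // -H2 //; apply: deriveM.
    by have [_ d _] := calg_c1 c1 x0; exact: d.
  by have [_ d _] := calg_c1 c2 x0; exact: d.
Qed.

Variable kappa : R.
Notation V := (coulomb kappa).

Lemma smooth_coulomb : smooth_on X0 V.
Proof. by apply: smooth_calg; apply: calg_mul; [exact: calg_cst|exact: calg_rinv]. Qed.

Lemma coulomb_dirD (x a : V3) : x != 0 -> dirD a V x = kappa * dot x a * rinv x ^+ 3.
Proof.
move=> x0; have [d e] := rinv_dirD a x0.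
rewrite /dirD in e *; rewrite (@deriveMl _ _ rinv (- kappa) x a d) e; ring.
Qed.

Lemma rinvX_dirD n (x b : V3) : x != 0 ->
  derivable (fun y => rinv y ^+ n.+1) x b /\
  dirD b (fun y => rinv y ^+ n.+1) x = - n.+1%:R * dot x b * rinv x ^+ n.+3.
Proof.
move=> x0; have [d E] := rinv_dirD b x0.
have -> : (fun y => rinv y ^+ n.+1) = rinv ^+ n.+1 by apply/funext => y; rewrite exprfctE.
split; first exact: derivableX.
by rewrite /dirD in E *; rewrite deriveX // E /GRing.scale /= !exprS; ring.
Qed.

Lemma coulomb_dirD2 (x a b : V3) : x != 0 ->
  dirD b (dirD a V) x =
    kappa * (dot a b * rinv x ^+ 3 - 3 * (dot x a * dot x b) * rinv x ^+ 5).
Proof.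
move=> x0; have [d3 e3] := rinvX_dirD 2 b x0.
have dd : derivable (fun y : V3 => dot y a) x b by exact/diff_derivable/dotl_diff.
have ed := dotl_dirD a x b.
have N : {near x, dirD a V =1 (fun y => kappa * (dot y a * rinv y ^+ 3))}.
  apply: filterS (open_nbhs_nbhs (conj neq0_open x0)) => y /= y0.
  by rewrite coulomb_dirD // mulrA.
have dm := derivableM dd d3.
have E1 := near_eq_derive b N.
have E2 := @deriveMl _ _ _ kappa x b dm.
have E3 := deriveM dd d3.
apply: etrans E1 (etrans E2 _); rewrite E3; congr (_ * _).
rewrite /dirD in e3 ed; rewrite e3 ed (dotC b a) /GRing.scale /=; ring.
Qed.

Lemma sum_dot_delta (x : V3) :
  \sum_(i < 3) dot x (delta_mx ord0 i) * dot x (delta_mx ord0 i) = dot x x.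
Proof. by apply: eq_bigr => i _; rewrite !dot_delta. Qed.

End Coulomb.

(** * Covariant tensor fields *)

Section Words.
Context {R : realType}.
Implicit Types (J I K Z : seq 'I_3) (T S : seq 'I_3 -> R).

(** A full contraction over index words. Ordered words, with repetitions, match the iterated sums of
    [Domega]. *)
Fixpoint wsum (m : nat) T : R :=
  if m is m'.+1 then \sum_(i < 3) wsum m' (fun J => T (i :: J)) else T [::].

Lemma eq_wsum m T S : (forall J, size J = m -> T J = S J) -> wsum m T = wsum m S.
Proof.
elim: m T S => [|m IH] T S TS /=; first exact: TS.
by apply: eq_bigr => i _; apply: IH => J Jm; apply: TS; rewrite /= Jm.
Qed.

Lemma wsumD m T S : wsum m (fun J => T J + S J) = wsum m T + wsum m S.
Proof.
elim: m T S => [|m IH] T S //=.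
by rewrite -big_split; apply: eq_bigr => i _; exact: IH.
Qed.

Lemma wsumZ m (c : R) T : wsum m (fun J => c * T J) = c * wsum m T.
Proof.
elim: m T => [|m IH] T //=.
by rewrite mulr_sumr; apply: eq_bigr => i _; exact: IH.
Qed.

Lemma wsum0 m : wsum m (fun=> 0) = 0.
Proof. by elim: m => [|m IH] //=; rewrite big1. Qed.

Lemma wsum_sum m (A : Type) (r : seq A) (T : A -> seq 'I_3 -> R) :
  wsum m (fun J => \sum_(a <- r) T a J) = \sum_(a <- r) wsum m (T a).
Proof.
elim: r => [|a r IH].
  by rewrite big_nil -[RHS](wsum0 m); apply: eq_wsum => J _; rewrite big_nil.
rewrite big_cons -IH -wsumD; apply: eq_wsum => J _; exact: big_cons.
Qed.

Lemma wsum_rcons m T : wsum m.+1 T = \sum_(i < 3) wsum m (fun J => T (rcons J i)).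
Proof.
elim: m T => [|m IH] T //.
rewrite -[LHS]/(\sum_(i < 3) wsum m.+1 (fun J => T (i :: J))).
under eq_bigr do rewrite IH.
by rewrite exchange_big.
Qed.

Lemma wsum_cat m n T : wsum (m + n) T = wsum m (fun J => wsum n (fun I => T (J ++ I))).
Proof. by elim: m T => [|m IH] T //=; apply: eq_bigr => i _; rewrite IH. Qed.

Variable A : 'M[R]_3.

(** The action of [A] on a tensor, with one factor of [A] per slot. *)
Fixpoint rotT J T : R :=
  if J is i :: J' then \sum_(k < 3) A k i * rotT J' (fun K => T (k :: K)) else T [::].

Lemma eq_rotT J T S : (forall K, size K = size J -> T K = S K) -> rotT J T = rotT J S.
Proof.
elim: J T S => [|i J IH] T S TS /=; first exact: TS.
apply: eq_bigr => k _; congr (_ * _); apply: IH => K KJ; apply: TS.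
by rewrite /= KJ.
Qed.

Lemma rotTD J T S : rotT J (fun K => T K + S K) = rotT J T + rotT J S.
Proof.
elim: J T S => [|i J IH] T S //=; rewrite -big_split; apply: eq_bigr => k _.
by rewrite IH mulrDr.
Qed.

Lemma rotTZ J (c : R) T : rotT J (fun K => c * T K) = c * rotT J T.
Proof.
elim: J T => [|i J IH] T //=; rewrite mulr_sumr; apply: eq_bigr => k _.
by rewrite IH mulrCA.
Qed.

Lemma rotT0 J : rotT J (fun=> 0) = 0.
Proof. by elim: J => [|i J IH] //=; rewrite big1 // => k _; rewrite IH mulr0. Qed.

Lemma rotT_sum J (B : Type) (r : seq B) (T : B -> seq 'I_3 -> R) :
  rotT J (fun K => \sum_(b <- r) T b K) = \sum_(b <- r) rotT J (T b).
Proof.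
elim: r => [|b r IH].
  by rewrite big_nil -[RHS](rotT0 J); apply: eq_rotT => K _; rewrite big_nil.
rewrite big_cons -IH -rotTD; apply: eq_rotT => K _; exact: big_cons.
Qed.

Lemma rotT_rcons J i T :
  rotT (rcons J i) T = \sum_(k < 3) A k i * rotT J (fun K => T (rcons K k)).
Proof.
elim: J T => [|j J IH] T //=.
under eq_bigr do rewrite IH mulr_sumr.
rewrite exchange_big /=; apply: eq_bigr => k _; rewrite mulr_sumr.
by apply: eq_bigr => l _; rewrite mulrCA.
Qed.

Lemma rotT_cat J I T S :
  rotT (J ++ I) (fun K => T (take (size J) K) * S (drop (size J) K)) =
  rotT J T * rotT I S.
Proof.
elim: J T => [|i J IH] T /=.
  by rewrite -rotTZ; apply: eq_rotT => K _; rewrite take0 drop0.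
by rewrite mulr_suml; apply: eq_bigr => k _; rewrite -mulrA -IH.
Qed.

End Words.

(** * Orthogonal covariance of derivatives *)

Section Covariance.
Context {R : realType}.
Notation V3 := 'rV[R]_3.
Notation e := (delta_mx ord0 : 'I_3 -> V3).

Lemma dot_mx (x y : V3) : dot x y = (x *m y^T) ord0 ord0.
Proof. by rewrite mxE; apply: eq_bigr => i _; rewrite mxE. Qed.

Definition orthogonal_mx (A : 'M[R]_3) := A *m A^T = 1%:M.

Lemma dot_orth A (x y : V3) : orthogonal_mx A -> dot (x *m A) (y *m A) = dot x y.
Proof. by move=> oA; rewrite !dot_mx trmx_mul mulmxA -(mulmxA x) oA mulmx1. Qed.

Lemma orth_col A (j l : 'I_3) : orthogonal_mx A ->
  \sum_(k < 3) A k j * A k l = (j == l)%:R.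
Proof.
move=> /mulmx1C /matrixP /(_ j l); rewrite !mxE => <-.
by apply: eq_bigr => k _; rewrite mxE.
Qed.

Lemma orth_row A (j l : 'I_3) : orthogonal_mx A ->
  \sum_(k < 3) A j k * A l k = (j == l)%:R.
Proof.
move=> /matrixP /(_ j l); rewrite !mxE => <-.
by apply: eq_bigr => k _; rewrite mxE.
Qed.

Lemma dirD_lin_sum (O : set V3) (F : V3 -> R) (x : V3) (c : 'I_3 -> R) :
  smooth_on O F -> O x -> dirD (\sum_(l < 3) c l *: e l) F x =
    \sum_(l < 3) c l * dirD (e l) F x.
Proof.
move=> sF Ox.
suff H (r : seq 'I_3) : dirD (\sum_(l <- r) c l *: e l) F x =
    \sum_(l <- r) c l * dirD (e l) F x by exact: H.
elim: r => [|l r IH]; first by rewrite !big_nil /dirD derive0.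
by rewrite !big_cons -IH; exact: (smooth_lin (c l) (e l) _ sF Ox).
Qed.

Lemma dirD_coord (O : set V3) (F : V3 -> R) (x a : V3) :
  smooth_on O F -> O x -> dirD a F x = \sum_(l < 3) a ord0 l * dirD (e l) F x.
Proof. by move=> sF Ox; rewrite [in LHS](row_sum_delta a); exact: dirD_lin_sum sF Ox. Qed.

Lemma dirD_mulmx A (F : V3 -> R) (x a : V3) :
  dirD a (fun y => F (y *m A)) x = dirD (a *m A) F (x *m A).
Proof.
apply: (@dirD_comp R V3 V3 (fun y => y *m A) (fun y => y *m A)) => h b y.
by rewrite mulmxDl -scalemxAl.
Qed.

Lemma smooth_rotT A (O : set V3) J (W : seq 'I_3 -> V3 -> R) : open O ->
  (forall K, size K = size J -> smooth_on O (W K)) ->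
  smooth_on O (fun y => rotT A J (fun K => W K y)) /\
  forall a x, O x -> dirD a (fun y => rotT A J (fun K => W K y)) x =
    rotT A J (fun K => dirD a (W K) x).
Proof.
move=> oO; elim: J W => [|i J IH] W sW /=.
  by split=> //; exact: sW.
have sWk k := IH (fun K => W (k :: K)) (fun K KJ => sW (k :: K) (congr1 S KJ)).
have sk k : smooth_on O (fun y => A k i * rotT A J (fun K => W (k :: K) y)).
  by apply: smooth_scale => //; exact: (sWk k).1.
split; first exact: smooth_sum.
move=> a x Ox.
suff H (r : seq 'I_3) : dirD a (fun y => \sum_(k <- r) A k i * rotT A J (fun K => W (k :: K) y)) x =
   \sum_(k <- r) A k i * rotT A J (fun K => dirD a (W (k :: K)) x) by exact: H.
elim: r => [|k r IHr].
  under [fun y => _]eq_fun do rewrite big_nil.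
  by rewrite big_nil; exact: derive_cst.
under [fun y => _]eq_fun do rewrite big_cons.
rewrite big_cons -IHr -((sWk k).2 a x Ox).
have d1 := smooth_derivable (sk k) Ox : derivable _ x a.
have d2 := smooth_derivable (smooth_sum r oO sk) Ox : derivable _ x a.
apply: etrans (deriveD d1 d2) _; congr (_ + _).
exact: (deriveMl _ (smooth_derivable (sWk k).1 Ox)).
Qed.

(** Differentiating the transformation law gives an identity with one more factor of [A]; the
    relation [A^T A = 1], in the form [orth_col], solves it for the derivative at [x *m A]. *)
Lemma cov_dirD A (O : set V3) J (F : V3 -> R) (W : seq 'I_3 -> V3 -> R) :
  orthogonal_mx A -> open O -> (forall x, O x -> O (x *m A)) -> smooth_on O F ->
  (forall K, size K = size J -> smooth_on O (W K)) ->
  (forall x, O x -> F (x *m A) = rotT A J (fun K => W K x)) ->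
  forall l x, O x -> dirD (e l) F (x *m A) =
    \sum_(k < 3) A k l * rotT A J (fun K => dirD (e k) (W K) x).
Proof.
move=> oA oO OA sF sW FW l x Ox.
have [_ DR] := smooth_rotT A oO sW.
have E k : rotT A J (fun K => dirD (e k) (W K) x) =
    \sum_(m < 3) A k m * dirD (e m) F (x *m A).
  rewrite -DR // -[LHS](_ : dirD (e k) (fun y => F (y *m A)) x = _).
    rewrite dirD_mulmx (dirD_coord _ sF (OA x Ox)).
    by apply: eq_bigr => m _; rewrite -rowE mxE.
  apply: near_eq_derive.
  by apply: filterS (open_nbhs_nbhs (conj oO Ox)) => y Oy; exact: FW.
under eq_bigr do rewrite E mulr_sumr.
rewrite exchange_big /= (bigD1 l) //= [X in _ + X]big1 ?addr0 => [|m ml].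
  under eq_bigr do rewrite mulrA.
  by rewrite -mulr_suml orth_col // eqxx mul1r.
under eq_bigr do rewrite mulrA.
by rewrite -mulr_suml orth_col // eq_sym (negPf ml) mul0r.
Qed.

End Covariance.

(** * Operations on covariant homogeneous tensors *)

Section NiceTensors.
Context {R : realType}.
Notation V3 := 'rV[R]_3.
Notation e := (delta_mx ord0 : 'I_3 -> V3).
Variables (mu kappa : R) (p0 : V3).
Hypothesis mu_gt0 : 0 < mu.
Hypothesis p0_neq0 : p0 != 0.
Notation U := (off_forward_ray p0).
Notation V := (coulomb kappa).
Implicit Types (W : seq 'I_3 -> V3 -> R).

Definition covT r W := forall A, orthogonal_mx A -> p0 *m A = p0 ->
  forall J, size J = r -> forall x, U x -> W J (x *m A) = rotT A J (fun K => W K x).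

Definition niceT r d W := (forall J, size J = r -> nice p0 d (W J)) /\ covT r W.

Lemma off_ray_mulmx A (x : V3) : orthogonal_mx A -> p0 *m A = p0 -> U x -> U (x *m A).
Proof.
move=> oA pA /off_rayP Ux; apply/off_rayP => s s0 E; apply: (Ux s s0).
have E' : x *m A *m A^T = s *: (p0 *m A) *m A^T by rewrite pA E.
by move: E'; rewrite scalemxAl -!mulmxA oA !mulmx1.
Qed.

Lemma enorm_orth A (x : V3) : orthogonal_mx A -> enorm (x *m A) = enorm x.
Proof. by move=> oA; rewrite /enorm dot_orth. Qed.

Lemma coulomb_iterD_cov A (I : seq 'I_3) (x : V3) : orthogonal_mx A -> x != 0 ->
  foldr dirD V (map e I) (x *m A) = rotT A I (fun K => foldr dirD V (map e K) x).
Proof.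
move=> oA; elim: I x => [|i I IH] x x0 /=; first by rewrite /coulomb enorm_orth.
have sV K := smooth_iterD (map e K) (smooth_coulomb kappa).
have XA (y : V3) : y != 0 -> y *m A != 0.
  by move=> y0; rewrite -dot_eq0 dot_orth // dot_eq0.
exact: (cov_dirD oA neq0_open XA (sV I) (fun K _ => sV K) IH i x0).
Qed.

Lemma nice_coulomb : nice p0 1 V.
Proof.
split; first by apply: smooth_onS (smooth_coulomb kappa) => x; exact: off_ray_neq0.
move=> x k Ux k0; rewrite /coulomb enormZ ?ltW // expr1 invfM.
by rewrite mulrA mulrAC.
Qed.

Lemma nice_coulomb_iterD (I : seq 'I_3) : nice p0 (size I).+1 (foldr dirD V (map e I)).
Proof.
by have := nice_iterD p0_neq0 (map e I) nice_coulomb; rewrite size_map addn1.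
Qed.

(** The tensor product with the derivatives of V: the first [r] letters index [W], the remaining
    ones the derivatives. *)
Definition mulV_T r W K (x : V3) := W (take r K) x * foldr dirD V (map e (drop r K)) x.

Lemma nice_mulV r d m W : niceT r d W -> niceT (r + m) (d + m.+1) (mulV_T r W).
Proof.
move=> [nW cW]; split=> [J Jr|A oA pA J Jr x Ux].
  have sd : size (drop r J) = m by rewrite size_drop Jr addKn.
  have := nice_coulomb_iterD (drop r J); rewrite sd; apply: nice_mul => //.
  by apply: nW; rewrite size_takel // Jr leq_addr.
have sd : size (take r J) = r by rewrite size_takel // Jr leq_addr.
rewrite /mulV_T (cW A oA pA _ sd x Ux).
rewrite (coulomb_iterD_cov _ oA (off_ray_neq0 Ux)) -rotT_cat sd.
by rewrite cat_take_drop.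
Qed.

(** Moves the last letter to the front, which accounts for a momentum derivative transferred from
    the first place to the last. *)
Definition cycT W Z := W (rotr 1 Z).

Lemma cycT_rcons W Z j : cycT W (rcons Z j) = W (j :: Z).
Proof. by rewrite /cycT rotr1_rcons. Qed.

Lemma nice_cyc r d W : niceT r d W -> niceT r d (cycT W).
Proof.
move=> [nW cW]; split=> [J Jr|A oA pA J]; first by apply: nW; rewrite size_rotr.
case/lastP: J => [|Z j] Jr x Ux.
  by have := cW A oA pA [::] Jr x Ux.
have sj : size (j :: Z) = r by rewrite -Jr size_rcons.
rewrite cycT_rcons rotT_rcons (cW A oA pA _ sj x Ux) /=.
apply: eq_bigr => k _; congr (_ * _); apply: eq_rotT => K _.
by rewrite cycT_rcons.
Qed.

Definition divT W Z (x : V3) := \sum_(j < 3) dirD (e j) (W (j :: Z)) x.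

(** The derivative at [x *m A] is first expressed through derivatives at [x] by [orth_col]. A
    divergence contracts two slots, and the two factors of [A] then cancel by [orth_row]. *)
Lemma nice_div r d W : niceT r.+1 d W -> niceT r d.+1 (divT W).
Proof.
move=> [nW cW]; split=> [J Jr|A oA pA J Jr x Ux].
  by apply: nice_sum => // j; apply: nice_dirD => //; apply: nW; rewrite /= Jr.
have oU := off_ray_open p0_neq0.
have sW j K : size K = size J -> smooth_on U (W (j :: K)).
  by move=> KJ; apply: (nW _ _).1; rewrite /= KJ Jr.
have UA y : U y -> U (y *m A) by exact: off_ray_mulmx.
rewrite /divT rotT_sum.
have E j : dirD (e j) (W (j :: J)) (x *m A) =
    \sum_(k < 3) \sum_(l < 3) A k j * A l j * rotT A J (fun K => dirD (e k) (W (l :: K)) x).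
  have sF y : U y -> W (j :: J) (y *m A) = rotT A (j :: J) (fun K => W K y).
    by move=> Uy; apply: cW; rewrite //= Jr.
  pose G l y := rotT A J (fun K => W (l :: K) y).
  have sG l : smooth_on U (G l) := (smooth_rotT A oU (sW l)).1.
  have DE k : dirD (e k) (fun y => W (j :: J) (y *m A)) x =
      \sum_(l < 3) A l j * rotT A J (fun K => dirD (e k) (W (l :: K)) x).
    transitivity (dirD (e k) (fun y => \sum_(l < 3) A l j * G l y) x).
      apply: near_eq_derive; apply: filterS (open_nbhs_nbhs (conj oU Ux)) => y Uy.
      exact: sF.
    suff H (r' : seq 'I_3) : dirD (e k) (fun y => \sum_(l <- r') A l j * G l y) x =
       \sum_(l <- r') A l j * dirD (e k) (G l) x.
      rewrite H; apply: eq_bigr => l _; congr (_ * _).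
      exact: (smooth_rotT A oU (sW l)).2.
    elim: r' => [|l r' IHr].
      under [fun y => _]eq_fun do rewrite big_nil.
      by rewrite big_nil; exact: derive_cst.
    under [fun y => _]eq_fun do rewrite big_cons.
    rewrite big_cons -IHr.
    have sk l' : smooth_on U (fun y => A l' j * G l' y) by apply: smooth_scale.
    have d1 := smooth_derivable (sk l) Ux : derivable _ x (e k).
    have d2 := smooth_derivable (smooth_sum r' oU sk) Ux : derivable _ x (e k).
    apply: etrans (deriveD d1 d2) _; congr (_ + _).
    exact: (deriveMl _ (smooth_derivable (sG l) Ux)).
  have D k : dirD (e k) (fun y => W (j :: J) (y *m A)) x =
      \sum_(m < 3) A k m * dirD (e m) (W (j :: J)) (x *m A).
    rewrite dirD_mulmx (dirD_coord _ (sW j J erefl) (UA x Ux)).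
    by apply: eq_bigr => m _; rewrite -rowE mxE.
  transitivity (\sum_(k < 3) A k j * \sum_(m < 3) A k m * dirD (e m) (W (j :: J)) (x *m A)).
    under [RHS]eq_bigr do rewrite mulr_sumr.
    rewrite [RHS]exchange_big /= (bigD1 j) //= [X in _ = _ + X]big1 ?addr0 => [|m mj].
      under [RHS]eq_bigr do rewrite mulrA.
      by rewrite -mulr_suml orth_col // eqxx mul1r.
    under eq_bigr do rewrite mulrA.
    by rewrite -mulr_suml orth_col // eq_sym (negPf mj) mul0r.
  apply: eq_bigr => k _; rewrite -D DE mulr_sumr.
  by apply: eq_bigr => l _; rewrite mulrA.
under eq_bigr do rewrite E.
rewrite exchange_big /=; apply: eq_bigr => k _.
rewrite exchange_big /= (bigD1 k) //= [X in _ + X]big1 ?addr0 => [|l lk].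
  by rewrite -mulr_suml orth_row // eqxx mul1r.
by rewrite -mulr_suml orth_row // eq_sym (negPf lk) mul0r.
Qed.

Definition pathT l W Z : V3 -> R := path_int mu p0 l (W Z).

(** [A] fixes [p0], so it carries the backward trajectory of [x] to that of [x *m A]; what remains
    is that the integral commutes with the finite sums in [rotT]. *)
Lemma nice_path r d l W : niceT r d W -> (l.+2 <= d)%N -> niceT r (d - l.+1) (pathT l W).
Proof.
move=> [nW cW] ld; split=> [J Jr|A oA pA J Jr x Ux].
  by apply: nice_path_int => //; exact: nW.
have -> : pathT l W J (x *m A) = path_int mu p0 l (fun y => rotT A J (fun K => W K y)) x.
  apply: eq_tint => u _; rewrite /path_fun; congr (_ * _).
  have -> : x *m A - (`|u| / mu) *: p0 = (x - (`|u| / mu) *: p0) *m A.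
    by rewrite mulmxBl -scalemxAl pA.
  by rewrite (cW A oA pA J Jr) //; exact: path_in.
have {}nW K : size K = size J -> nice p0 d (W K) by move=> KJ; apply: nW; rewrite KJ.
(* Niceness of the partial sums is proved along with the identity, since additivity of [path_int]
   requires it. *)
suff H : nice p0 d (fun y => rotT A J (fun K => W K y)) /\
   path_int mu p0 l (fun y => rotT A J (fun K => W K y)) x = rotT A J (fun K => pathT l W K x).
  exact: H.2.
clear Jr cW; rewrite /pathT.
elim: J W nW => [|i J IH] W nW /=; first by split=> //; exact: nW.
have IHk k := IH (fun K => W (k :: K)) (fun K KJ => nW (k :: K) (congr1 S KJ)).
have nk k : nice p0 d (fun y => A k i * rotT A J (fun K => W (k :: K) y)).
  by apply: nice_scale => //; exact: (IHk k).1.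
split; first exact: nice_sum.
rewrite (path_int_sum mu_gt0 p0_neq0 _ nk ld Ux); apply: eq_bigr => k _.
by rewrite (path_intZ mu_gt0 p0_neq0 _ (IHk k).1 ld Ux) (IHk k).2.
Qed.

Lemma niceT_scale r d (c : R) W : niceT r d W -> niceT r d (fun J x => c * W J x).
Proof.
move=> [nW cW]; split=> [J Jr|A oA pA J Jr x Ux]; first by apply: nice_scale => //; exact: nW.
by rewrite (cW A oA pA J Jr) // rotTZ.
Qed.

End NiceTensors.

(** * Phase-space test functions *)

Lemma shear_cont {R : realType} {E : normedModType R} (s : R) :
  continuous (fun z : E * E => z.1 + s *: z.2).
Proof.
move=> z; apply: cvgD; first exact: cvg_fst.
by apply: cvgZr; exact: cvg_snd.
Qed.

Lemma shear_pair_cont {R : realType} {E : normedModType R} (s : R) :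
  continuous (fun z : E * E => (z.1 + s *: z.2, z.2)).
Proof. by move=> z; apply: cvg_pair => /=; [exact: shear_cont|exact: cvg_snd]. Qed.

Section PhaseTest.
Context {R : realType}.
Notation V3 := 'rV[R]_3.
Notation e := (delta_mx ord0 : 'I_3 -> V3).
Notation VV := (V3 * V3)%type.
Variables (p0 : V3).
Hypothesis p0_neq0 : p0 != 0.
Notation U := (off_forward_ray p0).
Implicit Types (Psi : phase_fun R) (q p a : V3).

Definition unc Psi (z : VV) : R := Psi z.1 z.2.

Definition pball (eps : R) : set VV := [set z | ball p0 eps z.2].

Lemma open_pball eps : open (pball eps).
Proof.
apply: (@open_comp _ _ (fun z : VV => z.2) (ball p0 eps)); last exact: ball_open.
by move=> z _; exact: cvg_snd.
Qed.

Lemma dqE Psi i q p : dq i Psi q p = dirD (e i, 0) (unc Psi) (q, p).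
Proof.
have := @dirD_comp R V3 VV (fun x => (x, p)) (fun x => (x, 0)) _ (unc Psi) (e i) q.
apply=> h a x; congr (_, _); rewrite /=.
by rewrite scaler0 add0r.
Qed.

Lemma dpE Psi i q p : dp i Psi q p = dirD (0, e i) (unc Psi) (q, p).
Proof.
have := @dirD_comp R V3 VV (fun x => (q, x)) (fun x => (0, x)) _ (unc Psi) (e i) p.
apply=> h a x; congr (_, _); rewrite /=.
by rewrite scaler0 add0r.
Qed.

(** All conditions are restricted to momenta near [p0], with one compact set for all of them: the
    distributions see only the germ at [p = p0], test functions of [q] alone qualify, and free
    shifts can be accommodated by shrinking the ball. *)
Definition phase_test_at (eps : R) (K : set V3) Psi := smooth_on (pball eps) (unc Psi) /\
  forall q p, ball p0 eps p -> ~ K q -> Psi q p = 0.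

Definition phase_test Psi := exists eps K, [/\ 0 < eps, compact K, K `<=` U & phase_test_at eps K Psi].

Lemma phase_test_atS eps eps' K K' Psi : eps' <= eps -> K `<=` K' -> phase_test_at eps K Psi ->
  phase_test_at eps' K' Psi.
Proof.
move=> ee KK [sP zP]; split=> [|q p bp nK].
  by apply: smooth_onS sP => z; exact: le_ball.
by apply: zP; [exact: le_ball bp|move/KK].
Qed.

Lemma TT2 Psi Psi' : phase_test Psi -> phase_test Psi' ->
  exists eps K, [/\ 0 < eps, compact K, K `<=` U, phase_test_at eps K Psi & phase_test_at eps K Psi'].
Proof.
move=> [eps [K [e0 cK KU TP]]] [eps' [K' [e0' cK' KU' TP']]].
exists (Num.min eps eps'), (K `|` K'); split.
- by rewrite lt_min e0.
- exact: compactU.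
- by move=> x [/KU|/KU'].
- by apply: phase_test_atS TP; [rewrite ge_min lexx|left].
- by apply: phase_test_atS TP'; [rewrite ge_min lexx orbT|right].
Qed.

Lemma phase_test_at_add eps K Psi Psi' : phase_test_at eps K Psi -> phase_test_at eps K Psi' ->
  phase_test_at eps K (fun q p => Psi q p + Psi' q p).
Proof.
move=> [s1 z1] [s2 z2]; split=> [|q p bp nK]; last by rewrite z1 // z2 // addr0.
by apply: (@smooth_add _ _ _ (unc Psi) (unc Psi')) => //; exact: open_pball.
Qed.

Lemma phase_test_add Psi Psi' : phase_test Psi -> phase_test Psi' -> phase_test (fun q p => Psi q p + Psi' q p).
Proof.
move=> T1 T2; have [eps [K [e0 cK KU TP TP']]] := TT2 T1 T2.
by exists eps, K; split=> //; exact: phase_test_at_add.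
Qed.

Lemma phase_test_at_scale eps K (c : R) Psi : phase_test_at eps K Psi -> phase_test_at eps K (fun q p => c * Psi q p).
Proof.
move=> [s1 z1]; split=> [|q p bp nK]; last by rewrite z1 // mulr0.
by apply: (@smooth_scale _ _ _ c (unc Psi)) => //; exact: open_pball.
Qed.

Lemma phase_test_scale (c : R) Psi : phase_test Psi -> phase_test (fun q p => c * Psi q p).
Proof.
by move=> [eps [K [e0 cK KU TP]]]; exists eps, K; split=> //; exact: phase_test_at_scale.
Qed.

Lemma TT0 : phase_test (fun _ _ => 0).
Proof.
exists 1, set0; split=> //; first exact: compact0.
split=> //; apply: (@smooth_cst _ _ _ 0); exact: open_pball.
Qed.

Lemma phase_test_at_vanish eps K Psi q p : closed K -> phase_test_at eps K Psi -> ball p0 eps p -> ~ K q ->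
  \forall z \near (q, p), unc Psi z = 0.
Proof.
move=> cK [sP zP] bp nK.
have n1 : nbhs q (~` K) by apply: open_nbhs_nbhs; split=> //; exact: closed_openC.
have n2 : nbhs p (ball p0 eps) by apply: open_nbhs_nbhs; split=> //; exact: ball_open.
exists (~` K, ball p0 eps) => // -[x y] [/= nx by_]; exact: zP.
Qed.

Lemma phase_test_at_dirD eps K Psi b : compact K -> phase_test_at eps K Psi ->
  phase_test_at eps K (fun q p => dirD b (unc Psi) (q, p)).
Proof.
move=> cK TP; have [sP zP] := TP; split=> [|q p bp nK].
  have -> : unc (fun q p => dirD b (unc Psi) (q, p)) = dirD b (unc Psi).
    by apply/funext => -[].
  exact: smooth_dirD.
have clK : closed K by apply: compact_closed => //; exact: norm_hausdorff.
have N := phase_test_at_vanish clK TP bp nK.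
by rewrite /dirD (near_eq_derive b N); exact: derive_cst.
Qed.

Lemma phase_test_dq Psi i : phase_test Psi -> phase_test (dq i Psi).
Proof.
move=> [eps [K [e0 cK KU TP]]]; exists eps, K; split=> //.
have -> : dq i Psi = fun q p => dirD (e i, 0) (unc Psi) (q, p).
  by apply/funext => q; apply/funext => p; exact: dqE.
exact: phase_test_at_dirD.
Qed.

(** [F] may be singular at the origin, but there [Psi] vanishes: the product is smooth off the
    origin and zero off [K], and these two open sets cover everything because [K] avoids the
    origin. *)
Lemma phase_test_mul (F : V3 -> R) Psi : smooth_on [set x : V3 | x != 0] F -> phase_test Psi ->
  phase_test (fun q p => F q * Psi q p).
Proof.
move=> sF [eps [K [e0 cK KU TP]]]; exists eps, K; split=> //.
have [sP zP] := TP; split=> [|q p bp nK]; last by rewrite zP // mulr0.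
have clK : closed K by apply: compact_closed => //; exact: norm_hausdorff.
have oN : open [set z : VV | ~ K z.1].
  apply: (@open_comp _ _ (fun z : VV => z.1) (~` K)); last exact: closed_openC.
  by move=> z _; exact: cvg_fst.
have oX : open [set z : VV | z.1 != 0].
  apply: (@open_comp _ _ (fun z : VV => z.1) [set x : V3 | x != 0]); last exact: neq0_open.
  by move=> z _; exact: cvg_fst.
have oP : open (pball eps) by exact: open_pball.
have sFz : smooth_on [set z : VV | z.1 != 0] (fun z => F z.1).
  apply: (@smooth_comp R VV V3 fst fst [set x : V3 | x != 0] _ _ _ F neq0_open sF) => //.
  by move=> z; exact: cvg_fst.
have s1 : smooth_on ([set z : VV | z.1 != 0] `&` pball eps)
    (unc (fun q p => F q * Psi q p)).
  apply: (@smooth_mul _ _ _ (fun z => F z.1) (unc Psi)); first exact: openI.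
    by apply: smooth_onS sFz => z [].
  by apply: smooth_onS sP => z [].
have s2 : smooth_on ([set z : VV | ~ K z.1] `&` pball eps)
    (unc (fun q p => F q * Psi q p)).
  apply: (@eq_smooth_on _ _ _ (fun=> 0)); first exact: openI.
    by move=> [x y]; rewrite inE => -[/= nx by_]; rewrite /unc /= zP // mulr0.
  by apply: smooth_cst; exact: openI.
apply: smooth_onS (smooth_onU s1 s2) => -[x y] by_.
have [x0|x0] := eqVneq x 0; [right|by left].
by split=> //= /KU; rewrite x0 => /off_ray_neq0; rewrite eqxx.
Qed.

(** Otherwise points of [K] at distance tending to zero from the complement would cluster at a point
    of [K], which is interior to the open domain. *)
Lemma compact_thicken K : compact K -> K `<=` U ->
  exists2 d : R, 0 < d & forall x y, K x -> ball x d y -> U y.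
Proof.
move=> cK KU; apply: contrapT => H.
have Hn (n : nat) : exists z : V3 * V3, [/\ K z.1, ball z.1 n.+1%:R^-1 z.2 & ~ U z.2].
  apply: contrapT => Hn; apply: H; exists n.+1%:R^-1; first by rewrite invr_gt0.
  by move=> x y Kx xy; apply: contrapT => nU; apply: Hn; exists (x, y).
have [z Hz] := choice Hn.
have [x [Kx cx]] : exists x, K x /\ cluster ((fun n => (z n).1) @ \oo) x.
  have [|x Kx] := cK ((fun n => (z n).1) @ \oo) _; last by exists x.
  by exists 0%N => // n _; have [] := Hz n.
have [r r0 Hr] := (nbhs_ballP x _).1 (open_nbhs_nbhs (conj (off_ray_open p0_neq0) (KU x Kx))).
have r2 : 0 < r / 2 by rewrite divr_gt0.
have tail : ((fun n => (z n).1) @ \oo) [set y | exists2 n, n.+1%:R^-1 < r / 2 & y = (z n).1].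
  have : (fun n : nat => n.+1%:R^-1 : R) @ \oo --> (0 : R) by exact: cvg_harmonic.
  move/cvgrPdist_lt => /(_ _ r2); apply: filterS => n.
  by rewrite sub0r normrN ger0_norm ?invr_ge0 // => h; exists n.
have [y [[n nr ->] xb]] := cx _ _ tail (nbhsx_ballx x _ r2).
have [_ zb nU] := Hz n; apply: nU; apply: Hr.
by rewrite [r]splitr; apply: ball_triangle xb _; exact: le_ball (ltW nr) _ zb.
Qed.

(** For [p] near [p0] the support moves to [x - s p = (x + s (p0 - p)) - s p0] with [x] in [K]; the
    bracket stays in a thickening of [K] inside the domain, and subtracting [s p0] does not leave
    the domain. *)
Lemma phase_test_shift (s : R) Psi : 0 <= s -> phase_test Psi -> phase_test (fun q p => Psi (q + s *: p) p).
Proof.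
move=> s0 [eps [K [e0 cK KU [sP zP]]]].
have [d d0 Kd] := compact_thicken cK KU.
(* The bound [d / (s + 1)] makes [s * eps' < d], so that the spread of momenta moves positions by
   less than [d]. *)
pose eps' := Num.min eps (d / (s + 1)) / 2.
have s1 : 0 < s + 1 by rewrite ltr_wpDl.
have m0 : 0 < Num.min eps (d / (s + 1)) by rewrite lt_min e0 divr_gt0.
have e0' : 0 < eps' by rewrite divr_gt0.
have ee : eps' < eps.
  apply: (@lt_le_trans _ _ (Num.min eps (d / (s + 1)))); last by rewrite ge_min lexx.
  by rewrite ltr_pdivrMr // ltr_pMr // ltrDl.
have ed : s * eps' < d.
  apply: (@le_lt_trans _ _ (s * (d / (s + 1)))).
    apply: ler_wpM2l => //; apply: (@le_trans _ _ (Num.min eps (d / (s + 1)))).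
      by rewrite /eps'; move: m0; set m := Num.min _ _; lra.
    by rewrite ge_min lexx orbT.
  by rewrite mulrCA gtr_pMr // ltr_pdivrMr // mul1r ltrDl.
pose A (z : VV) : VV := (z.1 + s *: z.2, z.2).
have AL (h : R) (a z : VV) : A (h *: a + z) = h *: A a + A z.
  by rewrite /A /= scalerDr; congr (_, _); rewrite /= scalerDr !scalerA (mulrC s) addrACA.
have cA : continuous A.
  exact: shear_pair_cont.
pose f (z : V3 * V3) : V3 := z.1 - s *: z.2.
have cf : continuous f.
  have -> : f = (fun z : V3 * V3 => z.1 + (- s) *: z.2).
    by apply/funext => z; rewrite /f scaleNr.
  exact: shear_cont.
have cB : compact (closed_ball p0 eps').
  apply: bounded_closed_compact; last exact: closed_ball_closed.
  rewrite closed_ballE //; exists (`|p0| + eps'); split; first exact: num_real.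
  move=> M xM y; rewrite /closed_ball_ /= => xy.
  apply: ltW; apply: le_lt_trans xM; have -> : y = p0 - (p0 - y) by rewrite subKr.
  by apply: le_trans (ler_normB _ _) _; rewrite lerD2l.
exists eps', (f @` (K `*` closed_ball p0 eps')); split=> //.
- apply: continuous_compact; first exact: continuous_subspaceT.
  exact: compact_setX.
- move=> _ [[x p] [/= Kx pb] <-]; rewrite /f /=.
  have -> : x - s *: p = (x + s *: (p0 - p)) - s *: p0 by rewrite scalerBr addrA addrAC addrK.
  apply: off_ray_sub => //; apply: (Kd x) => //.
  rewrite -ball_normE /= opprD addrA subrr add0r normrN normrZ ger0_norm //.
  apply: le_lt_trans ed; apply: ler_wpM2l => //.
  by move: pb; rewrite closed_ballE.
split=> [|q p bp nK].
  have := @smooth_comp R VV VV A A (pball eps) AL AL cA (unc Psi) (@open_pball eps) sP.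
  by apply: smooth_onS => z; apply: le_ball; exact: ltW.
apply: zP; first exact: le_ball (ltW ee) _ bp.
move=> Kq; apply: nK; exists (q + s *: p, p); last by rewrite /f /= addrK.
by split=> //=; exact: subset_closed_ball.
Qed.

End PhaseTest.

(** * Test functions of position *)

Section TestFunction.
Context {R : realType}.
Notation V3 := 'rV[R]_3.
Notation e := (delta_mx ord0 : 'I_3 -> V3).

(** [smooth] speaks of coordinate derivatives; a derivative along [a] is a linear combination of
    these, so [smooth_coind] is applied to their linear span. *)
Inductive pderiv_span (psi : V3 -> R) : (V3 -> R) -> Prop :=
| pspan_iter I : pderiv_span psi (foldr (fun i g => pderiv i g) psi I)
| pspan_add f g of pderiv_span psi f & pderiv_span psi g : pderiv_span psi (fun x => f x + g x)
| pspan_scale c f of pderiv_span psi f : pderiv_span psi (fun x => c * f x)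
| pspan0 : pderiv_span psi (fun=> 0).

Lemma smooth_test (psi : V3 -> R) : smooth psi -> smooth_on setT psi.
Proof.
move=> spsi.
have c1 f x : pderiv_span psi f -> c1_at f x.
  elim=> [I|g h _ cg _ ch|c g _ cg|]; [exact/diff_c1/spsi|exact: c1_add| |exact: c1_cst].
  by apply: c1_mul => //; exact: c1_cst.
apply: (@smooth_coind _ _ setT (pderiv_span psi) openT) => [f Pf x _|f a Pf|].
- exact: c1.
- suff [g Pg fg] : exists2 g, pderiv_span psi g & forall x, dirD a f x = g x.
    by exists g.
  elim: Pf => [I|f1 f2 P1 [g1 Pg1 H1] P2 [g2 Pg2 H2]|c f1 P1 [g1 Pg1 H1]|].
  + set F := foldr _ _ _.
    have DF x : dirD a F x = \sum_(l < 3) a ord0 l * dirD (e l) F x.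
      have cF : c1_at F x by exact/diff_c1/spsi.
      have lin : forall k b c, 'D_(k *: b + c) F x = k * 'D_b F x + 'D_c F x by case: cF.
      rewrite [in LHS](row_sum_delta a).
      suff H (r : seq 'I_3) : dirD (\sum_(l <- r) a ord0 l *: e l) F x =
          \sum_(l <- r) a ord0 l * dirD (e l) F x by exact: H.
      elim: r => [|l r IH]; first by rewrite !big_nil /dirD derive0.
      by rewrite !big_cons -IH; exact: (lin (a ord0 l) (e l)).
    exists (fun x => \sum_(l < 3) a ord0 l * dirD (e l) F x) => //.
    suff H (r : seq 'I_3) : pderiv_span psi (fun x => \sum_(l <- r) a ord0 l * dirD (e l) F x).
      exact: H.
    elim: r => [|l r IH].
      by under [fun x => _]eq_fun do rewrite big_nil; exact: pspan0.
    under [fun x => _]eq_fun do rewrite big_cons.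
    by apply: pspan_add => //; apply: pspan_scale; exact: (pspan_iter psi (l :: I)).
  + exists (fun x => g1 x + g2 x); first exact: pspan_add.
    move=> x; rewrite -H1 -H2; apply: deriveD.
      by have [_ d _] := c1 _ x P1; exact: d.
    by have [_ d _] := c1 _ x P2; exact: d.
  + exists (fun x => c * g1 x); first exact: pspan_scale.
    move=> x; rewrite -H1; apply: deriveMl.
    by have [_ d _] := c1 _ x P1; exact: d.
  + exists (fun=> 0); first exact: pspan0.
    by move=> x; exact: derive_cst.
- exact: (pspan_iter psi [::]).
Qed.

Lemma phase_test_test (p0 : V3) (psi : V3 -> R) :
  test_function (off_forward_ray p0) psi -> phase_test p0 (fun q _ => psi q).
Proof.
move=> [spsi cK KU]; exists 1, (closure [set x | psi x != 0]); split=> //; split=> [|q p _ nK].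
  have := @smooth_comp R (V3 * V3)%type V3 fst fst setT (fun _ _ _ => erefl)
    (fun _ _ _ => erefl) (fun z => @cvg_fst _ _ _ _ _) psi openT (smooth_test spsi).
  by move=> H s z _; exact: H.
apply/eqP; apply: contrapT => /negP qn; apply: nK; exact: subset_closure.
Qed.

End TestFunction.

Lemma pair_cst_cont {R : realType} {E : normedModType R} (p : E) :
  continuous (fun q : E => (q, p)).
Proof. by move=> q; apply: cvg_pair; [done|exact: cvg_cst]. Qed.

(** * Pairing with functions smooth off the forward ray *)

Section Pairing.
Context {R : realType}.
Notation V3 := 'rV[R]_3.
Notation e := (delta_mx ord0 : 'I_3 -> V3).
Notation VV := (V3 * V3)%type.
Variables (p0 : V3).
Hypothesis p0_neq0 : p0 != 0.
Notation U := (off_forward_ray p0).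
Implicit Types (Psi : phase_fun R) (F : V3 -> R).

Lemma cont_bsupp_compact (h : V3 -> R) (K : set V3) : continuous h -> compact K ->
  (forall q, ~ K q -> h q = 0) -> cont_bsupp h.
Proof.
move=> ch cK zh; split=> //.
have [M [_ HM]] := compact_bounded cK; exists (M + 1) => q qM.
have M1 : M < M + 1 by rewrite ltrDl.
apply: zh => Kq; have := HM (M + 1) M1 q Kq.
by rewrite ltNge in qM; move/negP: qM.
Qed.

(** The product extends by zero across the forward ray: it is smooth on the domain of [F] and zero
    off [K], and these two open sets cover the space. *)
Lemma pair_smooth F Psi : smooth_on U F -> phase_test p0 Psi ->
  smooth_on setT (fun q => F q * Psi q p0) /\ cont_bsupp (fun q => F q * Psi q p0).
Proof.
move=> sF [eps [K [e0 cK KU TP]]]; have [sP zP] := TP.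
have oU := off_ray_open p0_neq0.
have clK : closed K by apply: compact_closed => //; exact: norm_hausdorff.
have oN : open (~` K) by exact: closed_openC.
have bp : ball p0 eps p0 by exact: ballxx.
have cpair : continuous (fun q : V3 => (q, p0)) by exact: pair_cst_cont.
have AL (h : R) (a z : V3) : (h *: a + z, p0) = h *: ((a, 0) : VV) + (z, p0).
  by congr (_, _); rewrite /= scaler0 add0r.
have LL (k : R) (a b : V3) : (k *: a + b, 0) = k *: ((a, 0) : VV) + (b, 0).
  by congr (_, _); rewrite /= scaler0 add0r.
have sQ : smooth_on setT (fun q => Psi q p0).
  have := @smooth_comp R V3 VV (fun q => (q, p0)) (fun a => (a, 0)) (pball p0 eps)
    AL LL cpair (unc Psi) (@open_pball R p0 eps) sP.
  by apply: smooth_onS => z _.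
have sh : smooth_on setT (fun q => F q * Psi q p0).
  have s1 : smooth_on U (fun q => F q * Psi q p0).
    by apply: smooth_mul => //; apply: smooth_onS sQ.
  have s2 : smooth_on (~` K) (fun q => F q * Psi q p0).
    apply: (@eq_smooth_on _ _ _ (fun=> 0)) => //; last exact: smooth_cst.
    by move=> x; rewrite inE => nK; rewrite zP // mulr0.
  apply: smooth_onS (smooth_onU s1 s2) => q _.
  by have [Kq|nK] := pselect (K q); [left; exact: KU|right].
split=> //; apply: (cont_bsupp_compact _ cK) => [q|q nK]; last by rewrite zP // mulr0.
exact: (smooth_cont sh).
Qed.

Lemma pair_by_parts F Psi i : smooth_on U F -> phase_test p0 Psi ->
  int3 (fun q => F q * dq i Psi q p0) = - int3 (fun q => dirD (e i) F q * Psi q p0).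
Proof.
move=> sF TP; have [sh ch] := pair_smooth sF TP.
have [_ c1] := pair_smooth sF (phase_test_dq i TP).
have [_ c2] := pair_smooth (smooth_dirD (e i) sF) TP.
have [eps [K [e0 cK KU [sP zP]]]] := TP.
have oU := off_ray_open p0_neq0.
have clK : closed K by apply: compact_closed => //; exact: norm_hausdorff.
have bp : ball p0 eps p0 by exact: ballxx.
apply: (@int3_by_parts R F (fun q => Psi q p0) (e i) sh ch c1 c2) => q.
have [Kq|nK] := pselect (K q); last first.
  (* Off [K] nothing is known about [F], but the test function vanishes near [q], so each term of
     Leibniz's formula is zero. *)
  have zero : {near q, (fun q => Psi q p0) =1 (fun=> 0)}.
    by apply: filterS (open_nbhs_nbhs (conj (closed_openC clK) nK)) => x nx; exact: zP.
  have zero' : {near q, (fun q => F q * Psi q p0) =1 (fun=> 0)}.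
    by apply: filterS zero => x /= ->; rewrite mulr0.
  have E1 : dirD (e i) (fun q => F q * Psi q p0) q = 0.
    by apply: etrans (near_eq_derive (e i) zero') _; exact: derive_cst.
  have E2 : dirD (e i) (fun q => Psi q p0) q = 0.
    by apply: etrans (near_eq_derive (e i) zero) _; exact: derive_cst.
  by rewrite E1 E2 zP // !mulr0 addr0.
have dF := smooth_derivable sF (KU q Kq) : derivable F q (e i).
have AL (h : R) (a z : V3) : (h *: a + z, p0) = h *: ((a, 0) : VV) + (z, p0).
  by congr (_, _); rewrite /= scaler0 add0r.
have dP : derivable (fun q => Psi q p0) q (e i).
  apply: (@derivable_comp R V3 VV (fun q => (q, p0)) (fun a => (a, 0)) AL (unc Psi)).
  exact: (smooth_derivable sP (bp : pball p0 eps (q, p0))).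
apply: etrans (deriveM dF dP) _.
by rewrite /GRing.scale /= [X in _ + X]mulrC.
Qed.

Lemma phase_test_bsupp F Psi : smooth_on U F -> phase_test p0 Psi -> cont_bsupp (fun q => F q * Psi q p0).
Proof. by move=> sF TP; have [] := pair_smooth sF TP. Qed.

Lemma smooth_translate F (s : R) : 0 <= s -> smooth_on U F ->
  smooth_on U (fun q => F (q - s *: p0)) /\
  forall a q, dirD a (fun q => F (q - s *: p0)) q = dirD a F (q - s *: p0).
Proof.
move=> s0 sF; have AL (h : R) (b z : V3) : h *: b + z - s *: p0 = h *: id b + (z - s *: p0).
  by rewrite addrA.
split=> [|a q]; last exact: (@dirD_comp R V3 V3 (fun z => z - s *: p0) id AL F a q).
have := @smooth_comp R V3 V3 (fun z => z - s *: p0) id U AL (fun _ _ _ => erefl)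
  (@translate_cont R V3 _) F (off_ray_open p0_neq0) sF.
by apply: smooth_onS => q Uq; exact: off_ray_sub.
Qed.

End Pairing.

(** * Functionals supported at the initial momentum *)

Lemma mulrDrCA {R : comPzRingType} (w s a b : R) : w * (s * a + b) = s * (w * a) + w * b.
Proof. by rewrite mulrDr mulrCA. Qed.

Section Functionals.
Context {R : realType}.
Notation V3 := 'rV[R]_3.
Notation e := (delta_mx ord0 : 'I_3 -> V3).
Notation VV := (V3 * V3)%type.
Variables (kappa : R) (p0 : V3).
Hypothesis p0_neq0 : p0 != 0.
Notation U := (off_forward_ray p0).
Notation V := (coulomb kappa).
Implicit Types (Psi G : phase_fun R) (W : seq 'I_3 -> V3 -> R) (b : VV) (s : R).

Definition Dz b Psi : phase_fun R := fun q p => dirD b (unc Psi) (q, p).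
Definition DzJ (bs : seq VV) Psi := foldr Dz Psi bs.
Definition pdir (i : 'I_3) : VV := (0, e i).
(** What [pdir i] becomes under the shear [(q, p) -> (q + s p, p)]. *)
Definition xdir s (i : 'I_3) : VV := (s *: e i, e i).

Lemma unc_Dz b Psi : unc (Dz b Psi) = dirD b (unc Psi).
Proof. by apply/funext => -[]. Qed.

Lemma dp_Dz i Psi : dp i Psi = Dz (pdir i) Psi.
Proof. by apply/funext => q; apply/funext => p; exact: dpE. Qed.

Lemma dq_Dz i Psi : dq i Psi = Dz (e i, 0) Psi.
Proof. by apply/funext => q; apply/funext => p; exact: dqE. Qed.

Lemma phase_test_at_Dz eps K b Psi : compact K -> phase_test_at p0 eps K Psi -> phase_test_at p0 eps K (Dz b Psi).
Proof. exact: phase_test_at_dirD. Qed.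

Lemma phase_test_at_DzJ eps K bs Psi : compact K -> phase_test_at p0 eps K Psi -> phase_test_at p0 eps K (DzJ bs Psi).
Proof. by move=> cK TP; elim: bs => //= b bs; exact: phase_test_at_Dz. Qed.

Lemma phase_test_Dz b Psi : phase_test p0 Psi -> phase_test p0 (Dz b Psi).
Proof. by move=> [eps [K [e0 cK KU TP]]]; exists eps, K; split=> //; exact: phase_test_at_Dz. Qed.

Lemma phase_test_DzJ bs Psi : phase_test p0 Psi -> phase_test p0 (DzJ bs Psi).
Proof. by move=> TP; elim: bs => //= b bs; exact: phase_test_Dz. Qed.

(** Equality for [p] in a ball and all [q] survives differentiation in every phase-space direction,
    because the ball is open. *)
Definition eqb eps Psi G := forall q p, ball p0 eps p -> Psi q p = G q p.

Lemma eqb_Dz eps b Psi G : eqb eps Psi G -> eqb eps (Dz b Psi) (Dz b G).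
Proof.
move=> PG q p bp; apply: near_eq_derive.
have N := open_nbhs_nbhs (conj (@open_pball R p0 eps) (bp : pball p0 eps (q, p))).
by apply: filterS N => -[x y] /= by_; exact: PG.
Qed.

Lemma eqb_DzJ eps bs Psi G : eqb eps Psi G -> eqb eps (DzJ bs Psi) (DzJ bs G).
Proof. by move=> PG; elim: bs => //= b bs; exact: eqb_Dz. Qed.

Lemma Dz_comm eps K b c Psi : phase_test_at p0 eps K Psi -> eqb eps (Dz b (Dz c Psi)) (Dz c (Dz b Psi)).
Proof.
move=> [sP _] q p bp; rewrite /Dz !unc_Dz.
exact: (Schwarz b c (@open_pball R p0 eps) sP (bp : pball p0 eps (q, p))).
Qed.

Lemma Dz_DzJ_comm eps K b bs Psi : compact K -> phase_test_at p0 eps K Psi ->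
  eqb eps (Dz b (DzJ bs Psi)) (DzJ bs (Dz b Psi)).
Proof.
move=> cK TP; elim: bs => //= c bs IH q p bp.
rewrite (Dz_comm b c (phase_test_at_DzJ bs cK TP)) //.
exact: eqb_Dz IH q p bp.
Qed.

Lemma Dz_xdir eps K s i Psi q p : phase_test_at p0 eps K Psi -> ball p0 eps p ->
  Dz (xdir s i) Psi q p = s * dq i Psi q p + Dz (pdir i) Psi q p.
Proof.
move=> [sP _] bp; rewrite dq_Dz.
have -> : xdir s i = s *: ((e i, 0) : VV) + pdir i.
  by congr (_, _); rewrite /= ?addr0 ?scaler0 ?add0r.
exact: (smooth_lin s (e i, 0) (pdir i) sP (bp : pball p0 eps (q, p))).
Qed.

Definition shift_phase s Psi : phase_fun R := fun q p => Psi (q + s *: p) p.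

Lemma Dz_shift s i Psi : Dz (pdir i) (shift_phase s Psi) = shift_phase s (Dz (xdir s i) Psi).
Proof.
apply/funext => q; apply/funext => p.
pose A (z : VV) : VV := (z.1 + s *: z.2, z.2).
have AL (h : R) (a z : VV) : A (h *: a + z) = h *: A a + A z.
  by rewrite /A /= scalerDr; congr (_, _); rewrite /= scalerDr !scalerA (mulrC s) addrACA.
have E : unc (shift_phase s Psi) = unc Psi \o A by apply/funext => -[].
have Ax : A (pdir i) = xdir s i by rewrite /A /pdir /xdir /= add0r.
rewrite {1}/Dz E (dirD_comp AL) Ax.
reflexivity.
Qed.

Lemma DzJ_shift s J Psi : DzJ (map pdir J) (shift_phase s Psi) =
  shift_phase s (DzJ (map (xdir s) J) Psi).
Proof. by elim: J => //= i J ->; exact: Dz_shift. Qed.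

Lemma cont_bsupp_wsum m (F : seq 'I_3 -> V3 -> R) : (forall I, size I = m -> cont_bsupp (F I)) ->
  cont_bsupp (fun q => wsum m (fun I => F I q)) /\
  int3 (fun q => wsum m (fun I => F I q)) = wsum m (fun I => int3 (F I)).
Proof.
elim: m F => [|m IH] F cF /=; first by split=> //; exact: cF.
have IHi i := IH (fun I => F (i :: I)) (fun I Im => cF (i :: I) (congr1 S Im)).
split; first by apply: cont_bsupp_sum => i; exact: (IHi i).1.
rewrite int3_sum => [|i]; last exact: (IHi i).1.
by apply: eq_bigr => i _; exact: (IHi i).2.
Qed.

Definition smoothT r W := forall J, size J = r -> smooth_on U (W J).

Definition pairing r W Psi : R :=
  wsum r (fun J => int3 (fun q => W J q * DzJ (map pdir J) Psi q p0)).

(* A momentum derivative of a shifted test function is a derivative along [xdir s];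
   here all but the first [m] of them have been turned back into momentum
   derivatives by integration by parts. *)
Definition mixed m r W s Psi : R :=
  wsum r (fun Z => int3 (fun q => W Z (q - s *: p0) *
    DzJ (map (xdir s) (take m Z)) (DzJ (map pdir (drop m Z)) Psi) q p0)).

(** On [p = p0] the shear is the translation by [s p0], which translation invariance of the integral
    transfers to [W]. *)
Lemma pairing_shift r W s Psi : smoothT r W -> 0 <= s -> phase_test p0 Psi ->
  pairing r W (shift_phase s Psi) = mixed r r W s Psi.
Proof.
move=> sW s0 TP; apply: eq_wsum => J Jr.
have -> : take r J = J by rewrite -Jr take_size.
have -> : drop r J = [::] by rewrite -Jr drop_size.
rewrite /= DzJ_shift.
have [sF _] := smooth_translate p0_neq0 s0 (sW J Jr).
have ch := phase_test_bsupp p0_neq0 sF (phase_test_DzJ (map (xdir s) J) TP).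
rewrite -(int3_translate (s *: p0) ch); apply: eq_int3 => q.
by rewrite addrK.
Qed.

(** The outermost [xdir] derivative splits into [s d_q + d_p]. The first part is integrated by parts
    and gives [- s] times a divergence; the second commutes with all other derivatives and joins the
    momentum derivatives at the end, whence [cycT]. *)
Lemma mixed_step m r W s Psi : smoothT r.+1 W -> (m <= r)%N -> 0 <= s -> phase_test p0 Psi ->
  mixed m.+1 r.+1 W s Psi = mixed m r.+1 (cycT W) s Psi - s * mixed m r (divT W) s Psi.
Proof.
move=> sW mr s0 TP; have [eps [K [e0 cK KU TPat]]] := TP.
have bp : ball p0 eps p0 by exact: ballxx.
pose G Z := DzJ (map (xdir s) (take m Z)) (DzJ (map pdir (drop m Z)) Psi).
have TG Z : phase_test p0 (G Z) by do 2 apply: phase_test_DzJ.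
have TGat Z : phase_test_at p0 eps K (G Z) by do 2 apply: phase_test_at_DzJ => //.
have sF j Z : size Z = r -> smooth_on U (fun q => W (j :: Z) (q - s *: p0)).
  by move=> Zr; apply: (smooth_translate p0_neq0 s0 (sW _ _)).1; rewrite /= Zr.
have sD j Z : size Z = r -> smooth_on U (fun q => dirD (e j) (W (j :: Z)) (q - s *: p0)).
  move=> Zr; apply: (smooth_translate p0_neq0 s0 _).1.
  by apply: smooth_dirD; apply: sW; rewrite /= Zr.
pose T1 Z := int3 (fun q => cycT W Z (q - s *: p0) * G Z q p0).
pose T2 j Z := int3 (fun q => dirD (e j) (W (j :: Z)) (q - s *: p0) * G Z q p0).
have H j Z : size Z = r ->
   int3 (fun q => W (j :: Z) (q - s *: p0) * Dz (xdir s j) (G Z) q p0) =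
   T1 (rcons Z j) + (- s) * T2 j Z.
  move=> Zr.
  have c1 := phase_test_bsupp p0_neq0 (sF j Z Zr) (phase_test_dq j (TG Z)).
  have c2 := phase_test_bsupp p0_neq0 (sF j Z Zr) (phase_test_Dz (pdir j) (TG Z)).
  have E1 : int3 (fun q => W (j :: Z) (q - s *: p0) * Dz (pdir j) (G Z) q p0) = T1 (rcons Z j).
    apply: eq_int3 => q; rewrite cycT_rcons; apply: (congr1 (fun z => _ * z)).
    have mZ : (m <= size Z)%N by rewrite Zr.
    have -> : G (rcons Z j) = DzJ (map (xdir s) (take m Z)) (DzJ (map pdir (drop m Z)) (Dz (pdir j) Psi)).
      by rewrite /G drop_rcons // -cats1 takel_cat // map_rcons /DzJ foldr_rcons.
    have h1 := Dz_DzJ_comm (pdir j) (map (xdir s) (take m Z)) cK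
      (phase_test_at_DzJ (map pdir (drop m Z)) cK TPat).
    have h2 := eqb_DzJ (map (xdir s) (take m Z))
      (Dz_DzJ_comm (pdir j) (map pdir (drop m Z)) cK TPat).
    exact: etrans (h1 q p0 bp) (h2 q p0 bp).
  have E2 : int3 (fun q => W (j :: Z) (q - s *: p0) * dq j (G Z) q p0) = - T2 j Z.
    apply: etrans (pair_by_parts p0_neq0 j (sF j Z Zr) (TG Z)) _.
    apply: (congr1 (fun z => - z)); apply: eq_int3 => q.
    apply: (congr1 (fun z => z * _)).
    by apply: (smooth_translate p0_neq0 s0 (sW _ _)).2; rewrite /= Zr.
  have E3 : int3 (fun q => W (j :: Z) (q - s *: p0) * Dz (xdir s j) (G Z) q p0) =
      s * int3 (fun q => W (j :: Z) (q - s *: p0) * dq j (G Z) q p0) +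
      int3 (fun q => W (j :: Z) (q - s *: p0) * Dz (pdir j) (G Z) q p0).
    rewrite -(int3Z s c1) -(int3D (cont_bsupp_scale s c1) c2); apply: eq_int3 => q.
    rewrite (Dz_xdir s j q (TGat Z) bp); exact: mulrDrCA.
  by rewrite E3 E2 E1 mulrN mulNr addrC.
rewrite /mixed [LHS]/=.
under eq_bigr do rewrite (eq_wsum (H _)) wsumD wsumZ.
rewrite big_split /= -wsum_rcons -mulr_sumr mulNr; congr (_ - s * _).
rewrite -wsum_sum; apply: eq_wsum => Z Zr.
have cj j := phase_test_bsupp p0_neq0 (sD j Z Zr) (TG Z).
apply: etrans (esym (int3_sum _ cj)) _.
by apply: eq_int3 => q; rewrite /divT mulr_suml.
Qed.

Lemma Domega0 m G q p : Domega m (fun _ _ => 0) G q p = 0.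
Proof.
elim: m G q p => [|m IH] G q p /=; first by rewrite mul0r.
rewrite big1 // => i _.
have -> : dq i (fun _ _ => 0) = (fun _ _ => 0) :> phase_fun R.
  by apply/funext => x; apply/funext => y; exact: derive_cst.
have -> : dp i (fun _ _ => 0) = (fun _ _ => 0) :> phase_fun R.
  by apply/funext => x; apply/funext => y; exact: derive_cst.
by rewrite !IH subrr.
Qed.

(** [F] does not depend on [p], so the subtracted half of the bracket vanishes at every level. *)
Lemma DomegaE m (F : V3 -> R) Psi q p : Domega m (fun q _ => F q) Psi q p =
  wsum m (fun I => foldr dirD F (map e I) q * DzJ (map pdir I) Psi q p).
Proof.
elim: m F Psi q p => [|m IH] F Psi q p //.
rewrite wsum_rcons [LHS]/=; apply: eq_bigr => i _.
have -> : dp i (fun q _ => F q) = (fun _ _ => 0) :> phase_fun R.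
  by apply/funext => x; apply/funext => y; exact: derive_cst.
rewrite Domega0 subr0 dp_Dz -[dq i _]/(fun q _ => dirD (e i) F q) IH.
by apply: eq_wsum => I _; rewrite !map_rcons /DzJ !foldr_rcons.
Qed.

Lemma DzJ_wsum eps K m J (F : seq 'I_3 -> V3 -> R) (G : seq 'I_3 -> phase_fun R) :
  compact K -> (forall I, phase_test_at p0 eps K (G I)) ->
  eqb eps (DzJ (map pdir J) (fun q p => wsum m (fun I => F I q * G I q p)))
    (fun q p => wsum m (fun I => F I q * DzJ (map pdir J) (G I) q p)).
Proof.
move=> cK TG; elim: J => //= i J IH q p bp.
rewrite (eqb_Dz _ IH) // -dp_Dz /dp /pderiv.
have dG I : derivable (fun y => DzJ (map pdir J) (G I) q y) p (e i).
  have [sG _] := phase_test_at_DzJ (map pdir J) cK (TG I).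
  apply: (@derivable_comp R V3 VV (fun x => (q, x)) (fun x => (0, x)) _
    (unc (DzJ (map pdir J) (G I)))).
    by move=> h a x; congr (_, _); rewrite /= scaler0 add0r.
  exact: (smooth_derivable sG (bp : pball p0 eps (q, p))).
have DG I : 'D_(e i) (fun y => DzJ (map pdir J) (G I) q y) p = Dz (pdir i) (DzJ (map pdir J) (G I)) q p.
  by rewrite -dp_Dz.
suff [_ ->] : derivable (fun y => wsum m (fun I => F I q * DzJ (map pdir J) (G I) q y)) p (e i) /\
   'D_(e i) (fun y => wsum m (fun I => F I q * DzJ (map pdir J) (G I) q y)) p =
   wsum m (fun I => F I q * Dz (pdir i) (DzJ (map pdir J) (G I)) q p) by [].
clear IH TG; elim: m F G dG DG => [|m IHm] F G dG DG /=.
  split; first exact: derivableM (derivable_cst _ _ _) (dG _).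
  apply: etrans (deriveMl _ (dG _)) _.
  exact: (congr1 (fun z => _ * z) (DG _)).
have IHl l := IHm (fun I => F (l :: I)) (fun I => G (l :: I)) (fun I => dG _) (fun I => DG _).
suff H (r : seq 'I_3) :
   derivable (fun y => \sum_(l <- r) wsum m (fun I => F (l :: I) q * DzJ (map pdir J) (G (l :: I)) q y)) p (e i) /\
   'D_(e i) (fun y => \sum_(l <- r) wsum m (fun I => F (l :: I) q * DzJ (map pdir J) (G (l :: I)) q y)) p =
   \sum_(l <- r) wsum m (fun I => F (l :: I) q * Dz (pdir i) (DzJ (map pdir J) (G (l :: I))) q p).
  exact: H.
elim: r => [|l r [d1 d2]].
  under [fun y => _]eq_fun do rewrite big_nil.
  by rewrite big_nil; split; [exact: derivable_cst|exact: derive_cst].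
under [fun y => _]eq_fun do rewrite big_cons.
have [d3 d4] := IHl l.
split; first exact: derivableD d3 d1.
by apply: etrans (deriveD d3 d1) _; rewrite big_cons d4 d2.
Qed.

(** Momentum derivatives do not act on the derivatives of V, so the [r] old and [m] new ones combine
    into one word. *)
Lemma pairing_mulV r m (c : R) W Psi : smoothT r W -> phase_test p0 Psi ->
  pairing r W (fun q p => c * Domega m (fun q _ => V q) Psi q p) =
  pairing (r + m) (fun J x => c * mulV_T kappa r W J x) Psi.
Proof.
move=> sW TP; have [eps [K [e0 cK KU TPat]]] := TP.
have bp : ball p0 eps p0 by exact: ballxx.
rewrite /pairing wsum_cat; apply: eq_wsum => J Jr.
have E : (fun q p => c * Domega m (fun q _ => V q) Psi q p) =
   (fun q p => wsum m (fun I => (c * foldr dirD V (map e I) q) * DzJ (map pdir I) Psi q p)).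
  apply/funext => q; apply/funext => p; rewrite DomegaE -wsumZ.
  by apply: eq_wsum => I _; rewrite mulrA.
rewrite E.
transitivity (int3 (fun q => wsum m (fun I => c * mulV_T kappa r W (J ++ I) q *
    DzJ (map pdir (J ++ I)) Psi q p0))).
  apply: eq_int3 => q.
  rewrite (DzJ_wsum m J (fun I q => c * foldr dirD V (map e I) q) cK
    (fun I => phase_test_at_DzJ (map pdir I) cK TPat) q bp) -wsumZ.
  apply: eq_wsum => I _; rewrite /mulV_T -Jr take_size_cat // drop_size_cat //.
  rewrite map_cat /DzJ foldr_cat; ring.
have oU := off_ray_open p0_neq0.
have sm I : smooth_on U (fun q => c * mulV_T kappa r W (J ++ I) q).
  apply: smooth_scale => //; apply: smooth_mul => //.
    by apply: sW; rewrite -Jr take_size_cat.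
  apply: smooth_onS (smooth_iterD _ (smooth_coulomb kappa)) => x.
  exact: off_ray_neq0.
have cF I (Im : size I = m) := phase_test_bsupp p0_neq0 (sm I) (phase_test_DzJ (map pdir (J ++ I)) TP).
exact: (cont_bsupp_wsum cF).2.
Qed.

End Functionals.

(** * Exchange of time and space integration *)

Section Admissible.
Context {R : realType}.
Notation V3 := 'rV[R]_3.
Implicit Types (h : R -> V3 -> R).

(** The form in which time integrands are carried along: a majorant in time uniform in [q] and a
    bounded support in space uniform in [u], so that the two integrations commute. *)
Definition dominated h := [/\ forall u, continuous (h u), forall q, continuous (h ^~ q) &
  exists C M, (forall u q, `|h u q| <= C * decay u) /\ (forall u q, M < `|q| -> h u q = 0)].

Definition time_int3 h : R := tint (fun u => int3 (h u)).

Lemma dominated_bsupp h u : dominated h -> cont_bsupp (h u).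
Proof. by move=> [c1 _ [C [M [_ hM]]]]; split=> //; exists M => q; exact: hM. Qed.

Lemma time_int3_fubini h : dominated h -> time_int3 h = int3 (fun q => tint (h ^~ q)).
Proof.
move=> [c1 c2 [C [M [hC hM]]]].
exact: (time_fubini c1 c2 (fun u q _ => hC u q) hM).
Qed.

Lemma dominated_tint_bsupp h : dominated h -> cont_bsupp (fun q => tint (h ^~ q)).
Proof.
move=> [c1 c2 [C [M [hC hM]]]]; split; last first.
  exists M => q qM; rewrite -[RHS](@tint0 R); apply: eq_tint => u _; exact: hM.
move=> q; apply: (@tint_cont R V3 (fun q u => h u q) q C 1 ltr01).
- by move=> y _; exact: c2.
- by move=> u _; exact: c1.
- by move=> y u _ _; exact: hC.
Qed.

Lemma dominated_add h h' : dominated h -> dominated h' -> dominated (fun u q => h u q + h' u q).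
Proof.
move=> [c1 c2 [C [M [hC hM]]]] [c1' c2' [C' [M' [hC' hM']]]]; split.
- by move=> u; exact: cont_add.
- by move=> q; exact: (@cont_add R R).
exists (C + C'), (Num.max M M'); split=> u q; last first.
  by rewrite gt_max => /andP[q1 q2]; rewrite hM // hM' // addr0.
by rewrite mulrDl (le_trans (ler_normD _ _)) // lerD.
Qed.

Lemma dominated_scale (c : R) h : dominated h -> dominated (fun u q => c * h u q).
Proof.
move=> [c1 c2 [C [M [hC hM]]]]; split.
- by move=> u; apply: cont_mul => //; exact: cont_cst.
- by move=> q; apply: (@cont_mul R R) => //; exact: cont_cst.
exists (`|c| * C), M; split=> u q; last by move=> qM; rewrite hM // mulr0.
by rewrite normrM -mulrA ler_wpM2l.
Qed.

Lemma adm0 : dominated (fun _ _ => 0).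
Proof.
split; [by move=> u; exact: cont_cst|by move=> q; exact: cont_cst|].
by exists 0, 0; split=> // u q; rewrite normr0 mul0r.
Qed.

Lemma time_int3_add h h' : dominated h -> dominated h' -> time_int3 (fun u q => h u q + h' u q) = time_int3 h + time_int3 h'.
Proof.
move=> ah ah'; rewrite !time_int3_fubini //; last exact: dominated_add.
rewrite -int3D; [|exact: dominated_tint_bsupp..].
apply: eq_int3 => q.
have [_ c2 [C [_ [hC _]]]] := ah; have [_ c2' [C' [_ [hC' _]]]] := ah'.
exact: (tintD (c2 q) (c2' q) (fun u _ => hC u q) (fun u _ => hC' u q)).
Qed.

Lemma time_int3_scale (c : R) h : dominated h -> time_int3 (fun u q => c * h u q) = c * time_int3 h.
Proof.
move=> ah; rewrite !time_int3_fubini //; last exact: dominated_scale.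
rewrite -int3Z; last exact: dominated_tint_bsupp.
apply: eq_int3 => q; have [_ c2 [C [_ [hC _]]]] := ah.
exact: (tintZ c (c2 q) (fun u _ => hC u q)).
Qed.

Lemma tI0 : time_int3 (fun _ _ => 0) = 0.
Proof.
rewrite /time_int3; under [fun u => _]eq_fun do rewrite int3_0.
exact: tint0.
Qed.

Lemma dominated_wsum m (h : seq 'I_3 -> R -> V3 -> R) : (forall I, size I = m -> dominated (h I)) ->
  dominated (fun u q => wsum m (fun I => h I u q)) /\
  time_int3 (fun u q => wsum m (fun I => h I u q)) = wsum m (fun I => time_int3 (h I)).
Proof.
elim: m h => [|m IH] h ah /=; first by split=> //; exact: ah.
have IHi i := IH (fun I => h (i :: I)) (fun I Im => ah (i :: I) (congr1 S Im)).
suff H (r : seq 'I_3) : dominated (fun u q => \sum_(i <- r) wsum m (fun I => h (i :: I) u q)) /\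
  time_int3 (fun u q => \sum_(i <- r) wsum m (fun I => h (i :: I) u q)) =
  \sum_(i <- r) wsum m (fun I => time_int3 (h (i :: I))) by exact: H.
elim: r => [|i r [a1 a2]].
  have -> : (fun (u : R) (q : V3) => \sum_(i <- [::]) wsum m (fun I => h (i :: I) u q)) =
    (fun _ _ => 0) by apply/funext => u; apply/funext => q; rewrite big_nil.
  by rewrite big_nil; split; [exact: adm0|exact: tI0].
have -> : (fun (u : R) (q : V3) => \sum_(i <- i :: r) wsum m (fun I => h (i :: I) u q)) =
    (fun u q => wsum m (fun I => h (i :: I) u q) + \sum_(i <- r) wsum m (fun I => h (i :: I) u q)).
  by apply/funext => u; apply/funext => q; rewrite big_cons.
have [b1 b2] := IHi i.
split; first exact: dominated_add.
by rewrite (time_int3_add b1 a1) b2 a2 big_cons.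
Qed.

End Admissible.

(** * Induction on the perturbation order *)

Section MainInduction.
Context {R : realType}.
Notation V3 := 'rV[R]_3.
Notation e := (delta_mx ord0 : 'I_3 -> V3).
Variables (mu nu kappa : R) (p0 : V3).
Hypothesis mu_gt0 : 0 < mu.
Hypothesis p0_neq0 : p0 != 0.
Notation U := (off_forward_ray p0).
Notation V := (coulomb kappa).
Implicit Types (Psi : phase_fun R) (W : seq 'I_3 -> V3 -> R) (L : phase_fun R -> R).

(** On [K] the integrand obeys [path_fun_bound]; off [K] the test function makes it zero, whatever
    [F] does there. *)
Lemma path_pair_adm l d F Psi : nice p0 d F -> (l.+2 <= d)%N -> phase_test p0 Psi ->
  dominated (fun u q => path_fun mu p0 l F q u * Psi q p0) /\
  forall q, tint (fun u => path_fun mu p0 l F q u * Psi q p0) =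
    path_int mu p0 l F q * Psi q p0.
Proof.
move=> nF ld TP; have [eps [K [e0 cK KU [sP zP]]]] := TP.
have bp : ball p0 eps p0 by exact: ballxx.
have [C C0 HC] := path_fun_bound mu_gt0 p0_neq0 nF ld cK KU.
have sone : smooth_on U (fun=> 1 : R) by apply: smooth_cst; exact: off_ray_open.
have c1 := phase_test_bsupp p0_neq0 sone TP.
have [B B0 HB] := cont_bsupp_bound c1; have [_ [M HM]] := c1.
have zK q : ~ K q -> Psi q p0 = 0 by exact: zP.
split; last first.
  move=> q; have [Kq|nK] := pselect (K q); last first.
    rewrite zK // mulr0 -[RHS](@tint0 R).
    by apply: eq_tint => u _; rewrite mulr0.
  rewrite mulrC -(tintZ _ (path_fun_cont mu_gt0 nF (KU q Kq)) (fun u _ => HC q u Kq)).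
  by apply: eq_tint => u _; rewrite mulrC.
split.
- move=> u.
  have s0 := speed_ge0 mu_gt0 u.
  have [cF _] := phase_test_bsupp p0_neq0 (smooth_translate p0_neq0 s0 nF.1).1 TP.
  have -> : (fun q => path_fun mu p0 l F q u * Psi q p0) =
     (fun q => (`|u| / mu) ^+ l * (F (q - (`|u| / mu) *: p0) * Psi q p0)).
    by apply/funext => q; rewrite /path_fun mulrA.
  by apply: cont_mul => //; exact: cont_cst.
- move=> q; have [Kq|nK] := pselect (K q); last first.
    have -> : (fun u => path_fun mu p0 l F q u * Psi q p0) = fun=> 0.
      by apply/funext => u; rewrite zK // mulr0.
    exact: cont_cst.
  apply: (@cont_mul R R); last exact: cont_cst.
  exact: (path_fun_cont mu_gt0 nF (KU q Kq)).
exists (C * B), M; split=> u q; last first.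
  by move=> qM; have := HM q qM; rewrite mul1r => ->; rewrite mulr0.
have [Kq|nK] := pselect (K q); last first.
  by rewrite zK // mulr0 normr0 !mulr_ge0 // decay_ge0.
rewrite normrM mulrAC; apply: ler_pM => //; first exact: HC.
by have := HB q; rewrite mul1r.
Qed.

(** The rank is left free and only the decay is recorded, since a free shift mixes ranks. The last
    constructor makes membership depend only on the values at [phase_test] functions, where the
    integral identities hold. *)
Inductive tensor_dist (d : nat) : (phase_fun R -> R) -> Prop :=
| tensor_dist_Lam r W of niceT p0 r d W : tensor_dist d (pairing p0 r W)
| tensor_dist_0 : tensor_dist d (fun=> 0)
| tensor_dist_add L L' of tensor_dist d L & tensor_dist d L' : tensor_dist d (fun Psi => L Psi + L' Psi)
| tensor_dist_scale c L of tensor_dist d L : tensor_dist d (fun Psi => c * L Psi)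
| tensor_dist_eq L L' of (forall Psi, phase_test p0 Psi -> L Psi = L' Psi) & tensor_dist d L : tensor_dist d L'.

Lemma tensor_dist_sum d (I : Type) (r : seq I) (L : I -> phase_fun R -> R) :
  (forall i, tensor_dist d (L i)) -> tensor_dist d (fun Psi => \sum_(i <- r) L i Psi).
Proof.
move=> FL; elim: r => [|i r IH].
  by under [fun Psi => _]eq_fun do rewrite big_nil; exact: tensor_dist_0.
by under [fun Psi => _]eq_fun do rewrite big_cons; exact: tensor_dist_add.
Qed.

Lemma niceT_smooth r d W : niceT p0 r d W -> smoothT p0 r W.
Proof. by move=> [nW _] J Jr; exact: (nW J Jr).1. Qed.

(** With no [xdir] derivative left, the time dependence sits in [W] alone, and Fubini's theorem
    moves the time integral onto it. *)
Lemma mixed0_time r d l W Psi : niceT p0 r d W -> (l.+2 <= d)%N -> phase_test p0 Psi ->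
  exists h, [/\ dominated h,
    forall u : R, 0 <= u -> (u / mu) ^+ l * mixed p0 0 r W (u / mu) Psi = int3 (h u) &
    time_int3 h = pairing p0 r (pathT mu p0 l W) Psi].
Proof.
move=> nW ld TP.
pose h Z (u : R) (q : V3) := path_fun mu p0 l (W Z) q u * DzJ (map (@pdir R) Z) Psi q p0.
have ah Z : size Z = r -> dominated (h Z).
  by move=> Zr; exact: (path_pair_adm (nW.1 Z Zr) ld (phase_test_DzJ _ TP)).1.
have [H1 H2] := dominated_wsum ah.
exists (fun u q => wsum r (fun Z => h Z u q)); split=> //.
  move=> u u0; rewrite (cont_bsupp_wsum (fun Z Zr => dominated_bsupp u (ah Z Zr))).2 -wsumZ.
  apply: eq_wsum => Z Zr; rewrite take0 drop0 /=.
  have s0 : 0 <= u / mu by rewrite divr_ge0 // ltW.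
  have ch := phase_test_bsupp p0_neq0 (smooth_translate p0_neq0 s0 (nW.1 Z Zr).1).1
    (phase_test_DzJ (map (@pdir R) Z) TP).
  rewrite -int3Z //; apply: eq_int3 => q.
  by rewrite /h /path_fun ger0_norm // mulrA.
rewrite H2; apply: eq_wsum => Z Zr; rewrite time_int3_fubini; last exact: ah.
apply: eq_int3 => q.
exact: (path_pair_adm (nW.1 Z Zr) ld (phase_test_DzJ _ TP)).2.
Qed.

(** Induction on the number of [xdir] derivatives. Each use of [mixed_step] leaves a term of the
    same weight and one where both the weight [l] and the decay [d + l] have gone up by one, so [d]
    is an invariant and every branch ends with decay [d - 1]. *)
Lemma mixed_time m r d l W : niceT p0 r (d + l) W -> (m <= r)%N -> (2 <= d)%N ->
  exists L, tensor_dist (d - 1) L /\ forall Psi, phase_test p0 Psi -> exists h, [/\ dominated h,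
    forall u : R, 0 <= u -> (u / mu) ^+ l * mixed p0 m r W (u / mu) Psi = int3 (h u) &
    time_int3 h = L Psi].
Proof.
elim: m r l W => [|m IH] r l W nW mr d2.
  have ld : (l.+2 <= d + l)%N by rewrite -addn2 addnC leq_add2r.
  exists (pairing p0 r (pathT mu p0 l W)); split; last by move=> Psi TP; exact: (mixed0_time nW ld TP).
  have -> : (d - 1 = d + l - l.+1)%N by lia.
  by apply: tensor_dist_Lam; exact: nice_path.
case: r nW mr => // r nW mr.
have n1 := nice_cyc nW.
have n2 := nice_div p0_neq0 nW; rewrite -addnS in n2.
have [L1 [F1 H1]] := IH _ _ _ n1 (leqW mr) d2.
have [L2 [F2 H2]] := IH _ _ _ n2 mr d2.
exists (fun Psi => L1 Psi + -1 * L2 Psi); split.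
  by apply: tensor_dist_add => //; exact: tensor_dist_scale.
move=> Psi TP; have [h1 [a1 e1 t1]] := H1 Psi TP; have [h2 [a2 e2 t2]] := H2 Psi TP.
exists (fun u q => h1 u q + -1 * h2 u q); split.
- by apply: dominated_add => //; exact: dominated_scale.
- move=> u u0; have s0 : 0 <= u / mu by rewrite divr_ge0 // ltW.
  rewrite (mixed_step p0_neq0 (niceT_smooth nW) mr s0 TP).
  rewrite int3D ?int3Z; [|exact: dominated_bsupp|exact: dominated_bsupp|by apply: cont_bsupp_scale; exact: dominated_bsupp].
  rewrite -(e1 u u0) -(e2 u u0) exprSr; ring.
- rewrite (time_int3_add a1 (dominated_scale _ a2)) (time_int3_scale _ a2) t1 t2 //.
Qed.

(** The integrand [h] is returned along with the value: splitting the time integral of a sum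
    requires integrability of its parts, which [dominated] provides. *)
Lemma tensor_dist_time d L : tensor_dist d L -> (2 <= d)%N ->
  exists L', tensor_dist (d - 1) L' /\ forall Psi, phase_test p0 Psi -> exists h, [/\ dominated h,
    forall u : R, 0 <= u -> L (shift_phase (u / mu) Psi) = int3 (h u) & time_int3 h = L' Psi].
Proof.
move=> FL d2; elim: FL => {L} [r W nW||L1 L2 _ [M1 [F1 H1]] _ [M2 [F2 H2]]|c L _ [M [F H]]|L1 L2 E _ [M [F H]]].
- have nW0 : niceT p0 r (d + 0) W by rewrite addn0.
  have [L [F H]] := mixed_time nW0 (leqnn r) d2.
  exists L; split=> // Psi TP; have [h [ah eh th]] := H Psi TP.
  exists h; split=> // u u0; have s0 : 0 <= u / mu by rewrite divr_ge0 // ltW.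
  by rewrite (pairing_shift p0_neq0 (niceT_smooth nW) s0 TP) -eh // expr0 mul1r.
- exists (fun=> 0); split; first exact: tensor_dist_0.
  move=> Psi _; exists (fun _ _ => 0); split; [exact: adm0|by move=> u _; rewrite int3_0|exact: tI0].
- exists (fun Psi => M1 Psi + M2 Psi); split; first exact: tensor_dist_add.
  move=> Psi TP; have [h1 [a1 e1 t1]] := H1 Psi TP; have [h2 [a2 e2 t2]] := H2 Psi TP.
  exists (fun u q => h1 u q + h2 u q); split; first exact: dominated_add.
    by move=> u u0; rewrite int3D ?e1 ?e2 //; exact: dominated_bsupp.
  by rewrite time_int3_add // t1 t2.
- exists (fun Psi => c * M Psi); split; first exact: tensor_dist_scale.
  move=> Psi TP; have [h [ah eh th]] := H Psi TP.
  exists (fun u q => c * h u q); split; first exact: dominated_scale.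
    by move=> u u0; rewrite int3Z ?eh //; exact: dominated_bsupp.
  by rewrite time_int3_scale // th.
- exists M; split=> // Psi TP; have [h [ah eh th]] := H Psi TP.
  exists h; split=> // u u0; rewrite -E ?eh //.
  by apply: phase_test_shift => //; rewrite divr_ge0 // ltW.
Qed.

Lemma phase_test_wsum m (G : seq 'I_3 -> phase_fun R) : (forall I, phase_test p0 (G I)) ->
  phase_test p0 (fun q p => wsum m (fun I => G I q p)).
Proof.
elim: m G => [|m IH] G TG /=; first exact: TG.
have IHi i := IH (fun I => G (i :: I)) (fun I => TG _).
suff H (r : seq 'I_3) : phase_test p0 (fun q p => \sum_(i <- r) wsum m (fun I => G (i :: I) q p)).
  exact: H.
elim: r => [|i r IHr].
  have -> : (fun q p : V3 => \sum_(i <- [::]) wsum m (fun I => G (i :: I) q p)) =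
    (fun _ _ => 0) by apply/funext => u; apply/funext => q; rewrite big_nil.
  exact: TT0.
have -> : (fun q p : V3 => \sum_(i <- i :: r) wsum m (fun I => G (i :: I) q p)) =
    (fun q p => wsum m (fun I => G (i :: I) q p) + \sum_(i <- r) wsum m (fun I => G (i :: I) q p)).
  by apply/funext => u; apply/funext => q; rewrite big_cons.
exact: phase_test_add.
Qed.

Lemma phase_test_Domega m (c : R) Psi : phase_test p0 Psi ->
  phase_test p0 (fun q p => c * Domega m (fun q _ => V q) Psi q p).
Proof.
move=> TP; apply: phase_test_scale.
have -> : Domega m (fun q _ => V q) Psi =
    (fun q p => wsum m (fun I => foldr dirD V (map e I) q * DzJ (map (@pdir R) I) Psi q p)).
  by apply/funext => q; apply/funext => p; exact: DomegaE.
apply: phase_test_wsum => I; apply: phase_test_mul; last exact: phase_test_DzJ.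
exact: smooth_iterD (smooth_coulomb kappa).
Qed.

(** The increment is [m + 1] because V itself decays like [1/|q|] and each derivative adds one. *)
Lemma tensor_dist_mulV d L m (c : R) : tensor_dist d L -> exists L', tensor_dist (d + m.+1) L' /\
  forall Psi, phase_test p0 Psi -> L (fun q p => c * Domega m (fun q _ => V q) Psi q p) = L' Psi.
Proof.
elim=> {L} [r W nW||L1 L2 _ [M1 [F1 H1]] _ [M2 [F2 H2]]|k L _ [M [F H]]|L1 L2 E _ [M [F H]]].
- exists (pairing p0 (r + m) (fun J x => c * mulV_T kappa r W J x)); split.
    by apply: tensor_dist_Lam; apply: niceT_scale => //; exact: nice_mulV.
  by move=> Psi TP; exact: (pairing_mulV kappa p0_neq0 m c (niceT_smooth nW) TP).
- by exists (fun=> 0); split=> //; exact: tensor_dist_0.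
- exists (fun Psi => M1 Psi + M2 Psi); split; first exact: tensor_dist_add.
  by move=> Psi TP; rewrite H1 // H2.
- exists (fun Psi => k * M Psi); split; first exact: tensor_dist_scale.
  by move=> Psi TP; rewrite H.
- exists M; split=> // Psi TP; rewrite -E ?H //; exact: phase_test_Domega.
Qed.

Lemma pairing_cst (c : R) (Psi : phase_fun R) : phase_test p0 Psi ->
  c * int3 (fun q => Psi q p0) = pairing p0 0 (fun _ _ => c) Psi.
Proof.
move=> TP; have s1 : smooth_on U (fun=> 1 : R) by apply: smooth_cst; exact: off_ray_open.
have cP := phase_test_bsupp p0_neq0 s1 TP.
rewrite /pairing /= -int3Z //.
by have -> : (fun q => Psi q p0) = (fun q => 1 * Psi q p0) by apply/funext => q; rewrite mul1r.
Qed.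

Lemma niceT_cst (c : R) : niceT p0 0 0 (fun _ _ => c).
Proof. by split=> [J _|A _ _ [|//] _ x _] //; exact: nice_cst. Qed.

Lemma DzJ_test (psi : V3 -> R) i J :
  DzJ (map (@pdir R) (i :: J)) (fun q _ => psi q) = (fun _ _ => 0).
Proof.
elim: J i => [|j J IH] i /=.
  rewrite -dp_Dz; apply/funext => q; apply/funext => p; exact: derive_cst.
rewrite [X in Dz _ X](IH j) -dp_Dz; apply/funext => q; apply/funext => p.
exact: derive_cst.
Qed.

(** Every momentum derivative kills a function of [q] alone; densities therefore come from rank
    zero. *)
Lemma pairing_test r (W : seq 'I_3 -> V3 -> R) (psi : V3 -> R) :
  pairing p0 r.+1 W (fun q _ => psi q) = 0.
Proof.
rewrite -[RHS](wsum0 r.+1); apply: eq_wsum => -[|i J] // _; rewrite DzJ_test.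
by under eq_int3 do rewrite mulr0; rewrite int3_0.
Qed.

(** Each order is a kick, [tensor_dist_mulV], followed by a free flight, [tensor_dist_time]. The
    functional [L] is chosen independent of [t], so the shifted time [t - u] of the recursion drops
    out. *)
Lemma rho_Fc (a : nat -> R) k n : exists L, tensor_dist (n.*2 + k) L /\
  forall t Psi, phase_test p0 Psi -> rho_coef mu nu p0 V (moyal_series a) n k t Psi = L Psi.
Proof.
elim: k n => [|k IH] n.
  rewrite addn0 /=; case: n => [|n] /=; last by exists (fun=> 0); split=> //; exact: tensor_dist_0.
  exists (pairing p0 0 (fun _ _ => nu)); split; first by apply: tensor_dist_Lam; exact: niceT_cst.
  by move=> t Psi TP; exact: pairing_cst.
have step (j : 'I_n.+1) : exists L, tensor_dist (n.*2 + k.+1) L /\ forall t Psi, phase_test p0 Psi ->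
   \int[@lebesgue_measure R]_(u in `[0, +oo[)
     rho_coef mu nu p0 V (moyal_series a) j k (t - u)
       (moyal_series a (n - j)%N (fun q _ => V q) (fun q p => Psi (q + (u / mu) *: p) p)) =
   L Psi.
  have [L [FL HL]] := IH j.
  have [L1 [F1 H1]] := tensor_dist_mulV (n - j)%N.*2.+1 (a (n - j)%N) FL.
  have dE : (j.*2 + k + (n - j).*2.+2 = (n.*2 + k.+1).+1)%N.
    have jn : (j <= n)%N by rewrite -ltnS.
    by lia.
  rewrite dE in F1.
  have d2 : (2 <= (n.*2 + k.+1).+1)%N by rewrite addnS.
  have [L2 [F2 H2]] := tensor_dist_time F1 d2; rewrite subn1 /= in F2.
  exists L2; split=> // t Psi TP.
  have [h [ah eh <-]] := H2 Psi TP.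
  apply: eq_tint => u u0; have s0 : 0 <= u / mu by rewrite divr_ge0 // ltW.
  have TS : phase_test p0 (shift_phase (u / mu) Psi) by exact: phase_test_shift.
  rewrite -eh // -H1 //; apply: HL; exact: phase_test_Domega.
have [L HL] := choice step.
(* The sign of the dual recursion, from transposing an odd number of momentum derivatives. *)
exists (fun Psi => -1 * \sum_(j < n.+1) L j Psi); split.
  by apply: tensor_dist_scale; apply: tensor_dist_sum => j; exact: (HL j).1.
move=> t Psi TP /=; rewrite mulN1r; congr (- _).
by apply: eq_bigr => j _; exact: (HL j).2.
Qed.

Definition axisymmetric (D : V3 -> R) := forall A, orthogonal_mx A -> p0 *m A = p0 ->
  forall x, U x -> D (x *m A) = D x.

Lemma tensor_dist_marginal d L : tensor_dist d L -> exists D, [/\ nice p0 d D, axisymmetric D &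
  forall psi, test_function U psi -> L (fun q _ => psi q) = int3 (fun q => D q * psi q)].
Proof.
have cD D psi : nice p0 d D -> test_function U psi -> cont_bsupp (fun q => D q * psi q).
  by move=> nD tp; exact: (phase_test_bsupp p0_neq0 nD.1 (phase_test_test tp)).
elim=> {L} [r W nW||L1 L2 _ [D1 [n1 a1 H1]] _ [D2 [n2 a2 H2]]|k L _ [D [n a H]]|L1 L2 E _ [D [n a H]]].
- case: r nW => [|r] nW.
    exists (W [::]); split=> //; first exact: nW.1.
    by move=> A oA pA x Ux; exact: (nW.2 A oA pA [::] erefl x Ux).
  exists (fun=> 0); split=> //; first exact: nice0.
  by move=> psi tp; rewrite pairing_test; under eq_int3 do rewrite mul0r; rewrite int3_0.
- exists (fun=> 0); split=> //; first exact: nice0.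
  by move=> psi tp; under eq_int3 do rewrite mul0r; rewrite int3_0.
- exists (fun x => D1 x + D2 x); split; first exact: nice_add.
    by move=> A oA pA x Ux; rewrite a1 // a2.
  move=> psi tp; rewrite H1 // H2 // -int3D; [|exact: cD..].
  by apply: eq_int3 => q; rewrite mulrDl.
- exists (fun x => k * D x); split; first exact: nice_scale.
    by move=> A oA pA x Ux; rewrite a.
  move=> psi tp; rewrite H // -int3Z; last exact: cD.
  by apply: eq_int3 => q; rewrite mulrA.
- exists D; split=> // psi tp; rewrite -E ?H //; exact: phase_test_test.
Qed.

End MainInduction.

(** * The low orders *)

Section RayIntegrals.
Context {R : realType}.

Lemma tint_FTC (f F : R -> R) (C l : R) : continuous f ->
  (forall u : R, 0 <= u -> `|f u| <= C * decay u) ->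
  (forall u : R, 0 <= u -> is_derive u 1 F (f u)) -> F u @[u --> +oo] --> l ->
  tint f = l - F 0.
Proof.
move=> cf fC dF Fl.
pose B (u : R) : R := - (C * (1 + u)^-1).
have dB (u : R) : 0 <= u -> is_derive u 1 B (C * decay u).
  move=> u0; have n0 : 1 + u != 0 by rewrite gt_eqF // ltr_pwDl.
  have d1 : is_derive u 1 (fun u : R => 1 + u) 1.
    by have := is_deriveD (is_derive_cst (1 : R) u 1) (is_derive_id u 1); rewrite add0r.
  have d2 := is_deriveV n0 d1.
  have d3 := is_deriveN (is_deriveZ C d2).
  have <- : - (C *: (- (1 + u) ^- 2 *: (1 : R))) = C * decay u.
    by rewrite /decay ger0_norm // /GRing.scale /= mulr1 mulrN opprK.
  exact: d3.
have B0 : B u @[u --> +oo] --> (0 : R).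
  rewrite -[X in _ --> X](@oppr0 R) -(mulr0 C); apply: cvgN; apply: cvgM; first exact: cvg_cst.
  apply/gtr0_cvgV0; first by near=> u; rewrite ltr_pwDl //; near: u; exact: nbhs_pinfty_ge.
  exact: cvg_addrl.
have key (g G : R -> R) (m : R) : continuous g -> (forall u : R, 0 <= u -> 0 <= g u) ->
    (forall u : R, 0 <= u -> is_derive u 1 G (g u)) -> G u @[u --> +oo] --> m ->
    tint g = m - G 0.
  move=> cg g0 dG Gm; apply: Rintegral_ge0_continuous_FTC2y => //.
  - by apply: continuous_subspaceT.
  - by move=> u u0; have [] := dG u (ltW u0).
  - apply: cvg_at_right_filter; apply/differentiable_continuous/derivable1_diffP.
    by have [] := dG 0 (lexx _).
  - move=> u; rewrite in_itv /= andbT => u0; rewrite derive1E.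
    by have [_ ->] := dG u (ltW u0).
have cD := cont_mul (@cont_cst R R C) (@decay_cont R).
have C0 : 0 <= C.
  have := fC 0 (lexx _); rewrite /decay normr0 addr0 expr1n invr1 mulr1.
  exact: le_trans.
have D1 : tint (fun u => C * decay u) = 0 - B 0.
  by apply: key => // u _; rewrite mulr_ge0 // decay_ge0.
(* Adding [C * decay] makes the integrand nonnegative, as the improper FTC requires. *)
have D2 : tint (fun u => f u + C * decay u) = (l + 0) - (F 0 + B 0).
  apply: (key _ (fun u => F u + B u)).
  - exact: (@cont_add R R).
  - move=> u u0; have := fC u u0; rewrite ler_norml => /andP[+ _].
    by rewrite -subr_ge0 opprK.
  - by move=> u u0; apply: is_deriveD; [exact: dF|exact: dB].
  - exact: cvgD Fl B0.
have bD (u : R) : 0 <= u -> `|C * decay u| <= C * decay u.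
  by move=> _; rewrite ger0_norm // mulr_ge0 // decay_ge0.
have D3 := tintD cf cD fC bD.
rewrite D2 D1 in D3; move: D3 => /eqP; lra.
Unshelve. all: end_near. Qed.

(** * Antiderivatives along a backward ray *)

Section Antiderivatives.
Variables (A b w : R).
Hypothesis w_gt0 : 0 < w.
Hypothesis A_gt0 : 0 < A.
Hypothesis bw : b < w * Num.sqrt A.

(** With [A = |x|^2], [b = x.p0 / mu] and [w = |p0| / mu] this is the distance to the origin after
    backward flight from [x] during time [u], and [bw] says that [x] is off the forward ray. *)
Definition ray_dist (u : R) : R := Num.sqrt (A - 2 * b * u + w ^+ 2 * u ^+ 2).

(** The polynomial is [(sqrt A - w u)^2 + 2 u (w sqrt A - b)]. *)
Lemma ray_poly_gt0 (u : R) : 0 <= u -> 0 < A - 2 * b * u + w ^+ 2 * u ^+ 2.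
Proof.
rewrite le_eqVlt => /predU1P[<-|u0]; first by rewrite expr0n /= !mulr0 subr0 addr0.
have E := sqr_sqrtr (ltW A_gt0).
have h1 := sqr_ge0 (Num.sqrt A - w * u).
have h2 : 0 < u * (w * Num.sqrt A - b) by rewrite mulr_gt0 // subr_gt0.
by move: (Num.sqrt A) E h1 h2 => s <-; lra.
Qed.

Lemma ray_dist_gt0 (u : R) : 0 <= u -> 0 < ray_dist u.
Proof. by move=> u0; rewrite sqrtr_gt0 ray_poly_gt0. Qed.

Lemma ray_dist_sqr (u : R) : 0 <= u -> ray_dist u ^+ 2 = A - 2 * b * u + w ^+ 2 * u ^+ 2.
Proof. by move=> u0; rewrite sqr_sqrtr // ltW // ray_poly_gt0. Qed.

Lemma ray_dist_derive (u : R) : 0 <= u ->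
  is_derive u 1 ray_dist ((w ^+ 2 * u - b) / ray_dist u).
Proof.
move=> u0; have p0 := ray_poly_gt0 u0; have r0 := ray_dist_gt0 u0.
pose P (u : R) := A - 2 * b * u + w ^+ 2 * u ^+ 2.
have dP : is_derive u 1 P (- (2 * b) + w ^+ 2 * (2 * u)).
  rewrite /P; apply: is_derive_eq.
  by rewrite /GRing.scale /=; ring.
apply: is_derive_eq (@is_derive1_comp R (@Num.sqrt R) P u _ _ (is_derive1_sqrt p0) dP) _.
rewrite -/(ray_dist u); field; by rewrite gt_eqF.
Qed.

(** The numerator [A - b u] is the scalar product of [x] with the point reached at time [u], so the
    derivative is, up to a constant factor, [x] times the Coulomb force at that point. *)
Lemma ray_ratio_derive (u : R) : 0 <= u ->
  is_derive u 1 (fun u => u / ray_dist u) ((A - b * u) / ray_dist u ^+ 3).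
Proof.
move=> u0; have r0 := ray_dist_gt0 u0; have rn : ray_dist u != 0 by rewrite gt_eqF.
have dr := ray_dist_derive u0.
have dV := is_deriveV rn dr.
apply: is_derive_eq (is_deriveM (is_derive_id u 1) dV) _.
have -> : A = ray_dist u ^+ 2 + 2 * b * u - w ^+ 2 * u ^+ 2 by rewrite ray_dist_sqr //; ring.
by rewrite /GRing.scale /=; field.
Qed.

(** With [r = ray_dist u], the product [ray_gap u * (w r + b - w^2 u)] is the constant
    [A w^2 - b^2]. Of the two factors, this is the one that stays positive in the backward direction
    as well. *)
Definition ray_gap u := w * ray_dist u - b + w ^+ 2 * u.

Lemma ray_gap_gt0 (u : R) : 0 <= u -> 0 < ray_gap u.
Proof.
move=> u0; have r0 := ray_dist_gt0 u0; have E := ray_dist_sqr u0.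
have EA := sqr_sqrtr (ltW A_gt0).
rewrite /ray_gap; have [c0|c0] := leP (b - w ^+ 2 * u) 0.
  by rewrite -addrA ltr_pwDl ?mulr_gt0 //; lra.
have h : (b - w ^+ 2 * u) ^+ 2 < (w * ray_dist u) ^+ 2.
  rewrite [ltRHS]exprMn E.
  have : b ^+ 2 < (w * Num.sqrt A) ^+ 2.
    have b0 : 0 < b by have := mulr_ge0 (sqr_ge0 w) u0; lra.
    by rewrite ltr_pXn2r // nnegrE ltW //; apply: lt_trans bw.
  by rewrite exprMn EA; nra.
suff : b - w ^+ 2 * u < w * ray_dist u by lra.
by rewrite -(@ltr_pXn2r _ 2) // nnegrE ltW // mulr_gt0.
Qed.

(* The textbook antiderivative of [u ^+ 2 / ray_dist u ^+ 5] divides by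
   [A * w ^+ 2 - b ^+ 2], which vanishes in the backward direction; this one only
   divides by [ray_gap u]. *)
Definition ray_prim u :=
  let y := (ray_dist u)^-1 in let g := (ray_gap u)^-1 in
  - (g * g) / 3 *
  (w^-1 + 2 * (u * y) + u * u * (2 * w * ray_dist u - b + w ^+ 2 * u) * (y * y * y)).

Lemma ray_prim_derive (u : R) : 0 <= u -> is_derive u 1 ray_prim (u ^+ 2 / ray_dist u ^+ 5).
Proof.
move=> u0; have r0 := ray_dist_gt0 u0; have rn : ray_dist u != 0 by rewrite gt_eqF.
have e0 := ray_gap_gt0 u0; have en : ray_gap u != 0 by rewrite gt_eqF.
have wn : w != 0 by rewrite gt_eqF.
have dr := ray_dist_derive u0.
have dE : is_derive u 1 ray_gap (w * ((w ^+ 2 * u - b) / ray_dist u) + w ^+ 2).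
  rewrite /ray_gap; apply: is_derive_eq.
  by rewrite /GRing.scale /=; ring.
have dV := is_deriveV rn dr.
have dG := is_deriveV en dE.
rewrite /ray_prim; apply: is_derive_eq.
rewrite /GRing.scale /= /ray_gap in en *; field.
by rewrite rn en wn.
Qed.

(** [ray_dist u / u] in the variable [y = 1/u]: limits at infinity become continuity at zero. *)
Let tail (y : R) : R := Num.sqrt (A * y ^+ 2 - 2 * b * y + w ^+ 2).

Lemma ray_dist_tail (u : R) : 0 < u -> ray_dist u = u * tail u^-1.
Proof.
move=> u0; have un : u != 0 by rewrite gt_eqF.
have E : A - 2 * b * u + w ^+ 2 * u ^+ 2 = u ^+ 2 * (A * u^-1 ^+ 2 - 2 * b * u^-1 + w ^+ 2) by field.
by rewrite /ray_dist E sqrtrM ?sqr_ge0 // sqrtr_sqr ger0_norm // ltW.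
Qed.

Let tail_cont : {for (0 : R), continuous tail}.
Proof.
apply: (@continuous_comp _ _ _ (fun y : R => A * y ^+ 2 - 2 * b * y + w ^+ 2) (@Num.sqrt R)).
  apply: cvgD; last exact: cvg_cst.
  apply: cvgB; last by apply: cvgM; [exact: cvg_cst|exact: cvg_id].
  by apply: cvgM; [exact: cvg_cst|exact: exprn_continuous].
exact: sqrt_continuous.
Qed.

Let tail0 : tail 0 = w.
Proof. by rewrite /tail expr0n /= !mulr0 subrr add0r sqrtr_sqr ger0_norm // ltW. Qed.

Let inv_pinfty : (u : R)^-1 @[u --> +oo] --> (0 : R).
Proof. by apply/gtr0_cvgV0; [exact: nbhs_pinfty_gt|exact: cvg_id]. Qed.

Lemma ray_ratio_cvg : u / ray_dist u @[u --> +oo] --> w^-1.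
Proof.
have H : (tail u^-1)^-1 @[u --> +oo] --> w^-1.
  apply: cvgV; first by rewrite gt_eqF.
  by rewrite -tail0; apply: cvg_comp inv_pinfty tail_cont.
apply: cvg_trans H; apply: near_eq_cvg; near=> u.
have u0 : 0 < u by near: u; exact: nbhs_pinfty_gt.
by rewrite ray_dist_tail // invfM mulrA divff ?mul1r // gt_eqF.
Unshelve. all: by end_near. Qed.

Lemma ray_prim_cvg : ray_prim u @[u --> +oo] --> (0 : R).
Proof.
(* For large [u] one has [ray_prim u = h (1/u)]; the two factors [y * g y] come from [1 / ray_gap]
   and force the limit zero. *)
pose g (y : R) : R := (w * tail y - b * y + w ^+ 2)^-1.
pose h (y : R) : R := - (y * g y * (y * g y)) / 3 *
  (w^-1 + 2 * (tail y)^-1 + (2 * w * tail y - b * y + w ^+ 2) * ((tail y)^-1 * (tail y)^-1 * (tail y)^-1)).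
have cI : {for (0 : R), continuous (fun y => (tail y)^-1)}.
  by apply: cvgV tail_cont; rewrite tail0 gt_eqF.
have lin (c : R) : {for (0 : R), continuous (fun y : R => c * tail y - b * y + w ^+ 2)}.
  apply: cvgD; last exact: cvg_cst.
  apply: cvgB; last by apply: cvgM; [exact: cvg_cst|exact: cvg_id].
  by apply: cvgM; [exact: cvg_cst|exact: tail_cont].
have cg : {for (0 : R), continuous g}.
  apply: cvgV (lin w).
  by rewrite tail0 mulr0 subr0 gt_eqF // addr_gt0 ?exprn_gt0 // mulr_gt0.
have cyg : {for (0 : R), continuous (fun y : R => y * g y)} by apply: cvgM cg; exact: cvg_id.
have ch : {for (0 : R), continuous h}.
  apply: cvgM.
    by apply: cvgM; [apply: cvgN; exact: (cvgM cyg cyg)|exact: cvg_cst].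
  apply: cvgD; last exact: (cvgM (lin _) (cvgM (cvgM cI cI) cI)).
  by apply: cvgD; [exact: cvg_cst|apply: (cvgM _ cI); exact: cvg_cst].
have H : h u^-1 @[u --> +oo] --> (0 : R).
  have -> : 0 = h 0 by rewrite /h !mul0r oppr0 !mul0r.
  exact: cvg_comp inv_pinfty ch.
apply: cvg_trans H; apply: near_eq_cvg; near=> u.
have u0 : 0 < u by near: u; exact: nbhs_pinfty_gt.
have un : u != 0 by rewrite gt_eqF.
have rE := ray_dist_tail u0; have r0 := ray_dist_gt0 (ltW u0).
have g0 := ray_gap_gt0 (ltW u0).
rewrite rE pmulr_rgt0 // in r0.
rewrite /ray_gap rE in g0.
have gE : w * (u * tail u^-1) - b + w ^+ 2 * u = u * (w * tail u^-1 - b * u^-1 + w ^+ 2) by field.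
rewrite gE pmulr_rgt0 // in g0.
rewrite /ray_prim /h /g /ray_gap rE gE.
have tn : tail u^-1 != 0 by rewrite gt_eqF.
have gn : w * tail u^-1 - b * u^-1 + w ^+ 2 != 0 by rewrite gt_eqF.
move: (tail u^-1) tn gn => t tn gn; field.
have -> : w * t * u - b + w ^+ 2 * u = u * (w * t - b / u + w ^+ 2) by field.
by rewrite tn un mulf_neq0 // gt_eqF.
Unshelve. all: by end_near. Qed.

Lemma ray_prim0 : ray_prim 0 = - (3 * w * (w * Num.sqrt A - b) ^+ 2)^-1.
Proof.
have gn : w * Num.sqrt A - b != 0 by rewrite subr_eq0 gt_eqF.
have wn : w != 0 by rewrite gt_eqF.
have sn : Num.sqrt A != 0 by rewrite gt_eqF // sqrtr_gt0.
have -> : ray_prim 0 = - ((w * Num.sqrt A - b)^-1 * (w * Num.sqrt A - b)^-1) / 3 * w^-1.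
  by rewrite /ray_prim /ray_gap /ray_dist expr0n /= !(mulr0, mul0r, addr0, subr0).
by field; rewrite gn wn.
Qed.

End Antiderivatives.
End RayIntegrals.

(** * The integrated force and the second-order field *)

Section Explicit.
Context {R : realType}.
Notation V3 := 'rV[R]_3.
Notation e := (delta_mx ord0 : 'I_3 -> V3).
Variables (mu nu kappa : R) (p0 : V3).
Hypothesis mu_gt0 : 0 < mu.
Hypothesis p0_neq0 : p0 != 0.
Notation U := (off_forward_ray p0).
Notation V := (coulomb kappa).
Notation w := (enorm p0 / mu).

Lemma speed_gt0 : 0 < w.
Proof. by rewrite divr_gt0 // enorm_gt0. Qed.

Lemma ray_gap_start (x : V3) : U x -> dot x p0 / mu < w * Num.sqrt (dot x x).
Proof. by move=> /(off_ray_dot p0_neq0); rewrite mulrAC ltr_pM2r ?invr_gt0 // mulrC. Qed.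

Lemma enorm_path (x : V3) (u : R) : 0 <= u ->
  enorm (x - (u / mu) *: p0) = ray_dist (dot x x) (dot x p0 / mu) w u.
Proof.
move=> u0; rewrite /enorm /ray_dist; congr Num.sqrt.
rewrite !(dotDl, dotDr, dotNl, dotNr, dotZl, dotZr) (dotC p0 x) exprMn enorm_sqr; ring.
Qed.

Lemma nice_rinv : nice p0 1 (@rinv R).
Proof.
split; last by move=> x k Ux k0; rewrite /rinv enormZ ?ltW // expr1 invfM mulrC.
have sr : smooth_on [set x : V3 | x != 0] (@rinv R) := smooth_calg calg_rinv.
by apply: smooth_onS sr => x; exact: off_ray_neq0.
Qed.

Lemma nice_rinv5 : nice p0 5 (fun x => rinv x ^+ 5).
Proof.
have n2 := nice_mul p0_neq0 nice_rinv nice_rinv.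
have n4 := nice_mul p0_neq0 n2 n2.
have n5 := nice_mul p0_neq0 n4 nice_rinv.
by apply: (nice_eq p0_neq0 _ n5) => x _; ring.
Qed.

Lemma path_int_FTC l d F (G : R -> R) (x : V3) (m : R) : nice p0 d F -> (l.+2 <= d)%N -> U x ->
  (forall u : R, 0 <= u -> is_derive u 1 G (path_fun mu p0 l F x u)) ->
  G u @[u --> +oo] --> m -> path_int mu p0 l F x = m - G 0.
Proof.
move=> nF ld Ux dG Gm; have [r r0 [K [cK KU rK]]] := off_ray_compact_nbhs p0_neq0 Ux.
have Kx : K x by apply: rK; exact: ballxx.
have [C _ HC] := path_fun_bound mu_gt0 p0_neq0 nF ld cK KU.
exact: (tint_FTC (path_fun_cont mu_gt0 nF Ux) (fun u _ => HC x u Kx) dG Gm).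
Qed.

Lemma path_int_rinv5 (x : V3) : U x -> path_int mu p0 2 (fun x => rinv x ^+ 5) x =
  mu ^- 2 * (3 * w * (w * enorm x - dot x p0 / mu) ^+ 2)^-1.
Proof.
move=> Ux; have A0 : 0 < dot x x by rewrite dot_gt0 // (off_ray_neq0 Ux).
have bw := ray_gap_start Ux.
have D := ray_prim_derive speed_gt0 A0 bw.
have L := ray_prim_cvg speed_gt0 A0 bw.
have P0 := ray_prim0 speed_gt0 A0 bw.
(* The factor [mu^-2] comes from the weight [(u / mu)^2] of [path_int]. *)
pose G u := mu ^- 2 * ray_prim (dot x x) (dot x p0 / mu) w u.
have dG (u : R) : 0 <= u -> is_derive u 1 G (path_fun mu p0 2 (fun x => rinv x ^+ 5) x u).
  move=> u0; apply: is_derive_eq (is_deriveZ (mu ^- 2) (D u u0)) _.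
  rewrite /path_fun ger0_norm // /rinv enorm_path // /GRing.scale /= exprVn; field.
  by rewrite (gt_eqF mu_gt0) (gt_eqF (ray_dist_gt0 A0 bw u0)).
have cG : G u @[u --> +oo] --> mu ^- 2 * 0 by apply: cvgM L; exact: cvg_cst.
by rewrite (@path_int_FTC 2 5 _ _ _ _ nice_rinv5 isT Ux dG cG) /G P0 mulr0 sub0r mulrN opprK.
Qed.

(** Up to sign, [nu] times the momentum received from V along the straight trajectory arriving at
    [x]. *)
Definition force1 (j : 'I_3) (x : V3) : R := path_int mu p0 0 (fun y => nu * dirD (e j) V y) x.

Lemma nice_dV j : nice p0 2 (fun y => nu * dirD (e j) V y).
Proof. by apply: nice_scale => //; exact: (nice_coulomb_iterD kappa p0_neq0 [:: j]). Qed.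

(** At distance [r] on the ray, [x . grad V] equals [kappa (A - b u) / r^3], the derivative of
    [kappa u / r], which runs from [0] to [kappa / w]. *)
Lemma position_force1 (x : V3) : U x ->
  \sum_(j < 3) x ord0 j * force1 j x = nu * kappa / w.
Proof.
move=> Ux; have A0 : 0 < dot x x by rewrite dot_gt0 // (off_ray_neq0 Ux).
have bw := ray_gap_start Ux.
have D := ray_ratio_derive A0 bw.
have L := ray_ratio_cvg (dot x x) (dot x p0 / mu) speed_gt0.
have n1 j : nice p0 2 (fun y => x ord0 j * (nu * dirD (e j) V y)).
  by apply: nice_scale => //; exact: nice_dV.
have l2 : (0.+2 <= 2)%N by [].
under eq_bigr do rewrite -(path_intZ mu_gt0 p0_neq0 _ (nice_dV _) l2 Ux).
rewrite -(path_int_sum mu_gt0 p0_neq0 _ n1 l2 Ux).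
pose G u := nu * kappa * (u / ray_dist (dot x x) (dot x p0 / mu) w u).
have cG : G u @[u --> +oo] --> nu * kappa * w^-1 by apply: cvgM L; exact: cvg_cst.
have dG (u : R) : 0 <= u -> is_derive u 1 G
    (path_fun mu p0 0 (fun y => \sum_(j < 3) x ord0 j * (nu * dirD (e j) V y)) x u).
  move=> u0; apply: is_derive_eq (is_deriveZ (nu * kappa) (D u u0)) _.
  rewrite /path_fun ger0_norm // expr0 mul1r.
  set y := x - _.
  have yn : y != 0 by apply: (@off_ray_neq0 _ p0); apply: off_ray_sub => //; rewrite divr_ge0 // ltW.
  have -> : \sum_(i < 3) x ord0 i * (nu * dirD (e i) V y) = nu * kappa * dot x y * rinv y ^+ 3.
    under eq_bigr do rewrite coulomb_dirD // dot_delta.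
    by rewrite /dot mulr_sumr mulr_suml; apply: eq_bigr => i _; ring.
  have -> : dot x y = dot x x - dot x p0 / mu * u by rewrite /y dotDr dotNr dotZr; ring.
  by rewrite /rinv /y enorm_path // exprVn /GRing.scale /= mulrA.
rewrite (@path_int_FTC 0 2 _ _ _ _ (nice_sum p0_neq0 _ n1) isT Ux dG cG).
by rewrite /G mul0r mulr0 subr0.
Qed.

End Explicit.

Section Explicit2.
Context {R : realType}.
Notation V3 := 'rV[R]_3.
Notation e := (delta_mx ord0 : 'I_3 -> V3).
Variables (mu nu kappa : R) (p0 : V3).
Hypothesis mu_gt0 : 0 < mu.
Hypothesis p0_neq0 : p0 != 0.
Notation U := (off_forward_ray p0).
Notation V := (coulomb kappa).
Notation w := (enorm p0 / mu).
Notation force1 := (force1 mu nu kappa p0).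

Lemma rinv_sqr (x : V3) : x != 0 -> dot x x * rinv x ^+ 2 = 1.
Proof.
by move=> x0; rewrite -enorm_sqr /rinv exprVn divff // expf_neq0 // gt_eqF // enorm_gt0.
Qed.

Lemma laplace_coulomb (x : V3) : x != 0 -> \sum_(j < 3) dirD (e j) (dirD (e j) V) x = 0.
Proof.
move=> x0; under eq_bigr do rewrite coulomb_dirD2 // dot_delta mxE !eqxx.
have E := rinv_sqr x0.
rewrite -mulr_sumr sumrB -mulr_suml sumr_const card_ord -mulr_suml -mulr_sumr sum_dot_delta.
have -> : rinv x ^+ 5 = rinv x ^+ 2 * rinv x ^+ 3 by ring.
have -> : 3 * dot x x * (rinv x ^+ 2 * rinv x ^+ 3) = 3 * (dot x x * rinv x ^+ 2) * rinv x ^+ 3 by ring.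
by rewrite E /= -mulr_natr; ring.
Qed.

Lemma smooth_dV j : smooth_on U (dirD (e j) V).
Proof. exact: (nice_coulomb_iterD kappa p0_neq0 [:: j]).1. Qed.

Lemma force1_dirD j (x a : V3) : U x -> derivable (force1 j) x a /\
  dirD a (force1 j) x = path_int mu p0 0 (dirD a (fun y => nu * dirD (e j) V y)) x.
Proof. by move=> Ux; exact: ((path_int_regular mu_gt0 p0_neq0 (nice_dV nu kappa p0_neq0 j) (isT : (0.+2 <= 2)%N) Ux).2 a). Qed.

Lemma div_force1 (x : V3) : U x -> \sum_(j < 3) dirD (e j) (force1 j) x = 0.
Proof.
move=> Ux; have n3 j := nice_dirD p0_neq0 (e j) (nice_dV nu kappa p0_neq0 j).
under eq_bigr do rewrite (force1_dirD _ _ Ux).2.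
rewrite -(path_int_sum mu_gt0 p0_neq0 _ n3 (isT : (0.+2 <= 3)%N) Ux).
rewrite -[RHS](path_int0 mu p0 0 x). apply: (fun H => @path_int_eq R mu p0 mu_gt0 0 _ _ x H Ux) => y Uy.
transitivity (nu * \sum_(j < 3) dirD (e j) (dirD (e j) V) y).
  rewrite mulr_sumr; apply: eq_bigr => j _.
  exact: (deriveMl _ (smooth_derivable (smooth_dV j) Uy)).
by rewrite laplace_coulomb ?mulr0 // (off_ray_neq0 Uy).
Qed.

Lemma dirDM (f g : V3 -> R) (x a : V3) : derivable f x a -> derivable g x a ->
  derivable (fun y => f y * g y) x a /\
  dirD a (fun y => f y * g y) x = f x * dirD a g x + g x * dirD a f x.
Proof. by move=> df dg; exact: (conj (derivableM df dg) (deriveM df dg)). Qed.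

Lemma dirDZ (c : R) (f : V3 -> R) (x a : V3) : derivable f x a ->
  derivable (fun y => c * f y) x a /\ dirD a (fun y => c * f y) x = c * dirD a f x.
Proof. by move=> df; exact: (conj (derivableM (derivable_cst c x a) df) (deriveMl c df)). Qed.

Lemma dirDD (f g : V3 -> R) (x a : V3) : derivable f x a -> derivable g x a ->
  dirD a (fun y => f y + g y) x = dirD a f x + dirD a g x.
Proof. by move=> df dg; exact: (deriveD df dg). Qed.

Definition tensor1 := mulV_T kappa 0 (fun _ _ => nu : R).
Definition tensor2 := mulV_T kappa 1 (pathT mu p0 0 tensor1).

(** [force1] is divergence free, so only the Hessian of V contributes; its second term meets
    [force1] through the constant of [position_force1]. *)
Lemma div_tensor2 i (x : V3) : U x -> divT tensor2 [:: i] x =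
  kappa * (force1 i x * rinv x ^+ 3 - 3 * (nu * kappa / w) * (x ord0 i * rinv x ^+ 5)).
Proof.
move=> Ux; have x0 := off_ray_neq0 Ux.
transitivity (\sum_(j < 3) (force1 j x * dirD (e j) (dirD (e i) V) x +
    dirD (e i) V x * dirD (e j) (force1 j) x)).
  apply: eq_bigr => j _.
  exact: (dirDM (force1_dirD j (e j) Ux).1 (smooth_derivable (smooth_dV i) Ux)).2.
rewrite big_split /= -mulr_sumr div_force1 // mulr0 addr0 -(position_force1 nu kappa mu_gt0 p0_neq0 Ux).
have H j : force1 j x * dirD (e j) (dirD (e i) V) x = kappa * (
    (e i) ord0 j * force1 j x * rinv x ^+ 3 - 3 * (x ord0 j * force1 j x) * (x ord0 i * rinv x ^+ 5)).
  by rewrite coulomb_dirD2 // !dot_delta; ring.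
under eq_bigr do rewrite H.
rewrite -mulr_sumr sumrB -mulr_suml -mulr_suml -mulr_sumr; congr (_ * (_ * _ - _)).
rewrite (bigD1 i) //= mxE !eqxx mul1r big1 ?addr0 // => j ji.
by rewrite mxE eqxx (negPf ji) mul0r.
Qed.

(* The only input on [force1], besides being divergence free, is that
   [\sum_j x_j * force1 j x] does not depend on [x]. *)
Lemma div_div_tensor2 (x : V3) : U x -> divT (divT tensor2) [::] x =
  3 * kappa * (nu * kappa / w) * rinv x ^+ 5.
Proof.
move=> Ux; have x0 := off_ray_neq0 Ux.
set c := nu * kappa / w.
pose F i (y : V3) := kappa * (force1 i y * rinv y ^+ 3 + - (3 * c) * (dot y (e i) * rinv y ^+ 5)).
have FE i : dirD (e i) (divT tensor2 [:: i]) x = dirD (e i) (F i) x.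
  apply: near_eq_derive; apply: filterS (open_nbhs_nbhs (conj (off_ray_open p0_neq0) Ux)) => y Uy.
  by rewrite /F dot_delta mulNr; exact: div_tensor2.
have DF i : dirD (e i) (F i) x = kappa * (dirD (e i) (force1 i) x * rinv x ^+ 3
    - 3 * (x ord0 i * force1 i x) * rinv x ^+ 5
    - 3 * c * (rinv x ^+ 5 - 5 * (x ord0 i * x ord0 i) * rinv x ^+ 7)).
  have [d1 _] := force1_dirD i (e i) Ux.
  have [d3 E3] := rinvX_dirD 2 (e i) x0.
  have [d5 E5] := rinvX_dirD 4 (e i) x0.
  have dd : derivable (fun y : V3 => dot y (e i)) x (e i) by exact/diff_derivable/dotl_diff.
  have ed := dotl_dirD (e i) x (e i).
  have [p3 F3] := dirDM d1 d3.
  have [p5 F5] := dirDM dd d5.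
  have [q5 G5] := dirDZ (- (3 * c)) p5.
  apply: etrans (dirDZ kappa (derivableD p3 q5)).2 _.
  apply: etrans (congr1 (fun z => kappa * z) (dirDD p3 q5)) _.
  rewrite F3 G5 F5.
  rewrite E3 E5 ed !dot_delta mxE !eqxx /=; ring.
(* The sum over [i] of [1 - 5 x_i^2 / |x|^2] is [-2], and [- 3 c - 3 c (-2) = 3 c] is the final
   coefficient. *)
rewrite /divT; under eq_bigr do rewrite FE DF.
rewrite -mulr_sumr !sumrB -!mulr_suml -!mulr_sumr div_force1 // position_force1 // -/c mul0r.
rewrite sumrB sumr_const card_ord -mulr_natr -mulr_suml -mulr_sumr.
have -> : \sum_(i < 3) x ord0 i * x ord0 i = dot x x by [].
have -> : rinv x ^+ 7 = rinv x ^+ 2 * rinv x ^+ 5 by ring.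
have -> : 5 * dot x x * (rinv x ^+ 2 * rinv x ^+ 5) = 5 * (dot x x * rinv x ^+ 2) * rinv x ^+ 5 by ring.
by rewrite rinv_sqr //; ring.
Qed.

(** The weight [2] stems from the factor [s^2] left by two integrations by parts. *)
Definition density2 : V3 -> R := pathT mu p0 2 (divT (divT tensor2)) [::].

Lemma density2E (x : V3) : U x -> density2 x =
  nu * kappa ^+ 2 * mu ^+ 2 / (enorm p0 ^+ 2 * (enorm p0 * enorm x - dot x p0) ^+ 2).
Proof.
move=> Ux; have P0 := enorm_gt0 p0_neq0.
have g0 : 0 < enorm p0 * enorm x - dot x p0.
  by rewrite subr_gt0 mulrC; exact/(off_ray_dot p0_neq0).
rewrite /density2 /pathT (path_int_eq mu_gt0 _ div_div_tensor2 Ux).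
rewrite (path_intZ mu_gt0 p0_neq0 _ (nice_rinv5 p0_neq0) (isT : (2.+2 <= 5)%N) Ux).
rewrite path_int_rinv5 //.
have -> : w * enorm x - dot x p0 / mu = (enorm p0 * enorm x - dot x p0) / mu by ring.
move: (enorm p0 * enorm x - dot x p0) (enorm p0) P0 g0 => g P P0 g0.
by field; rewrite !gt_eqF.
Qed.

End Explicit2.

(** * Densities of first and second order in V *)

Section LowOrder.
Context {R : realType}.
Notation V3 := 'rV[R]_3.
Notation e := (delta_mx ord0 : 'I_3 -> V3).
Variables (mu nu kappa : R) (p0 : V3) (a : nat -> R).
Hypothesis mu_gt0 : 0 < mu.
Hypothesis p0_neq0 : p0 != 0.
Hypothesis a0 : a 0%N = 1.
Notation U := (off_forward_ray p0).
Notation V := (coulomb kappa).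
Notation rho := (rho_coef mu nu p0 V (moyal_series a)).
Notation tensor1 := (tensor1 nu kappa).
Notation tensor2 := (tensor2 mu nu kappa p0).

Lemma phase_test_off_ray (Psi : phase_fun R) q : phase_test p0 Psi -> ~ U q -> Psi q p0 = 0.
Proof.
move=> [eps [K [e0 _ KU [_ zP]]]] nU; apply: zP; first exact: ballxx.
by move=> Kq; apply: nU; exact: KU.
Qed.

Lemma nice_tensor1 : niceT p0 1 2 tensor1.
Proof. exact: (nice_mulV kappa p0_neq0 1 (niceT_cst p0_neq0 nu)). Qed.

Lemma nice_tensor2 : niceT p0 2 3 tensor2.
Proof. exact: (nice_mulV kappa p0_neq0 1 (nice_path mu_gt0 p0_neq0 nice_tensor1 (isT : (0.+2 <= 2)%N))). Qed.

(** One step of the classical recursion before time integration; [a 0 = 1] removes the bracket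
    coefficient. *)
Lemma pairing_kick r (W : seq 'I_3 -> V3 -> R) d s (Psi : phase_fun R) : niceT p0 r d W -> 0 <= s -> phase_test p0 Psi ->
  pairing p0 r W (moyal_series a 0 (fun q _ => V q) (fun q p => Psi (q + s *: p) p)) =
  mixed p0 (r + 1) (r + 1) (mulV_T kappa r W) s Psi.
Proof.
move=> nW s0 TP; have TS := phase_test_shift p0_neq0 s0 TP.
apply: etrans (pairing_mulV kappa p0_neq0 1 (a 0%N) (niceT_smooth nW) TS) _.
have -> : (fun J x => a 0%N * mulV_T kappa r W J x) = mulV_T kappa r W.
  by apply/funext => J; apply/funext => x; rewrite a0 mul1r.
exact: (pairing_shift p0_neq0 (niceT_smooth (nice_mulV kappa p0_neq0 1 nW)) s0 TP).
Qed.

(** The divergence produced by the shift is a multiple of the Laplacian of V, hence zero: to first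
    order no spatial density builds up. *)
Lemma mixed_tensor1 s (Psi : phase_fun R) : 0 <= s -> phase_test p0 Psi ->
  mixed p0 1 1 tensor1 s Psi = mixed p0 0 1 tensor1 s Psi.
Proof.
move=> s0 TP; rewrite (mixed_step p0_neq0 (niceT_smooth nice_tensor1) (leqnn 0) s0 TP).
have -> : mixed p0 0 0 (divT tensor1) s Psi = 0.
  rewrite -[RHS](@int3_0 R); apply: eq_int3 => q /=.
  have [Uq|nU] := pselect (U q); last by rewrite phase_test_off_ray // mulr0.
  have Us := off_ray_sub s0 Uq.
  have -> : divT tensor1 [::] (q - s *: p0) = nu * \sum_(j < 3) dirD (e j) (dirD (e j) V) (q - s *: p0).
    rewrite mulr_sumr; apply: eq_bigr => j _.
    exact: (deriveMl _ (smooth_derivable (smooth_dV kappa p0_neq0 j) Us)).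
  by rewrite laplace_coulomb ?mulr0 ?mul0r // (off_ray_neq0 Us).
(* On words of one letter cycling is the identity. *)
rewrite mulr0 subr0; apply: eq_wsum => -[|i [|? ?]] // _.
Qed.

Lemma rho01 t (Psi : phase_fun R) : phase_test p0 Psi ->
  rho 0%N 1%N t Psi = - pairing p0 1 (pathT mu p0 0 tensor1) Psi.
Proof.
move=> TP; have [h [ah eh th]] := mixed0_time mu_gt0 p0_neq0 nice_tensor1 (isT : (0.+2 <= 2)%N) TP.
rewrite /= big_ord_recl big_ord0 addr0 -th; congr (- _).
apply: eq_tint => u u0; have s0 : 0 <= u / mu by rewrite divr_ge0 // ltW.
rewrite -(eh u u0) expr0 mul1r -(mixed_tensor1 s0 TP).
have TD := phase_test_Domega kappa 1 (a 0%N) (phase_test_shift p0_neq0 s0 TP).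
exact: etrans (pairing_cst p0_neq0 nu TD) (pairing_kick (niceT_cst p0_neq0 nu) s0 TP).
Qed.

Lemma DzJ_0 (bs : seq (V3 * V3)) : DzJ bs (fun _ _ => 0 : R) = (fun _ _ => 0).
Proof.
elim: bs => // b bs IH; rewrite -[LHS]/(Dz b (DzJ bs (fun _ _ => 0))) IH.
by apply/funext => q; apply/funext => p; exact: derive_cst.
Qed.

Lemma mixed_test m r (W : seq 'I_3 -> V3 -> R) s (psi : V3 -> R) : (m < r)%N ->
  mixed p0 m r W s (fun q _ => psi q) = 0.
Proof.
move=> mr; rewrite -[RHS](wsum0 r); apply: eq_wsum => Z Zr.
have : (0 < size (drop m Z))%N by rewrite size_drop Zr subn_gt0.
case: (drop m Z) => [|i J] // _; rewrite DzJ_test DzJ_0.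
by under eq_int3 do rewrite mulr0; rewrite int3_0.
Qed.

(** On a function of [q] alone every term with a momentum derivative left over vanishes, so only the
    branch where both derivatives are integrated by parts survives. Its sign [(-s)^2] and the two
    minus signs of the recursion combine to plus. *)
Lemma rho02 t (psi : V3 -> R) : test_function U psi ->
  rho 0%N 2%N t (fun q _ => psi q) = int3 (fun q => density2 mu nu kappa p0 q * psi q).
Proof.
move=> tp; have TP := phase_test_test tp; set Psi := (fun q _ => psi q).
have n2 := nice_tensor2; have nd := nice_div p0_neq0 n2; have ndd := nice_div p0_neq0 nd.
have [h [ah eh th]] := mixed0_time mu_gt0 p0_neq0 ndd (isT : (2.+2 <= 5)%N) TP.
have n1 := nice_path mu_gt0 p0_neq0 nice_tensor1 (isT : (0.+2 <= 2)%N).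
rewrite -[RHS]/(pairing p0 0 (pathT mu p0 2 (divT (divT tensor2))) Psi) -th.
have -> : time_int3 h = - time_int3 (fun u q => -1 * h u q) by rewrite time_int3_scale // mulN1r opprK.
rewrite -[LHS]/(- \sum_(j < 1) _) big_ord_recl big_ord0 addr0; congr (- _).
apply: eq_tint => u u0; have s0 : 0 <= u / mu by rewrite divr_ge0 // ltW.
rewrite (int3Z _ (dominated_bsupp u ah)) -(eh u u0) mulN1r.
have TD := phase_test_Domega kappa 1 (a 0%N) (phase_test_shift p0_neq0 s0 TP).
apply: etrans (rho01 (t - u) TD) _; apply: (congr1 (fun z => - z)).
apply: etrans (pairing_kick n1 s0 TP) _.
rewrite -[mulV_T _ _ _]/tensor2.
rewrite (mixed_step p0_neq0 (niceT_smooth n2) (leqnn 1) s0 TP) mixed_test ?sub0r //.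
rewrite (mixed_step p0_neq0 (niceT_smooth nd) (leqnn 0) s0 TP) mixed_test ?sub0r //.
by rewrite mulrN opprK mulrA expr2.
Qed.

End LowOrder.

(** * Axisymmetry *)

Section Geometry.
Context {R : realType}.
Notation V3 := 'rV[R]_3.
Variable p0 : V3.
Hypothesis p0_neq0 : p0 != 0.
Notation U := (off_forward_ray p0).

(** The reflection in the plane orthogonal to [x - y]; it fixes [p0] because [p0] lies in that
    plane. *)
Lemma householder (x y : V3) : dot x x = dot y y -> dot x p0 = dot y p0 ->
  exists A, [/\ orthogonal_mx A, p0 *m A = p0 & x *m A = y].
Proof.
move=> xy xp; have [->|nxy] := eqVneq x y.
  by exists 1%:M; split; rewrite /orthogonal_mx ?trmx1 ?mulmx1.
pose n := x - y; have n0 : n != 0 by rewrite subr_eq0.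
have nn : dot n n != 0 by rewrite dot_eq0.
pose A : 'M[R]_3 := 1%:M - (2 / dot n n) *: (n^T *m n).
have AE (z : V3) : z *m A = z - (2 / dot n n * dot z n) *: n.
  rewrite mulmxBr mulmx1 -scalemxAr mulmxA (mx11_scalar (z *m n^T)) mul_scalar_mx scalerA.
  by rewrite (dot_mx z).
have AA (z : V3) : z *m A *m A = z.
  rewrite !AE dotDl dotNl dotZl.
  have -> : 2 / dot n n * (dot z n - 2 / dot n n * dot z n * dot n n) = - (2 / dot n n * dot z n).
    by field.
  by rewrite scaleNr opprK subrK.
have At : A^T = A by rewrite /A linearB /= trmx1 linearZ /= trmx_mul trmxK.
exists A; split.
- by rewrite /orthogonal_mx At; apply/row_matrixP => i; rewrite !rowE mulmxA AA mulmx1.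
- have E : dot p0 n = 0 by rewrite /n dotDr dotNr (dotC p0 x) (dotC p0 y) xp subrr.
  by rewrite AE E mulr0 scale0r subr0.
- have E : 2 * dot x n = dot n n.
    rewrite /n !(dotDl, dotDr, dotNl, dotNr) (dotC y x) xy; ring.
  by rewrite AE mulrAC E divff // scale1r /n opprB addrCA subrr addr0.
Qed.

Lemma cos_angle_range (x : V3) : U x -> dot x p0 / (enorm x * enorm p0) \in `[-1, 1].
Proof.
move=> Ux; have x0 := enorm_gt0 (off_ray_neq0 Ux); have P0 := enorm_gt0 p0_neq0.
have xP : 0 < enorm x * enorm p0 by rewrite mulr_gt0.
have H := (off_ray_dot p0_neq0 x).1 Ux.
rewrite in_itv /= ler_pdivrMr // mul1r (ltW H) andbT ler_pdivlMr // mulN1r.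
(* The lower bound expresses that [|p0| x + |x| p0] has nonnegative square. *)
have := dot_ge0 (enorm p0 *: x + enorm x *: p0).
rewrite !(dotDl, dotDr, dotZl, dotZr) -!enorm_sqr (dotC p0 x) => G.
have : 0 <= (enorm x * enorm p0) * (enorm x * enorm p0 + dot x p0).
  by rewrite -(pmulr_rge0 _ (ltr0Sn R 1)); apply: le_trans G _; rewrite le_eqVlt; apply/orP; left; apply/eqP; ring.
by rewrite pmulr_rge0 // => h; lra.
Qed.

Lemma cos_angle (x : V3) : U x -> cos (angle x p0) = dot x p0 / (enorm x * enorm p0).
Proof. by move=> Ux; rewrite /angle acosK // cos_angle_range. Qed.

(** Homogeneity reduces [q] to its direction, and [householder] maps any unit vector to any other
    with the same angle. *)
Lemma angle_factor d (D : V3 -> R) : nice p0 d D -> axisymmetric p0 D ->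
  exists f : R -> R, forall q, U q -> D q = f (angle q p0) / enorm q ^+ d.
Proof.
move=> [_ hD] aD.
pose S t := [set q : V3 | [/\ U q, enorm q = 1 & angle q p0 = t]].
(* [f t] is read off at a chosen unit vector of angle [t]; the default [0] of [xget] is taken only
   at angles that do not occur. *)
exists (fun t => D (xget 0 (S t))) => q Uq.
have q0 := enorm_gt0 (off_ray_neq0 Uq); have qn : enorm q != 0 by rewrite gt_eqF.
pose q1 := (enorm q)^-1 *: q.
have U1 : U q1 by apply: off_ray_scale => //; rewrite invr_gt0.
have e1 : enorm q1 = 1 by rewrite /q1 enormZ ?invr_ge0 ?(ltW q0) // mulVf.
have a1 : angle q1 p0 = angle q p0.
  by rewrite /angle e1 mul1r /q1 dotZl invfM mulrA [_ * dot q p0]mulrC.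
have [] := xgetPex 0 (ex_intro (S (angle q p0)) q1 (And3 U1 e1 a1)).
move: (xget _ _) => q2 U2 e2 a2.
have -> : q = enorm q *: q1 by rewrite /q1 scalerA divff // scale1r.
rewrite hD // enormZ ?(ltW q0) // e1 mulr1; congr (_ / _).
have E : dot q1 p0 = dot q2 p0.
  have : cos (angle q1 p0) = cos (angle q2 p0) by rewrite a1 a2.
  rewrite !cos_angle // e1 e2 mul1r => /(congr1 (fun z => z * enorm p0)).
  by rewrite !divfK // gt_eqF // enorm_gt0.
have E2 : dot q1 q1 = dot q2 q2 by rewrite -!enorm_sqr e1 e2.
have [A [oA pA <-]] := householder E2 E.
by rewrite aD.
Qed.

End Geometry.

(** * Far field *)

Section Assembly.
Context {R : realType}.
Notation V3 := 'rV[R]_3.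
Variables (mu nu kappa hbar : R) (p0 : V3) (a : nat -> R).
Hypothesis mu_gt0 : 0 < mu.
Hypothesis nu_gt0 : 0 < nu.
Hypothesis p0_neq0 : p0 != 0.
Hypothesis a0 : a 0%N = 1.
Notation U := (off_forward_ray p0).
Notation V := (coulomb kappa).
Notation rho := (rho_coef mu nu p0 V (moyal_series a)).
Notation rho_cl := (rho_coef mu nu p0 V (@poisson_series R)).

(** Time enters the recursion only as an argument passed down to the base case, which does not
    depend on it. *)
Lemma rho_stationary (B : bracket_series R) (W : V3 -> R) n k t t' Phi :
  rho_coef mu nu p0 W B n k t Phi = rho_coef mu nu p0 W B n k t' Phi.
Proof.
elim: k n t t' Phi => [|k IH] n t t' Phi //=; congr (- _).
by apply: eq_bigr => j _; apply: eq_tint => u _; exact: IH.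
Qed.

Lemma moyal0 : moyal_series a 0 = @poisson_series R 0.
Proof.
apply/funext => f; apply/funext => g; apply/funext => q; apply/funext => p.
by rewrite /moyal_series a0 mul1r.
Qed.

(** At [n = 0] the sum over [j] has one term, of bracket index [0], where [a 0 = 1] makes the two
    series agree. *)
Lemma rho_classical k t Phi : rho 0%N k t Phi = rho_cl 0%N k t Phi.
Proof.
elim: k t Phi => [|k IH] t Phi //=; congr (- _).
rewrite !big_ord_recl !big_ord0; congr (_ + _).
apply: eq_tint => u _.
by rewrite -[(0 - _)%N]/0%N moyal0; exact: IH.
Qed.

Lemma rho_cl_zero n k t : rho_cl n k t (fun _ _ => 0) = 0.
Proof.
elim: k n t => [|k IH] n t /=; first by case: ifP; rewrite // int3_0 mulr0.
rewrite big1 ?oppr0 // => j _; rewrite -[RHS](@tint0 R); apply: eq_tint => u _.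
have -> : poisson_series (n - j)%N (fun q _ => V q) (fun _ _ => 0) = (fun _ _ => 0).
  apply/funext => q; apply/funext => p; rewrite /poisson_series; case: ifP => // _.
  rewrite /poisson big1 // => i _.
  have -> : dp i (fun _ _ => 0 : R) q p = 0 by exact: derive_cst.
  have -> : dq i (fun _ _ => 0 : R) q p = 0 by exact: derive_cst.
  by rewrite !mulr0 subrr.
exact: IH.
Qed.

(** Either the bracket index [n - j] is positive and the bracket is zero, or [j = n] and the
    induction hypothesis applies. *)
Lemma rho_cl_pos n k t Phi : (0 < n)%N -> rho_cl n k t Phi = 0.
Proof.
move=> n0; elim: k t Phi => [|k IH] t Phi /=; first by rewrite gtn_eqF.
rewrite big1 ?oppr0 // => j _; rewrite -[RHS](@tint0 R); apply: eq_tint => u _.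
have [jn|jn] := ltnP j n.
  have -> : poisson_series (n - j)%N (fun q _ => V q)
      (fun q p => Phi (q + (u / mu) *: p) p) = (fun _ _ => 0).
    apply/funext => q; apply/funext => p; rewrite /poisson_series.
    by rewrite gtn_eqF // subn_gt0.
  exact: rho_cl_zero.
have -> : nat_of_ord j = n by apply/eqP; rewrite eqn_leq jn -ltnS ltn_ord.
exact: IH.
Qed.

Definition density_spec n k (D : V3 -> R) := [/\ nice p0 (n.*2 + k) D, axisymmetric p0 D &
  forall t psi, test_function U psi -> rho n k t (fun q _ => psi q) = int3 (fun q => D q * psi q)].

Lemma density_exists n k : exists D, density_spec n k D.
Proof.
have [L [FL HL]] := rho_Fc nu kappa mu_gt0 p0_neq0 a k n.
have [D [nD aD HD]] := tensor_dist_marginal p0_neq0 FL.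
by exists D; split=> // t psi tp; rewrite HL; [exact: HD|exact: phase_test_test].
Qed.

Lemma density00 : density_spec 0 0 (fun=> nu).
Proof.
split=> //; first exact: nice_cst.
move=> t psi tp /=; apply: etrans (pairing_cst p0_neq0 nu (phase_test_test tp)) _ => //.
Qed.

Lemma density01 : density_spec 0 1 (fun=> 0).
Proof.
split=> //; first exact: nice0.
move=> t psi tp; rewrite (rho01 nu kappa mu_gt0 p0_neq0 a0 t (phase_test_test tp)) pairing_test oppr0.
by under eq_int3 do rewrite mul0r; rewrite int3_0.
Qed.

Lemma density02 : density_spec 0 2 (density2 mu nu kappa p0).
Proof.
have n3 := nice_path mu_gt0 p0_neq0 (nice_div p0_neq0 (nice_div p0_neq0
  (nice_tensor2 nu kappa mu_gt0 p0_neq0))) (isT : (2.+2 <= 5)%N).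
split; first exact: (n3.1 [::] erefl).
  by move=> A oA pA x Ux; exact: (n3.2 A oA pA [::] erefl x Ux).
by move=> t psi tp; exact: rho02.
Qed.

Lemma density10 : density_spec 1 0 (fun=> 0).
Proof.
split=> //; first exact: nice0.
by move=> t psi tp /=; under eq_int3 do rewrite mul0r; rewrite int3_0.
Qed.

(** The four low-order densities are prescribed and the others chosen, which fixes the values that
    matter without an appeal to uniqueness. *)
Lemma densities : exists D : nat -> nat -> V3 -> R, [/\ forall n k, density_spec n k (D n k),
  D 0%N 0%N = (fun=> nu), D 0%N 1%N = (fun=> 0), D 0%N 2%N = density2 mu nu kappa p0 & D 1%N 0%N = (fun=> 0)].
Proof.
have [D HD] := choice (fun nk : nat * nat => density_exists nk.1 nk.2).
exists (fun n k => match n, k with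
  | 0, 0 => fun=> nu | 0, 1 => fun=> 0 | 0, 2 => density2 mu nu kappa p0 | 1, 0 => fun=> 0
  | _, _ => D (n, k) end); split=> //.
case=> [|[|n]] [|[|[|k]]]; try exact: (HD (_, _)).
- exact: density00.
- exact: density01.
- exact: density02.
- exact: density10.
Qed.

Lemma density_marginal n k t D : density_spec n k D -> is_momentum_marginal U (rho n k t) D.
Proof.
move=> [[sD _] _ HD]; split; last by move=> psi; exact: HD.
by move=> q Uq; exact: smooth_cont sD Uq.
Qed.

Lemma far_field_scale (D : nat -> nat -> V3 -> R) n k e : nice p0 (n.*2 + k) (D n k) -> U e ->
  forall l, (hbar ^+ n.*2 * D n k e * (r ^+ 2 / r ^+ (n.*2 + k)))%:E @[r --> +oo] --> l ->
  far_field_term hbar D e n k l.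
Proof.
move=> [_ hD] Ue l; apply: cvg_trans; apply: near_eq_cvg; near=> r.
have r0 : 0 < r by near: r; exact: nbhs_pinfty_gt.
by rewrite hD //; congr (_%:E); ring.
Unshelve. all: by end_near. Qed.

Lemma pow_ratio_cvg d : (2 < d)%N -> (r ^+ 2 / r ^+ d : R) @[r --> +oo] --> (0 : R).
Proof.
move=> d2; have H : (r^-1 ^+ (d - 2) : R) @[r --> +oo] --> (0 : R).
  have -> : (0 : R) = 0 ^+ (d - 2) by rewrite expr0n subn_eq0 leqNgt d2.
  apply: (@cvg_comp _ _ _ (fun r : R => r^-1) (fun y : R => y ^+ (d - 2))).
    by apply/gtr0_cvgV0; [exact: nbhs_pinfty_gt|exact: cvg_id].
  exact: exprn_continuous.
apply: cvg_trans H; apply: near_eq_cvg; near=> r.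
have r0 : 0 < r by near: r; exact: nbhs_pinfty_gt.
have rn : r != 0 by rewrite gt_eqF.
by rewrite -{2}(subnK (ltnW d2)) exprD invfM mulrA mulrAC divff ?expf_neq0 // mul1r exprVn.
Unshelve. all: by end_near. Qed.

Lemma sqr_cvg_pinfty : (r ^+ 2 : R) @[r --> +oo] --> +oo.
Proof.
apply/cvgryPge => A; near=> r.
have r1 : 1 <= r by near: r; exact: nbhs_pinfty_ge.
have rA : A <= r by near: r; apply: nbhs_pinfty_ge; exact: num_real.
by apply: le_trans rA _; rewrite expr2 ler_peMl // (le_trans ler01 r1).
Unshelve. all: by end_near. Qed.

Lemma far_field_zero (D : nat -> nat -> V3 -> R) e n k : D n k = (fun=> 0) ->
  far_field_term hbar D e n k 0%E.
Proof.
move=> D0; rewrite /far_field_term D0.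
under eq_fun do rewrite mulr0 mul0r.
exact: cvg_cst.
Qed.

Section FarField.
Variables (D : nat -> nat -> V3 -> R) (e : V3).
Hypothesis HD : forall n k, density_spec n k (D n k).
Hypothesis D00 : D 0%N 0%N = (fun=> nu).
Hypothesis D01 : D 0%N 1%N = (fun=> 0).
Hypothesis D10 : D 1%N 0%N = (fun=> 0).
Hypothesis Ue : U e.

(** The unscattered beam: a constant density times [r^2] diverges. Hence limits in the extended
    reals, and the separate treatment of this term in [is_cross_section]. *)
Lemma far_field00 : far_field_term hbar D e 0 0 +oo%E.
Proof.
rewrite /far_field_term D00; apply/cvgeryP; apply: gt0_cvgMry; last exact: sqr_cvg_pinfty.
by rewrite expr0 mul1r.
Qed.

(** Each term scales like [r^(2 - (2n+k))]. Decay above two gives zero; decay two occurs at [(0, 2)]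
    and at [(1, 0)], where [D10] applies; decay one, at [(0, 1)], would diverge but for [D01]. *)
Lemma far_field_ne00 n k : (n, k) != (0, 0)%N ->
  far_field_term hbar D e n k (if (n == 0%N) && (k == 2%N) then D 0%N 2%N e else 0)%:E.
Proof.
move=> nk0; have nD := (HD n k); case: nD => nD _ _.
have big : (2 < n.*2 + k)%N -> far_field_term hbar D e n k 0%E.
  move=> d2; apply: (far_field_scale nD Ue); apply: cvg_EFin; first by near=> r.
  rewrite -[X in _ --> X](mulr0 (hbar ^+ n.*2 * D n k e)); apply: cvgM; first exact: cvg_cst.
  exact: pow_ratio_cvg.
case: n nk0 nD big => [|[|n]] nk0 nD big.
- case: k nk0 nD big => [//|[|[|k]]] nk0 nD big; last exact: big.
    exact: far_field_zero.
  apply: (far_field_scale nD Ue); apply: cvg_near_cst; near=> r.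
  have r0 : 0 < r by near: r; exact: nbhs_pinfty_gt.
  by rewrite divff ?mulr1 ?expr0 ?mul1r // expf_neq0 // gt_eqF.
- case: k nk0 nD big => [|k] nk0 nD big; last exact: big.
  exact: far_field_zero.
- by apply: big; rewrite /= !doubleS.
Unshelve. all: by end_near. Qed.

End FarField.

Lemma cross_section_far (D : nat -> nat -> V3 -> R) e sigma :
  (forall n k, (n, k) != (0, 0)%N ->
    far_field_term hbar D e n k (if (n == 0%N) && (k == 2%N) then nu * sigma else 0)%:E) ->
  is_cross_section hbar nu D e sigma.
Proof.
move=> far; exists (fun n k => if (n == 0%N) && (k == 2%N) then nu * sigma else 0); split=> //.
(* From [N = 3] on the double sum contains the index [(0, 2)] and is constant. *)
apply: cvg_near_cst; exists 3%N => // N /= N3.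
have n0 : nu != 0 by rewrite gt_eqF.
rewrite -[RHS](mulfK n0) (mulrC sigma); congr (_ / _).
case: N N3 => [|[|[|N]]] // _.
rewrite big_ord_recl [X in _ + X]big1 ?addr0 => [|i _]; last exact: big1.
by rewrite 3!big_ord_recl big1 ?addr0 ?add0r.
Qed.

(** [|p0| - e.p0 = 2 |p0| sin^2(theta/2)] turns the square in [density2E] into the fourth power of
    the sine. *)
Lemma density2_rutherford (e : V3) : U e -> enorm e = 1 ->
  density2 mu nu kappa p0 e = nu * rutherford kappa mu p0 (angle e p0).
Proof.
move=> Ue e1; rewrite density2E // /rutherford.
have P0 := enorm_gt0 p0_neq0; have g0 := (off_ray_dot p0_neq0 e).1 Ue.
have cE := cos_angle p0_neq0 Ue.
have E2 : angle e p0 / 2 *+ 2 = angle e p0 by rewrite -(mulr_natr (_ / _)); field.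
have := cos_mulr2n (angle e p0 / 2); rewrite E2 cE cos2sin2.
rewrite e1 mulr1 !mul1r in g0 *.
move: (sin _) (dot e p0) (enorm p0) P0 g0 => s d P P0 g0 E.
have Pn : P != 0 by rewrite gt_eqF.
have dE : d = P * (1 - 2 * s ^+ 2).
  by rewrite -[LHS](divfK Pn) E; ring.
have sn : s != 0.
  by apply: contraTneq g0 => s0; rewrite dE s0 expr0n /= mulr0 subr0 mulr1 ltxx.
have dn : P - P * (1 - 2 * s ^+ 2) != 0 by rewrite -dE subr_eq0 gt_eqF.
by rewrite dE; field; rewrite sn Pn.
Qed.

End Assembly.

Unset Implicit Arguments.

Theorem mainTheorem2 (R : realType) (kappa mu nu hbar : R) (p0 : 'rV[R]_3)
    (a : nat -> R)
    (mu_gt0 : 0 < mu) (nu_gt0 : 0 < nu) (hbar_gt0 : 0 < hbar) (p0_neq0 : p0 != 0)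
    (a0 : a 0%N = 1) :
  let rho := rho_coef mu nu p0 (coulomb kappa) (moyal_series a) in
  let rho_cl := rho_coef mu nu p0 (coulomb kappa) (@poisson_series R) in
  let U := off_forward_ray p0 in
  [/\ (forall n k t t' Phi, rho n k t Phi = rho n k t' Phi),
      (forall t Phi, rho 1%N 0%N t Phi = 0),
      (forall k t Phi, rho 0%N k t Phi = rho_cl 0%N k t Phi),
      (forall n k t Phi, (0 < n)%N -> rho_cl n k t Phi = 0)
    & exists D D_cl : nat -> nat -> 'rV[R]_3 -> R,
      [/\ (forall n k t, is_momentum_marginal U (rho n k t) (D n k)),
          (forall n k t, is_momentum_marginal U (rho_cl n k t) (D_cl n k)),
          (forall n k, exists f : R -> R, forall q, U q ->
             D n k q = f (angle q p0) / enorm q ^+ (n.*2 + k)),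
          (forall e, U e -> enorm e = 1 ->
             exists l : nat -> nat -> \bar R,
               [/\ (forall n k, far_field_term hbar D e n k (l n k)),
                   (forall n k, l n k <> 0%E -> (n.*2 + k <= 2)%N),
                   (forall n k, l n k <> 0%E -> n = 0%N /\ (k <= 2)%N)
                 & (forall n k, far_field_term hbar D_cl e n k (l n k))])
        & (forall e, U e -> enorm e = 1 ->
             is_cross_section hbar nu D e (rutherford kappa mu p0 (angle e p0)) /\
             is_cross_section hbar nu D_cl e
               (rutherford kappa mu p0 (angle e p0)))]].
Proof.
set rho := rho_coef _ _ _ _ _; set rho_cl := rho_coef _ _ _ _ _; set U := off_forward_ray p0.
have cl k t Phi : rho 0%N k t Phi = rho_cl 0%N k t Phi by exact: rho_classical.
have cl0 n k t Phi : (0 < n)%N -> rho_cl n k t Phi = 0 by exact: rho_cl_pos.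
split=> //; first by move=> n k t t' Phi; exact: rho_stationary.
have [D [HD D00 D01 D02 D10]] := densities nu kappa mu_gt0 p0_neq0 a0.
(* Row [n = 0] is shared with the generalized bracket; the other classical orders vanish. *)
pose D_cl n k : 'rV[R]_3 -> R := if n == 0%N then D 0%N k else fun=> 0.
have far e (Ue : U e) n k : (n, k) != (0, 0)%N ->
    far_field_term hbar D e n k (if (n == 0%N) && (k == 2%N) then D 0%N 2%N e else 0)%:E.
  exact: far_field_ne00.
have far_cl e (Ue : U e) n k : (n, k) != (0, 0)%N ->
    far_field_term hbar D_cl e n k (if (n == 0%N) && (k == 2%N) then D 0%N 2%N e else 0)%:E.
  case: n => [|n] nk0; first exact: (far e Ue 0%N k nk0).
  exact: far_field_zero.
exists D, D_cl; split.
- by move=> n k t; exact: density_marginal.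
- move=> n k t; case: n => [|n].
    have [c H] := density_marginal t (HD 0%N k).
    by split=> // psi tp; rewrite -H // -cl.
  split=> [q _|psi _]; first exact: (@cont_cst R _ 0).
  rewrite cl0 //; under eq_int3 do rewrite mul0r.
  by rewrite int3_0.
- move=> n k; have [nD aD _] := HD n k; exact: angle_factor.
- move=> e Ue e1.
  (* [+oo] records the unscattered beam; apart from it only the index [(0, 2)] can carry a nonzero
     limit, which gives both restrictions on [n] and [k]. *)
  exists (fun n k => if (n == 0%N) && (k == 0%N) then +oo%E else
     (if (n == 0%N) && (k == 2%N) then D 0%N 2%N e else 0)%:E); split.
  + move=> n k; case: ifPn => [/andP[/eqP -> /eqP ->]|nk]; first exact: (far_field00 hbar nu_gt0 e D00).
    exact: far.
  + by case=> [|n] [|[|[|k]]] //= [].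
  + by case=> [|n] [|[|[|k]]] //= [].
  + move=> n k; case: ifPn => [/andP[/eqP -> /eqP ->]|nk]; first exact: (far_field00 hbar nu_gt0 e D00).
    exact: far_cl.
- move=> e Ue e1; have De := density2_rutherford nu kappa mu_gt0 p0_neq0 Ue e1.
  have F := far e Ue; have F_cl := far_cl e Ue; rewrite D02 De in F F_cl.
  split; [exact: (cross_section_far nu_gt0 F)|exact: (cross_section_far nu_gt0 F_cl)].
Qed.
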